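(* Let $R$ be a commutative artin ring and $(\mathcal{C},\mathbb{E},\mathfrak{s})$ a weakly idempotent complete $R$-linear Ext-finite extriangulated category with enough projectives $\mathcal{Q}$ and enough injectives $\mathcal{J}$ which are both functorially finite in $\mathcal{C}$. Suppose $(\mathcal{C},\mathbb{E},\mathfrak{s})$ has an ARS duality $(\tau,\eta)$, that $\mathcal{C}$ is Krull–Schmidt, and that both $\mathrm{ind}\,\mathcal{Q}$ and $\mathrm{ind}\,\mathcal{J}$ are finite sets. If the preprojectives coincide with the preinjectives (i.e. $\widetilde{\mathcal{P}}=\widetilde{\mathcal{I}}$), then $\widetilde{\mathcal{C}}:=\mathcal{C}/[\widetilde{\mathcal{P}}]$ is a triangulated category and $\tau$ induces a triangulated auto-equivalence on $\widetilde{\mathcal{C}}$.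
   Context: $J$ is the minimal injective cogenerator of the category $\mathrm{mod}R$ of finitely generated $R$-modules and $\mathbb{D}=\mathrm{Hom}_R(-,J)$. Extriangulated categories (Nakaoka–Palu). An $R$-linear extriangulated category is a triplet $(\mathcal{C},\mathbb{E},\mathfrak{s})$ where $\mathcal{C}$ is an $R$-linear additive category, (ET1) $\mathbb{E}:\mathcal{C}^{\rm op}\times\mathcal{C}\to\mathrm{Mod}R$ is an $R$-bilinear functor, (ET2) $\mathfrak{s}$ is an additive realization of $\mathbb{E}$, and (ET3), (ET4) and their duals hold. For $\delta\in\mathbb{E}(C,A)$, $c:C'\to C$, $a:A\to A'$ write $c^*\delta=\mathbb{E}(c,A)(\delta)$, $a_*\delta=\mathbb{E}(C,a)(\delta)$. A morphism $\delta\to\delta'$ from $\delta\in\mathbb{E}(C,A)$ to $\delta'\in\mathbb{E}(C',A')$ is a pair $(a:A\to A',c:C\to C')$ with $a_*\delta=c^*\delta'$. An additive realization assigns to each $\delta\in\mathbb{E}(C,A)$ an equivalence class $\mathfrak{s}(\delta)=[A\to B\to C]$ (sequences equivalent if there is an isomorphism of middle terms compatible with $\mathrm{id}_A,\mathrm{id}_C$) such that each morphism $(a,c):\delta\to\delta'$ extends to a commutative diagram between realizing sequences, $\mathfrak{s}(0)=[A\to A\oplus C\to C]$, and $\mathfrak{s}(\delta\oplus\delta')=\mathfrak{s}(\delta)\oplus\mathfrak{s}(\delta')$. (ET3): if $\mathfrak{s}(\delta)=[A\xrightarrow{x}B\xrightarrow{y}C]$, $\mathfrak{s}(\delta')=[A'\xrightarrow{x'}B'\xrightarrow{y'}C']$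 and $bx=x'a$, there is $c$ with $cy=y'b$ and $(a,c):\delta\to\delta'$ a morphism. (ET4): if $\delta\in\mathbb{E}(D,A)$, $\delta'\in\mathbb{E}(F,B)$ are realized by $A\xrightarrow{f}B\xrightarrow{f'}D$, $B\xrightarrow{g}C\xrightarrow{g'}F$, there are $E$, $d:D\to E$, $e:E\to F$, $h'\colon C\to E$ and $\delta''\in\mathbb{E}(E,A)$ realized by $A\xrightarrow{h=gf}C\xrightarrow{h'}E$ with $h'g=df'$, $eh'=g'$, such that $D\xrightarrow{d}E\xrightarrow{e}F$ realizes $f'_*\delta'$, $d^*\delta''=\delta$, $f_*\delta''=e^*\delta'$. If $\mathfrak{s}(\delta)=[A\xrightarrow{a}B\xrightarrow{b}C]$, then $A\xrightarrow{a}B\xrightarrow{b}C\overset{\delta}{\dashrightarrow}$ is an $\mathfrak{s}$-triangle. Ext-finite: every $\mathbb{E}(C,A)$ is a finitely generated $R$-module. Weakly idempotent complete: every retraction in $\mathcal{C}$ has a kernel. $P$ is projective if $\mathbb{E}(P,-)=0$; $\mathcal{C}$ has enough projectives if every $C$ admits an $\mathfrak{s}$-triangle $A\to P\to C\dashrightarrow$ with $P$ projective; injectives dually. ''Enough projectives $\mathcal{Q}$ / injectives $\mathcal{J}$'' means that $\mathcal{Q}$, $\mathcal{J}$ are the full subcategories of all projective, resp. injective, objects. $\mathrm{ind}\,\mathcal{X}$ is the set of isomorphism classes of indecomposable objects of $\mathcal{X}$. ARS duality. $\mathcal{P}_{\mathbb{E}}$ (resp. $\mathcal{I}_{\mathbb{E}}$)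 is the ideal of morphisms $f$ with $\mathbb{E}(f,-)=0$ (resp. $\mathbb{E}(-,f)=0$); $\underline{\mathcal{C}}=\mathcal{C}/\mathcal{P}_{\mathbb{E}}=\mathcal{C}/[\mathcal{Q}]$, $\overline{\mathcal{C}}=\mathcal{C}/\mathcal{I}_{\mathbb{E}}=\mathcal{C}/[\mathcal{J}]$, where $[\mathcal{X}]$ is the ideal of morphisms factoring through $\mathcal{X}$; $\mathbb{E}$ induces $\underline{\mathcal{C}}^{\rm op}\times\overline{\mathcal{C}}\to\mathrm{Mod}R$. An Auslander–Reiten–Serre (ARS) duality is a pair $(\tau,\eta)$ of an $R$-linear equivalence $\tau:\underline{\mathcal{C}}\to\overline{\mathcal{C}}$ and a binatural isomorphism of $R$-modules $\eta_{A,B}:\underline{\mathcal{C}}(A,B)\simeq\mathbb{D}\mathbb{E}(B,\tau A)$. Preprojectives and preinjectives. $\widetilde{\mathcal{P}}=\mathrm{add}\big(\bigcup_{n\ge0}\tau^{-n}\mathcal{Q}\big)$ and $\widetilde{\mathcal{I}}=\mathrm{add}\big(\bigcup_{n\ge0}\tau^{n}\mathcal{J}\big)$, where $\tau^{-1}$ is a quasi-inverse of $\tau$ and powers are taken on objects (the definition does not depend on the choice of $\tau$). A nonzero object is preprojective (resp. preinjective) if it lies in $\widetilde{\mathcal{P}}$ (resp. $\widetilde{\mathcal{I}}$). ''$\tau$ induces'' refers to the functor $\widetilde{\mathcal{C}}\to\widetilde{\mathcal{C}}$ obtained by factoring $\underline{\mathcal{C}}\xrightarrow{\tau}\overline{\mathcal{C}}\to\widetilde{\mathcal{C}}$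 through the canonical functor $\underline{\mathcal{C}}\to\widetilde{\mathcal{C}}$. *)

(* Defs.v *)
From HB Require Import structures.
From mathcomp Require Import all_boot all_order all_algebra.
From mathcomp Require Import generic_quotient ring_quotient.
From mathcomp Require Import boolp classical_sets cardinality.

Set Implicit Arguments.
Unset Strict Implicit.
Unset Printing Implicit Defensive.

Import GRing.Theory.

Local Open Scope classical_set_scope.
Local Open Scope quotient_scope.
Local Open Scope ring_scope.

Definition submodule (R : pzRingType) (V : lmodType R) (S : V -> Prop) : Prop :=
  S 0 /\ forall (a : R) u v, S u -> S v -> S (a *: u + v).

Definition artinian (R : comPzRingType) : Prop :=
  forall I : nat -> set R^o,
    (forall n, submodule (I n)) -> (forall n, I n.+1 `<=` I n) ->
    exists N, forall n, (N <= n)%N -> I n = I N.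

Definition fin_gen (R : pzRingType) (V : lmodType R) : Prop :=
  exists (n : nat) (e : 'I_n -> V),
    forall v, exists c : 'I_n -> R, v = \sum_(i < n) c i *: e i.

Section InjectiveCogenerator.
Variables (R : comPzRingType) (J : lmodType R).

Definition injective_in_mod : Prop :=
  forall M N : lmodType R, fin_gen M -> fin_gen N ->
  forall (i : {linear M -> N}) (f : {linear M -> J}), injective i ->
  exists g : {linear N -> J}, forall m, g (i m) = f m.

Definition cogenerates_mod : Prop :=
  forall M N : lmodType R, fin_gen M -> fin_gen N ->
  forall h : {linear M -> N}, (exists m, h m <> 0) ->
  exists (f : {linear N -> J}) (m : M), f (h m) <> 0.

Definition inj_cogenerator : Prop :=
  [/\ fin_gen J, injective_in_mod & cogenerates_mod].

End InjectiveCogenerator.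

(* Minimality: J is a direct summand of every injective cogenerator. *)
Definition min_inj_cogenerator (R : comPzRingType) (J : lmodType R) : Prop :=
  inj_cogenerator J /\
  forall J' : lmodType R, inj_cogenerator J' ->
    exists (i : {linear J -> J'}) (r : {linear J' -> J}), cancel i r.

Section QuotientModule.
Variables (R : pzRingType) (V : lmodType R) (S : V -> Prop) (HS : submodule S).

Definition submod_pred of submodule S : {pred V} := fun v => `[< S v >].

Lemma submod_pred_closed : zmod_closed (submod_pred HS).
Proof.
have [S0 Slin] := HS; split=> [|u v /asboolP Su /asboolP Sv]; apply/asboolP => //.
by rewrite addrC -scaleN1r; exact: Slin.
Qed.

HB.instance Definition _ :=
  GRing.isZmodClosed.Build V (submod_pred HS) submod_pred_closed.

Definition submod_closedV : zmodClosed V :=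
  GRing.ZmodClosed.clone V (submod_pred HS) _.

Definition lquot : Type := (Quotient.quot submod_closedV).
HB.instance Definition _ := GRing.Zmodule.on lquot.
HB.instance Definition _ := EqQuotient.on lquot.

Definition to_lquot (v : V) : lquot := \pi_(Quotient.quot submod_closedV) v.

Lemma lquotP u v : to_lquot u = to_lquot v <-> S (u - v).
Proof.
have -> : S (u - v) <-> (u - v) \in submod_closedV.
  by rewrite [X in _ <-> is_true X]unfold_in; split=> /asboolP.
by rewrite Quotient.idealrBE; split=> [/eqP | /eqP].
Qed.

Lemma to_lquot_surj (q : lquot) : exists v, q = to_lquot v.
Proof. by exists (repr q); rewrite /to_lquot reprK. Qed.

Lemma to_lquotD u v : to_lquot (u + v) = to_lquot u + to_lquot v.
Proof. exact: (raddfD (\pi_(Quotient.quot submod_closedV) : {additive V -> _})). Qed.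

Definition scale_lquot (a : R) (q : lquot) : lquot := to_lquot (a *: repr q).

Lemma scale_to_lquot a v : scale_lquot a (to_lquot v) = to_lquot (a *: v).
Proof.
apply/lquotP; rewrite -scalerBr -[_ *: _]addr0; have [S0 Slin] := HS.
by apply: (Slin) => //; apply/lquotP; rewrite /to_lquot reprK.
Qed.

Fact scale_lquotA a b q : scale_lquot a (scale_lquot b q) = scale_lquot (a * b) q.
Proof.
by have [v ->] := to_lquot_surj q; rewrite !scale_to_lquot scalerA.
Qed.
Fact scale_lquot1 : left_id 1 scale_lquot.
Proof.
by move=> q; have [v ->] := to_lquot_surj q; rewrite scale_to_lquot scale1r.
Qed.
Fact scale_lquotDr : right_distributive scale_lquot +%R.
Proof.
move=> a q q'; have [v ->] := to_lquot_surj q; have [v' ->] := to_lquot_surj q'.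
by rewrite -to_lquotD !scale_to_lquot scalerDr to_lquotD.
Qed.
Fact scale_lquotDl q : {morph scale_lquot^~ q : a b / a + b}.
Proof.
move=> a b /=; have [v ->] := to_lquot_surj q.
by rewrite !scale_to_lquot scalerDl to_lquotD.
Qed.
HB.instance Definition _ := GRing.Zmodule_isLmodule.Build R lquot
  scale_lquotA scale_lquot1 scale_lquotDr scale_lquotDl.

Lemma to_lquot_linear : linear to_lquot.
Proof. by move=> a u v; rewrite to_lquotD -scale_to_lquot. Qed.

End QuotientModule.

Record linCat (R : comPzRingType) := LinCat {
  obj :> Type;
  hom : obj -> obj -> lmodType R;
  idm : forall X, hom X X;
  compm : forall X Y Z, hom Y Z -> hom X Y -> hom X Z;
  comp_linear_l : forall X Y Z (f : hom X Y), linear (fun g : hom Y Z => compm g f);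
  comp_linear_r : forall X Y Z (g : hom Y Z), linear (fun f : hom X Y => compm g f);
  compmA : forall X Y Z W (h : hom Z W) (g : hom Y Z) (f : hom X Y),
    compm h (compm g f) = compm (compm h g) f;
  comp1m : forall X Y (f : hom X Y), compm (idm Y) f = f;
  compm1 : forall X Y (f : hom X Y), compm f (idm X) = f }.

Arguments hom {R} C X Y : rename.
Arguments idm {R C} X : rename.
Arguments compm {R C X Y Z} g f : rename.

Notation "X ~> Y" := (hom _ X Y) (at level 99, Y at level 200).
Notation "X ~>[ C ] Y" := (hom C X Y)
  (at level 99, C at level 0, Y at level 200, format "X  ~>[ C ]  Y").
Notation "g \oc f" := (compm g f) (at level 40, left associativity).

Section CategoryNotions.
Variables (R : comPzRingType) (C : linCat R).

Definition is_iso (X Y : C) (f : X ~> Y) : Prop :=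
  exists g : Y ~> X, g \oc f = idm X /\ f \oc g = idm Y.

Definition isomorphic (X Y : C) : Prop := exists f : X ~> Y, is_iso f.

Definition is_zero (X : C) : Prop := idm X = 0.

Definition is_biprod (A B S : C) (iA : A ~> S) (iB : B ~> S)
    (pA : S ~> A) (pB : S ~> B) : Prop :=
  [/\ pA \oc iA = idm A, pB \oc iB = idm B, pA \oc iB = 0, pB \oc iA = 0
    & iA \oc pA + iB \oc pB = idm S].

Definition is_sum (A B S : C) : Prop :=
  exists (iA : A ~> S) (iB : B ~> S) (pA : S ~> A) (pB : S ~> B),
    is_biprod iA iB pA pB.

Definition is_additive : Prop :=
  (exists X, is_zero X) /\ forall A B, exists S, is_sum A B S.

Definition is_finsum (n : nat) (F : 'I_n -> C) (S : C) : Prop :=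
  exists (i : forall k, F k ~> S) (p : forall k, S ~> F k),
    [/\ forall k, p k \oc i k = idm (F k),
        forall k l, k != l -> p l \oc i k = 0
      & \sum_(k < n) (i k \oc p k) = idm S].

Definition indecomposable (X : C) : Prop :=
  ~ is_zero X /\ forall A B, is_sum A B X -> is_zero A \/ is_zero B.

Definition local_end (X : C) : Prop :=
  ~ is_zero X /\
  forall f g : X ~> X, is_iso (f + g) -> is_iso f \/ is_iso g.

Definition krull_schmidt : Prop :=
  forall X, exists (n : nat) (F : 'I_n -> C),
    is_finsum F X /\ forall k, local_end (F k).

Definition ind (P : set C) : set (set C) :=
  [set isomorphic X | X in [set X | indecomposable X /\ P X]].

Definition is_kernel (X Y K : C) (r : X ~> Y) (k : K ~> X) : Prop :=
  r \oc k = 0 /\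
  forall Z (z : Z ~> X), r \oc z = 0 -> exists! w : Z ~> K, k \oc w = z.

Definition weakly_idempotent_complete : Prop :=
  forall (X Y : C) (r : X ~> Y), (exists s : Y ~> X, r \oc s = idm Y) ->
  exists (K : C) (k : K ~> X), is_kernel r k.

Definition contravariantly_finite (P : set C) : Prop :=
  forall X : C, exists (Z : C) (f : Z ~> X), P Z /\
    forall Z' (f' : Z' ~> X), P Z' -> exists g : Z' ~> Z, f' = f \oc g.

Definition covariantly_finite (P : set C) : Prop :=
  forall X : C, exists (Z : C) (f : X ~> Z), P Z /\
    forall Z' (f' : X ~> Z'), P Z' -> exists g : Z ~> Z', f' = g \oc f.

Definition functorially_finite (P : set C) : Prop :=
  contravariantly_finite P /\ covariantly_finite P.

(* The smallest full subcategory containing P and closed under finite direct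
   sums and direct summands (closure under isomorphism follows: an object
   isomorphic to A is a direct sum of A and a zero object). *)
Inductive add_hull (P : set C) : C -> Prop :=
| add_in X : P X -> add_hull P X
| add_zero X : is_zero X -> add_hull P X
| add_sum A B S : is_sum A B S -> add_hull P A -> add_hull P B -> add_hull P S
| add_summand A B S : is_sum A B S -> add_hull P S -> add_hull P A.

Definition factors_through (P : set C) (X Y : C) (f : X ~> Y) : Prop :=
  exists (Z : C) (a : X ~> Z) (b : Z ~> Y), P Z /\ f = b \oc a.

Lemma compDl X Y Z (g h : Y ~>[C] Z) (f : X ~> Y) :
  (g + h) \oc f = g \oc f + h \oc f.
Proof. by have := comp_linear_l f 1 g h; rewrite !scale1r. Qed.

Lemma compDr X Y Z (g : Y ~>[C] Z) (f h : X ~> Y) :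
  g \oc (f + h) = g \oc f + g \oc h.
Proof. by have := comp_linear_r g 1 f h; rewrite !scale1r. Qed.

Lemma comp0l X Y Z (f : X ~>[C] Y) : (0 : Y ~> Z) \oc f = 0.
Proof. by apply: (addrI (0 \oc f)); rewrite -compDl !addr0. Qed.

Lemma comp0r X Y Z (g : Y ~>[C] Z) : g \oc (0 : X ~> Y) = 0.
Proof. by apply: (addrI (g \oc 0)); rewrite -compDr !addr0. Qed.

Lemma compZl X Y Z a (g : Y ~>[C] Z) (f : X ~> Y) :
  (a *: g) \oc f = a *: (g \oc f).
Proof. by have := comp_linear_l f a g 0; rewrite comp0l !addr0. Qed.

Lemma compZr X Y Z a (g : Y ~>[C] Z) (f : X ~> Y) :
  g \oc (a *: f) = a *: (g \oc f).
Proof. by have := comp_linear_r g a f 0; rewrite comp0r !addr0. Qed.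

End CategoryNotions.

Section Opposite.
Variables (R : comPzRingType) (C : linCat R).

Definition op : linCat R := {|
  obj := C;
  hom X Y := Y ~>[C] X;
  idm X := idm X;
  compm X Y Z g f := f \oc g;
  comp_linear_l X Y Z f := comp_linear_r f;
  comp_linear_r X Y Z g := comp_linear_l g;
  compmA X Y Z W h g f := esym (compmA f g h);
  comp1m X Y f := compm1 f;
  compm1 X Y f := comp1m f |}.

End Opposite.

Section Functors.
Variable R : comPzRingType.

Definition is_functor (C D : linCat R) (F0 : C -> D)
    (F1 : forall X Y : C, (X ~> Y) -> (F0 X ~> F0 Y)) : Prop :=
  [/\ forall X Y, linear (@F1 X Y),
      forall X, F1 X X (idm X) = idm (F0 X)
    & forall X Y Z (g : Y ~> Z) (f : X ~> Y),
        F1 X Z (g \oc f) = F1 Y Z g \oc F1 X Y f].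

Record functor (C D : linCat R) := Functor {
  fobj :> C -> D;
  fmor : forall X Y : C, (X ~> Y) -> (fobj X ~> fobj Y);
  functorP : is_functor fmor }.

Arguments Functor {C D fobj fmor} functorP.
Arguments fmor {C D} F {X Y} f : rename.

Fact fid_subproof (C : linCat R) :
  is_functor (F0 := fun X : C => X) (fun X Y f => f).
Proof. by split. Qed.
Definition fid (C : linCat R) : functor C C := Functor (fid_subproof C).

Fact fcomp_subproof (C D E : linCat R) (G : functor D E) (F : functor C D) :
  is_functor (F0 := fun X => G (F X)) (fun X Y f => fmor G (fmor F f)).
Proof.
have [Gl G1 Gc] := functorP G; have [Fl F1 Fc] := functorP F.
by split=> [X Y a f g|X|X Y Z g f] /=; rewrite ?Fl ?Gl ?F1 ?G1 ?Fc ?Gc.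
Qed.
Definition fcomp (C D E : linCat R) (G : functor D E) (F : functor C D) :
  functor C E := Functor (fcomp_subproof G F).

Definition is_nat_iso (C D : linCat R) (F G : functor C D)
    (phi : forall X, F X ~> G X) : Prop :=
  (forall X, is_iso (phi X)) /\
  forall X Y (f : X ~> Y), phi Y \oc fmor F f = fmor G f \oc phi X.

Definition nat_isomorphic (C D : linCat R) (F G : functor C D) : Prop :=
  exists phi : forall X, F X ~> G X, is_nat_iso phi.

Definition quasi_inverse (C D : linCat R) (F : functor C D) (G : functor D C) :
    Prop :=
  nat_isomorphic (fcomp G F) (fid C) /\ nat_isomorphic (fcomp F G) (fid D).

Definition is_equivalence (C D : linCat R) (F : functor C D) : Prop :=
  exists G : functor D C, quasi_inverse F G.

End Functors.

Arguments Functor {R C D fobj fmor} functorP.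
Arguments fmor {R C D} F {X Y} f : rename.

Section Ideals.
Variables (R : comPzRingType) (C : linCat R).

Record ideal := Ideal {
  in_ideal : forall X Y : C, (X ~> Y) -> Prop;
  ideal_submod : forall X Y, submodule (@in_ideal X Y);
  ideal_comp : forall X Y Z W (h : Z ~> W) (f : Y ~> Z) (g : X ~> Y),
    in_ideal f -> in_ideal (h \oc f \oc g) }.

Variable I : ideal.

Let Q (X Y : C) : lmodType R := lquot (ideal_submod I X Y).
Let pi (X Y : C) (f : X ~> Y) : Q X Y := to_lquot (ideal_submod I X Y) f.

Definition quot_comp X Y Z (g : Q Y Z) (f : Q X Y) : Q X Z :=
  pi (repr g \oc repr f).

Lemma quot_comp_pi X Y Z (g : Y ~> Z) (f : X ~> Y) :
  quot_comp (pi g) (pi f) = pi (g \oc f).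
Proof.
have [_ lin] := ideal_submod I X Z.
apply/lquotP; set g' := repr _; set f' := repr _.
have Hg : in_ideal I (g' - g).
  by apply/(lquotP (ideal_submod I Y Z)); rewrite /g' /to_lquot reprK.
have Hf : in_ideal I (f' - f).
  by apply/(lquotP (ideal_submod I X Y)); rewrite /f' /to_lquot reprK.
have -> : g' \oc f' - g \oc f
    = 1 *: (idm Z \oc (g' - g) \oc f') + (g \oc (f' - f)) \oc idm X.
  rewrite scale1r comp1m compm1 -!scaleN1r compDl compDr compZl compZr.
  by rewrite !scaleN1r addrA subrK.
by apply: lin; apply: ideal_comp.
Qed.

Fact quot_linear_l X Y Z (f : Q X Y) : linear (fun g : Q Y Z => quot_comp g f).
Proof.
move=> a g h; have [f0 ->] := to_lquot_surj f; have [g0 ->] := to_lquot_surj g.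
have [h0 ->] := to_lquot_surj h; rewrite -to_lquot_linear !quot_comp_pi.
by rewrite -to_lquot_linear comp_linear_l.
Qed.
Fact quot_linear_r X Y Z (g : Q Y Z) : linear (fun f : Q X Y => quot_comp g f).
Proof.
move=> a f h; have [f0 ->] := to_lquot_surj f; have [g0 ->] := to_lquot_surj g.
have [h0 ->] := to_lquot_surj h; rewrite -to_lquot_linear !quot_comp_pi.
by rewrite -to_lquot_linear comp_linear_r.
Qed.
Fact quot_compA X Y Z W (h : Q Z W) (g : Q Y Z) (f : Q X Y) :
  quot_comp h (quot_comp g f) = quot_comp (quot_comp h g) f.
Proof.
have [f0 ->] := to_lquot_surj f; have [g0 ->] := to_lquot_surj g.
have [h0 ->] := to_lquot_surj h; rewrite (quot_comp_pi g0 f0).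
by rewrite (quot_comp_pi h0 g0) (quot_comp_pi h0) (quot_comp_pi _ f0) compmA.
Qed.
Fact quot_comp1m X Y (f : Q X Y) : quot_comp (pi (idm Y)) f = f.
Proof. by have [f0 ->] := to_lquot_surj f; rewrite !quot_comp_pi comp1m. Qed.
Fact quot_compm1 X Y (f : Q X Y) : quot_comp f (pi (idm X)) = f.
Proof. by have [f0 ->] := to_lquot_surj f; rewrite !quot_comp_pi compm1. Qed.

Definition quotCat : linCat R := {|
  obj := C;
  hom := Q;
  idm X := pi (idm X);
  compm := quot_comp;
  comp_linear_l := quot_linear_l;
  comp_linear_r := quot_linear_r;
  compmA := quot_compA;
  comp1m := quot_comp1m;
  compm1 := quot_compm1 |}.

Definition quot_mor (X Y : C) (f : X ~> Y) : X ~>[quotCat] Y := pi f.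

Lemma quot_mor_eq X Y (f g : X ~>[C] Y) :
  quot_mor f = quot_mor g <-> in_ideal I (f - g).
Proof. exact: lquotP. Qed.

Lemma quot_mor_functor : is_functor (C := C) (D := quotCat) quot_mor.
Proof.
split=> [X Y|//|X Y Z g f]; first exact: to_lquot_linear.
by rewrite /quot_mor -quot_comp_pi.
Qed.

Definition quot_functor : functor C quotCat := Functor quot_mor_functor.

End Ideals.

Arguments quot_mor {R C} I {X Y} f.

(* The ideal of the morphisms that factor through an object of add_hull P. *)
Section AddIdeal.
Variables (R : comPzRingType) (C : linCat R).
Hypothesis addC : is_additive C.
Variable P : set C.

Fact add_ideal_submod X Y : submodule (@factors_through R C (add_hull P) X Y).
Proof.
have [[O zO] sums] := addC; split.
  by exists O, 0, 0; split; [exact: add_zero | rewrite comp0l].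
move=> r f g [Z [a [b [PZ ->]]]] [W [c [d [PW ->]]]].
have [S [iZ [iW [pZ [pW]]]]] := sums Z W; move=> Sum.
have [e1 e2 e3 e4 _] := Sum.
exists S, (iZ \oc a + iW \oc c), (r *: (b \oc pZ) + d \oc pW); split.
  by apply: add_sum PZ PW; exists iZ, iW, pZ, pW.
rewrite compDl compZl !compDr -!compmA.
rewrite (compmA pZ iZ) (compmA pZ iW) (compmA pW iZ) (compmA pW iW).
by rewrite e1 e2 e3 e4 !comp0l !comp1m !comp0r addr0 add0r.
Qed.

Fact add_ideal_comp X Y Z W (h : Z ~>[C] W) (f : Y ~> Z) (g : X ~> Y) :
  factors_through (add_hull P) f -> factors_through (add_hull P) (h \oc f \oc g).
Proof.
move=> [T [a [b [PT ->]]]]; exists T, (a \oc g), (h \oc b); split=> //.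
by rewrite !compmA.
Qed.

Definition add_ideal : ideal C := Ideal add_ideal_submod add_ideal_comp.

End AddIdeal.

Section Bifunctor.
Variables (R : comPzRingType).

(* An R-bilinear functor E : C^op x C -> Mod R; push is a_*, pull is c^*. *)
Record bifunctor (C : linCat R) := Bifunctor {
  ext :> C -> C -> lmodType R;
  push : forall X A A', (A ~> A') -> ext X A -> ext X A';
  pull : forall X X' A, (X' ~> X) -> ext X A -> ext X' A;
  push_linear : forall X A A' (a : A ~> A'), linear (@push X A A' a);
  pull_linear : forall X X' A (c : X' ~> X), linear (@pull X X' A c);
  push_linear_mor : forall X A A' (d : ext X A),
    linear (fun a : A ~> A' => push a d);
  pull_linear_mor : forall X X' A (d : ext X A),
    linear (fun c : X' ~> X => pull c d);
  push_id : forall X A (d : ext X A), push (idm A) d = d;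
  pull_id : forall X A (d : ext X A), pull (idm X) d = d;
  push_comp : forall X A A' A'' (a' : A' ~> A'') (a : A ~> A') (d : ext X A),
    push (a' \oc a) d = push a' (push a d);
  pull_comp : forall X X' X'' A (c : X' ~> X) (c' : X'' ~> X') (d : ext X A),
    pull (c \oc c') d = pull c' (pull c d);
  push_pull : forall X X' A A' (a : A ~> A') (c : X' ~> X) (d : ext X A),
    push a (pull c d) = pull c (push a d) }.

Definition bifunctor_op (C : linCat R) (E : bifunctor C) : bifunctor (op C) :=
  @Bifunctor (op C) (fun X A => E A X)
    (fun X A A' a d => @pull C E A A' X a d)
    (fun X X' A c d => @push C E A X X' c d)
    (fun X A A' a => @pull_linear C E A A' X a)
    (fun X X' A c => @push_linear C E A X X' c)
    (fun X A A' d => @pull_linear_mor C E A A' X d)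
    (fun X X' A d => @push_linear_mor C E A X X' d)
    (fun X A d => @pull_id C E A X d)
    (fun X A d => @push_id C E A X d)
    (fun X A A' A'' a' a d => @pull_comp C E A A' A'' X a a' d)
    (fun X X' X'' A c c' d => @push_comp C E A X X' X'' c' c d)
    (fun X X' A A' a c d => esym (@push_pull C E A A' X X' c a d)).

End Bifunctor.

Arguments push {R C} b {X A A'} a d.
Arguments pull {R C} b {X X' A} c d.

Section Realization.
Variables (R : comPzRingType) (C : linCat R) (E : bifunctor C).

(* s d x y : the sequence A -x-> B -y-> X belongs to the class s(d). *)
Definition realization :=
  forall (X A : C) (d : E X A) (B : C), (A ~> B) -> (B ~> X) -> Prop.

Variable s : realization.

Definition seq_equiv (A B B' X : C) (x : A ~> B) (y : B ~> X)
    (x' : A ~> B') (y' : B' ~> X) : Prop :=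
  exists b : B ~> B', [/\ is_iso b, b \oc x = x' & y' \oc b = y].

Definition realizes_classes : Prop :=
  forall (X A : C) (d : E X A), exists (B : C) (x : A ~> B) (y : B ~> X),
  forall (B' : C) (x' : A ~> B') (y' : B' ~> X),
    s d x' y' <-> seq_equiv x y x' y'.

Definition realizes_morphisms : Prop :=
  forall (X A X' A' : C) (d : E X A) (d' : E X' A') (B B' : C)
    (x : A ~> B) (y : B ~> X) (x' : A' ~> B') (y' : B' ~> X')
    (a : A ~> A') (c : X ~> X'),
  s d x y -> s d' x' y' -> push E a d = pull E c d' ->
  exists b : B ~> B', b \oc x = x' \oc a /\ y' \oc b = c \oc y.

Definition realizes_zero : Prop :=
  forall (A X S : C) (iA : A ~> S) (iX : X ~> S) (pA : S ~> A) (pX : S ~> X),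
  is_biprod iA iX pA pX -> s (0 : E X A) iA pX.

(* The element of E(X (+) X', A (+) A') corresponding to (d, 0, 0, d'). *)
Definition ext_sum (A A' SA : C) (iA : A ~> SA) (iA' : A' ~> SA)
    (X X' SX : C) (pX : SX ~> X) (pX' : SX ~> X')
    (d : E X A) (d' : E X' A') : E SX SA :=
  push E iA (pull E pX d) + push E iA' (pull E pX' d').

Definition realizes_sums : Prop :=
  forall (A A' SA : C) (iA : A ~> SA) (iA' : A' ~> SA)
    (pA : SA ~> A) (pA' : SA ~> A')
    (B B' SB : C) (iB : B ~> SB) (iB' : B' ~> SB)
    (pB : SB ~> B) (pB' : SB ~> B')
    (X X' SX : C) (iX : X ~> SX) (iX' : X' ~> SX)
    (pX : SX ~> X) (pX' : SX ~> X')
    (d : E X A) (d' : E X' A')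
    (x : A ~> B) (y : B ~> X) (x' : A' ~> B') (y' : B' ~> X'),
  is_biprod iA iA' pA pA' -> is_biprod iB iB' pB pB' ->
  is_biprod iX iX' pX pX' ->
  s d x y -> s d' x' y' ->
  s (ext_sum iA iA' pX pX' d d')
    (iB \oc x \oc pA + iB' \oc x' \oc pA')
    (iX \oc y \oc pB + iX' \oc y' \oc pB').

Definition additive_realization : Prop :=
  [/\ realizes_classes, realizes_morphisms, realizes_zero & realizes_sums].

Definition ET3 : Prop :=
  forall (X A X' A' : C) (d : E X A) (d' : E X' A') (B B' : C)
    (x : A ~> B) (y : B ~> X) (x' : A' ~> B') (y' : B' ~> X')
    (a : A ~> A') (b : B ~> B'),
  s d x y -> s d' x' y' -> b \oc x = x' \oc a ->
  exists c : X ~> X', c \oc y = y' \oc b /\ push E a d = pull E c d'.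

Definition ET4 : Prop :=
  forall (A B D X F : C) (d : E D A) (d' : E F B)
    (f : A ~> B) (f' : B ~> D) (g : B ~> X) (g' : X ~> F),
  s d f f' -> s d' g g' ->
  exists (G : C) (u : D ~> G) (v : G ~> F) (h' : X ~> G) (d'' : E G A),
    s d'' (g \oc f) h' /\
    h' \oc g = u \oc f' /\ v \oc h' = g' /\
    s (push E f' d') u v /\
    pull E u d'' = d /\ push E f d'' = pull E v d'.

End Realization.

Definition realization_op (R : comPzRingType) (C : linCat R) (E : bifunctor C)
    (s : realization E) : realization (bifunctor_op E) :=
  fun X A d B x y => @s A X d B y x.

Record extriCat (R : comPzRingType) := ExtriCat {
  ecat :> linCat R;
  ecat_additive : is_additive ecat;
  EE : bifunctor ecat;
  realz : realization EE;
  real_additive : additive_realization realz;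
  real_ET3 : ET3 realz;
  real_ET3op : ET3 (realization_op realz);
  real_ET4 : ET4 realz;
  real_ET4op : ET4 (realization_op realz) }.

Arguments EE {R} C : rename.
Arguments realz {R} C {X A} d {B} x y : rename.

Section ExtriNotions.
Variables (R : comPzRingType) (C : extriCat R).

Definition ext_finite : Prop := forall X A : C, fin_gen (EE C X A).

Definition projective : set C := [set P | forall A (d : EE C P A), d = 0].

Definition injectiveo : set C := [set I | forall X (d : EE C X I), d = 0].

Definition enough_projectives : Prop :=
  forall X : C, exists (A P : C) (d : EE C X A) (x : A ~> P) (y : P ~> X),
    realz C d x y /\ projective P.

Definition enough_injectives : Prop :=
  forall A : C, exists (X I : C) (d : EE C X A) (x : A ~> I) (y : I ~> X),
    realz C d x y /\ injectiveo I.

Fact proj_ideal_submod (X Y : C) : submodule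
  (fun f : X ~> Y => forall A (d : EE C Y A), pull (EE C) f d = 0).
Proof.
have lin A (d : EE C Y A) := pull_linear_mor (X' := X) d; split.
  move=> A d; have := lin A d (-1) 0 0.
  by rewrite scaler0 addr0 scaleN1r addNr.
by move=> a f g Hf Hg A d; rewrite lin Hf Hg scaler0 addr0.
Qed.

Fact proj_ideal_comp (X Y Z W : C) (h : Z ~> W) (f : Y ~> Z) (g : X ~> Y) :
  (forall A (d : EE C Z A), pull (EE C) f d = 0) ->
  forall A (d : EE C W A), pull (EE C) (h \oc f \oc g) d = 0.
Proof.
move=> Hf A d; rewrite !pull_comp Hf.
by have := pull_linear (b := EE C) (A := A) g (-1) 0 0; rewrite scaler0 addr0 scaleN1r addNr.
Qed.

Definition proj_ideal : ideal C := Ideal proj_ideal_submod proj_ideal_comp.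

Fact inj_ideal_submod (X Y : C) : submodule
  (fun f : X ~> Y => forall A (d : EE C A X), push (EE C) f d = 0).
Proof.
have lin A (d : EE C A X) := push_linear_mor (A' := Y) d; split.
  move=> A d; have := lin A d (-1) 0 0.
  by rewrite scaler0 addr0 scaleN1r addNr.
by move=> a f g Hf Hg A d; rewrite lin Hf Hg scaler0 addr0.
Qed.

Fact inj_ideal_comp (X Y Z W : C) (h : Z ~> W) (f : Y ~> Z) (g : X ~> Y) :
  (forall A (d : EE C A Y), push (EE C) f d = 0) ->
  forall A (d : EE C A X), push (EE C) (h \oc f \oc g) d = 0.
Proof.
move=> Hf A d; rewrite !push_comp Hf.
by have := push_linear (b := EE C) (X := A) h (-1) 0 0; rewrite scaler0 addr0 scaleN1r addNr.
Qed.

Definition inj_ideal : ideal C := Ideal inj_ideal_submod inj_ideal_comp.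

Definition stableP : linCat R := quotCat proj_ideal.
Definition stableI : linCat R := quotCat inj_ideal.

End ExtriNotions.

Arguments projective {R} C.
Arguments injectiveo {R} C.
Arguments proj_ideal {R} C.
Arguments inj_ideal {R} C.
Arguments stableP {R} C.
Arguments stableI {R} C.

(* [ars_eta A B f] is an element of Hom_R(E(B, tau A), J); the module structure
   of that Hom is the pointwise one. In [ars_nat_l] the induced action of
   tau(a), a morphism of C/I_E, on E(B, -) is computed on a representative t. *)
Record ARS_duality (R : comPzRingType) (J : lmodType R) (C : extriCat R) :=
  ARSDuality {
  tau :> functor (stableP C) (stableI C);
  tau_equiv : is_equivalence tau;
  ars_eta : forall A B : C,
    (A ~>[stableP C] B) -> {linear EE C B (tau A) -> J};
  ars_linear : forall A B (r : R) (f g : A ~>[stableP C] B) d,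
    ars_eta (r *: f + g) d = r *: ars_eta f d + ars_eta g d;
  ars_inj : forall A B (f g : A ~>[stableP C] B),
    (forall d, ars_eta f d = ars_eta g d) -> f = g;
  ars_surj : forall A B (phi : {linear EE C B (tau A) -> J}),
    exists f : A ~>[stableP C] B, forall d, ars_eta f d = phi d;
  ars_nat_l : forall (A A' B : C) (f : A ~>[stableP C] B)
      (a : A' ~>[stableP C] A) (t : (tau A' : C) ~>[C] (tau A : C)),
    quot_mor (inj_ideal C) t = fmor tau a ->
    forall d : EE C B (tau A'), ars_eta (f \oc a) d = ars_eta f (push (EE C) t d);
  ars_nat_r : forall (A B B' : C) (f : A ~>[stableP C] B) (b : B ~>[C] B')
      (d : EE C B' (tau A)),
    ars_eta ((quot_mor (proj_ideal C) b : B ~>[stableP C] B') \oc f) d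
    = ars_eta f (pull (EE C) b d) }.

Arguments tau {R J C} D : rename.

Section Preprojectives.
Variables (R : comPzRingType) (C : extriCat R).
Variables (F : functor (stableP C) (stableI C)) (G : functor (stableI C) (stableP C)).

Definition inverse_translates : set C :=
  [set X | exists (n : nat) (P : C), projective C P /\ X = iter n G P].

Definition translates : set C :=
  [set X | exists (n : nat) (I : C), injectiveo C I /\ X = iter n F I].

Definition preprojectives : set C := add_hull inverse_translates.
Definition preinjectives : set C := add_hull translates.

Definition preprojective_ideal : ideal C :=
  add_ideal (ecat_additive C) inverse_translates.

Lemma preprojective_idealE (X Y : C) (f : X ~> Y) :
  in_ideal preprojective_ideal f = factors_through preprojectives f.
Proof. by []. Qed.

End Preprojectives.

Record triangulation (R : comPzRingType) (T : linCat R) := Triangulation {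
  tri_additive : is_additive T;
  shift : functor T T;
  shift_equiv : is_equivalence shift;
  dist : forall X Y Z : T, (X ~> Y) -> (Y ~> Z) -> (Z ~> shift X) -> Prop;
  dist_iso : forall X Y Z X' Y' Z' (f : X ~> Y) (g : Y ~> Z) (h : Z ~> shift X)
      (f' : X' ~> Y') (g' : Y' ~> Z') (h' : Z' ~> shift X')
      (a : X ~> X') (b : Y ~> Y') (c : Z ~> Z'),
    is_iso a -> is_iso b -> is_iso c ->
    b \oc f = f' \oc a -> c \oc g = g' \oc b -> fmor shift a \oc h = h' \oc c ->
    dist f g h -> dist f' g' h';
  dist_id : forall X Z : T, is_zero Z ->
    dist (idm X) (0 : X ~> Z) (0 : Z ~> shift X);
  dist_cone : forall X Y (f : X ~> Y),
    exists (Z : T) (g : Y ~> Z) (h : Z ~> shift X), dist f g h;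
  dist_rot : forall X Y Z (f : X ~> Y) (g : Y ~> Z) (h : Z ~> shift X),
    dist f g h <-> dist g h (- fmor shift f);
  dist_mor : forall X Y Z X' Y' Z' (f : X ~> Y) (g : Y ~> Z) (h : Z ~> shift X)
      (f' : X' ~> Y') (g' : Y' ~> Z') (h' : Z' ~> shift X')
      (a : X ~> X') (b : Y ~> Y'),
    dist f g h -> dist f' g' h' -> b \oc f = f' \oc a ->
    exists c : Z ~> Z', c \oc g = g' \oc b /\ fmor shift a \oc h = h' \oc c;
  dist_oct : forall (X Y Z Z' X' Y' : T)
      (f : X ~> Y) (f' : Y ~> Z') (f'' : Z' ~> shift X)
      (g : Y ~> Z) (g' : Z ~> X') (g'' : X' ~> shift Y)
      (h' : Z ~> Y') (h'' : Y' ~> shift X),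
    dist f f' f'' -> dist g g' g'' -> dist (g \oc f) h' h'' ->
    exists (u : Z' ~> Y') (v : Y' ~> X'),
      dist u v (fmor shift f' \oc g'') /\
      u \oc f' = h' \oc g /\ h'' \oc u = f'' /\
      v \oc h' = g' /\ g'' \oc v = fmor shift f \oc h'' }.

Arguments shift {R T} S : rename.
Arguments dist {R T} S {X Y Z} f g h : rename.

Definition triangle_functor (R : comPzRingType) (T : linCat R)
    (S : triangulation T) (F : functor T T) : Prop :=
  exists phi : forall X, F (shift S X) ~> shift S (F X),
    is_nat_iso (F := fcomp F (shift S)) (G := fcomp (shift S) F) phi /\
    forall X Y Z (f : X ~> Y) (g : Y ~> Z) (h : Z ~> shift S X),
      dist S f g h -> dist S (fmor F f) (fmor F g) (phi X \oc fmor F h).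

(* G : C/K -> C/K is the functor induced by F : C/I -> C/I', that is, the
   square formed by F, G and the canonical functors C/I -> C/K <- C/I'
   commutes. G has the object map of F (all quotients have the objects of C),
   and the two canonical functors send the class of a morphism f of C to its
   class in C/K. *)
Definition induces (R : comPzRingType) (C : linCat R) (I I' K : ideal C)
    (F : functor (quotCat I) (quotCat I'))
    (G1 : forall X Y : C, (X ~>[quotCat K] Y) -> (F X ~>[quotCat K] F Y)) :
    Prop :=
  forall (X Y : C) (f : X ~>[C] Y) (t : (F X : C) ~>[C] (F Y : C)),
    fmor F (quot_mor I f) = quot_mor I' t ->
    G1 X Y (quot_mor K f) = quot_mor K t.

Arguments induces {R C I I' K} F G1.

(* Main.v *)
Require Import Defs.
From HB Require Import structures.
From mathcomp Require Import all_boot all_order all_algebra.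
From mathcomp Require Import boolp classical_sets cardinality.

(** Write K for the class of preprojective (= preinjective) objects and sigma for
    the quasi-inverse of tau.  The duality gives a pairing of C(sigma X, B) with
    E(B, X), and it shows that an extension d in E(B, A) is killed by all pullbacks
    along sigma X -> B iff it is killed by all pushouts along A -> X.  As K is
    stable under sigma, the extensions killed by the pullbacks along objects of K
    are the ones killed by the pushouts along them: they form a relative Frobenius
    structure with K as class of projective-injectives.  There are enough of
    those, because finiteness of ind Q and preprojective = preinjective force
    K = add T for one object T, and the modules E(X, T), E(sigma T, X) satisfy the
    descending chain condition.  Hence C/[K] is triangulated, with
    Hom(B, Sigma A) the group of relative extensions of B by A.

    The pairing turns into a trace Hom(sigma X, Sigma X) -> J on C/[K], so sigma is
    the inverse of a Serre functor up to a shift.  As in Bondal and Kapranov's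
    argument, the comparison of sigma(Z) with the cone of sigma(f) is obtained as
    a linear form extended from a submodule of a Hom module; working with sigma
    instead of tau makes J-injectivity sufficient, with no Matlis reflexivity. *)

Set Implicit Arguments.
Unset Strict Implicit.
Unset Printing Implicit Defensive.
Import GRing.Theory.
Local Open Scope classical_set_scope.
Local Open Scope ring_scope.

(** * Modules over an artinian ring *)

(** [tau] and [sigma] are functors between two different quotients of C, so on objects of C they are
    controlled only up to morphisms through projectives or injectives. Membership in an additive
    hull is therefore tested on identity morphisms, which weak idempotent completeness allows. The
    object T comes from a bound. The projective generator is preinjective, so it is built from
    finitely many [tau^k I] with k < b; applying [sigma] b times puts its image in the hull of the
    [sigma^k P] with k < b. Thus the [sigma]-orbit of the projectives closes up after b steps.
    Enough relative projectives are found by improving an arbitrary conflation with middle term in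
    K, killing one further pullback at a time. Progress is measured by a submodule of E(X, T) that
    the duality attaches to the extension, and a minimal such submodule has to vanish. *)

Section LinearMap.
Variables (R : pzRingType) (U V : lmodType R) (f : U -> V).

Definition lin_fun of linear f := f.
HB.instance Definition _ (fL : linear f) :=
  GRing.isLinear.Build R U V *:%R (lin_fun fL) fL.

Definition mklin (fL : linear f) : {linear U -> V} := lin_fun fL.

Lemma mklinE fL u : mklin fL u = f u. Proof. by []. Qed.

End LinearMap.

Section Submodules.
Variables (R : pzRingType) (V : lmodType R) (S : set V).
Hypothesis SS : submodule S.

Lemma submodule0 : S 0. Proof. by case: SS. Qed.

Lemma submoduleD u v : S u -> S v -> S (u + v).
Proof. by case: SS => _ lin Su Sv; rewrite -[u]scale1r; apply: lin. Qed.

Lemma submoduleZ a u : S u -> S (a *: u).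
Proof. by case: SS => S0 lin Su; rewrite -[_ *: _]addr0; apply: lin. Qed.

Lemma submoduleN u : S u -> S (- u).
Proof. by rewrite -scaleN1r; apply: submoduleZ. Qed.

Lemma submoduleB u v : S u -> S v -> S (u - v).
Proof. by move=> Su Sv; apply: submoduleD => //; apply: submoduleN. Qed.

End Submodules.

Section ArtinianModules.
Variables (R : comPzRingType) (artR : artinian R).

(** Leading coefficients, as in Hilbert's basis theorem: [lead k n] is the ideal of k-th
    coefficients of the combinations that lie in [S n] and involve no later generator. These m
    chains of ideals stabilise, and from then on coefficients are cancelled from the top index
    down. *)
Lemma fin_gen_dcc (V : lmodType R) (S : nat -> set V) :
  fin_gen V -> (forall n, submodule (S n)) -> (forall n, S n.+1 `<=` S n) ->
  exists N, forall n, (N <= n)%N -> S N `<=` S n.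
Proof.
move=> [m [e gen_e]] subS decS.
have {}decS n n' : (n <= n')%N -> S n' `<=` S n.
  elim: n' => [|n' IH]; first by rewrite leqn0 => /eqP->.
  by rewrite leq_eqVlt => /predU1P[<-//|lt_nn' v Sv]; apply/IH/decS.
pose lead (k : 'I_m) n : set R^o := [set r | exists c : 'I_m -> R,
  [/\ forall i : 'I_m, (k < i)%N -> c i = 0, c k = r & S n (\sum_i c i *: e i)]].
have /choice[N N_lead] : forall k : 'I_m, exists Nk, forall n, (Nk <= n)%N ->
    lead k n = lead k Nk.
  move=> k; apply: artR => [n|n r [c [c0 ck Sc]]]; last first.
    by exists c; split=> //; apply: (decS n n.+1).
  split=> [|a r s [c [c0 <- Sc]] [d [d0 <- Sd]]].
    exists (fun=> 0); split=> //; rewrite big1 => [|i _]; last exact: scale0r.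
    exact: submodule0.
  exists (fun i => a * c i + d i); split=> // [i ki|].
    by rewrite c0 // d0 // mulr0 addr0.
  under eq_bigr => i _ do rewrite scalerDl -scalerA.
  rewrite big_split -scaler_sumr; have [_] := subS n; exact.
exists (\max_k N k) => n le_n v Sv.
suff main k : (k <= m)%N -> forall c : 'I_m -> R,
    (forall i : 'I_m, (k <= i)%N -> c i = 0) ->
    S (\max_k N k) (\sum_i c i *: e i) -> S n (\sum_i c i *: e i).
  have [c Dv] := gen_e v; rewrite Dv; apply: (main m) => // [i|]; last by rewrite -Dv.
  by rewrite leqNgt ltn_ord.
elim: k => [|k IH] lt_km c c0 Sc.
  by rewrite big1 => [|i _]; [exact: submodule0 | rewrite c0 ?scale0r].
pose k' := Ordinal lt_km.
have : lead k' (\max_k N k) (c k') by exists c; split=> // i; apply: c0.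
have leN : (N k' <= \max_k N k)%N by apply: leq_bigmax.
rewrite N_lead // -(N_lead _ n) ?(leq_trans leN) // => -[d [d0 dk Sd]].
have Dc : \sum_i c i *: e i = \sum_i (c i - d i) *: e i + \sum_i d i *: e i.
  by rewrite -big_split /=; apply: eq_bigr => i _; rewrite -scalerDl subrK.
rewrite Dc; apply: submoduleD => //; apply: IH => [|i|]; first exact: ltnW.
  rewrite leq_eqVlt => /predU1P[ki|ki]; last by rewrite c0 // d0 // subrr.
  suff -> : i = k' by rewrite dk subrr.
  exact: val_inj.
have -> : \sum_i (c i - d i) *: e i = \sum_i c i *: e i - \sum_i d i *: e i.
  by rewrite Dc addrK.
by apply: submoduleB => //; apply: decS le_n _ Sd.
Qed.

Lemma fin_gen_min (V : lmodType R) (Phi : set (set V)) :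
  fin_gen V -> (forall S, Phi S -> submodule S) -> Phi !=set0 ->
  exists S, Phi S /\ forall S', Phi S' -> S' `<=` S -> S `<=` S'.
Proof.
move=> fgV subPhi [S0 PhiS0]; apply: contrapT => nomin.
have /choice[next nextP] : forall S : {S | Phi S}, exists S' : {S | Phi S},
    sval S' `<=` sval S /\ ~ sval S `<=` sval S'.
  move=> S; case: S => S PhiS /=; apply: contrapT => noS'; apply: nomin; exists S.
  split=> // S' PhiS' S'S; apply: contrapT => nSS'; apply: noS'.
  by exists (exist _ S' PhiS').
pose chain n := iter n next (exist _ S0 PhiS0).
have [N HN] : exists N, forall n, (N <= n)%N -> sval (chain N) `<=` sval (chain n).
  apply: fin_gen_dcc => // n; first by apply: subPhi; apply: svalP.
  by have [] := nextP (chain n).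
by have [_] := nextP (chain N); apply; apply: (HN N.+1).
Qed.

(** * Extension of partial linear forms with values in an injective module *)

Section Extension.
Variable J : lmodType R.
Hypotheses (fgJ : fin_gen J) (injJ : injective_in_mod J).

(** The graph of a linear map to J from some submodule of V. A relation needs neither the submodule
    as a type nor a choice of values, and single-valuedness reduces to the fibre over 0. *)
Definition ext_graph (V : lmodType R) (G : V -> J -> Prop) : Prop :=
  [/\ G 0 0, forall j, G 0 j -> j = 0
    & forall a u v i j, G u i -> G v j -> G (a *: u + v) (a *: i + j)].

Lemma fin_gen_regular : fin_gen (R^o : lmodType R).
Proof.
exists 1%N, (fun=> 1); move=> v; exists (fun=> v).
by rewrite big_ord1 /GRing.scale /= mulr1.
Qed.

(** The ideal generated by the [r i] enters as R^k modulo the kernel of [ev], a module to which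
    injectivity of J applies. The map that x defines on it extends to R, and j is the value at 1. *)
Lemma inj_fin_gen_ideal k (r : 'I_k -> R) (x : 'I_k -> J) :
  (forall c : 'I_k -> R, \sum_i c i * r i = 0 -> \sum_i c i *: x i = 0) ->
  exists j, forall i, r i *: j = x i.
Proof.
move=> rel_rx.
pose ev (c : 'rV[R]_k) : R^o := \sum_i c 0 i * r i.
have evL : linear ev.
  move=> a c d; rewrite /ev /GRing.scale /= mulr_sumr -big_split.
  by apply: eq_bigr => i _; rewrite !mxE mulrDl mulrA.
pose ex (c : 'rV[R]_k) : J := \sum_i c 0 i *: x i.
have exL : linear ex.
  move=> a c d; rewrite /ex scaler_sumr -big_split.
  by apply: eq_bigr => i _; rewrite !mxE scalerDl scalerA.
have kerS : submodule [set c | ev c = 0].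
  split=> [|a u v /= u0 v0]; last by rewrite evL u0 v0 scaler0 addr0.
  by rewrite /= /ev big1 // => i _; rewrite mxE mul0r.
pose pi c := to_lquot kerS c.
have liftP (W : lmodType R) (f : {linear 'rV[R]_k -> W}) :
    (forall c, ev c = 0 -> f c = 0) ->
    exists g : {linear lquot kerS -> W}, forall c, g (pi c) = f c.
  move=> f0; have f_pi c : f (repr (pi c)) = f c.
    apply/eqP; rewrite -subr_eq0 -linearB; apply/eqP/f0.
    by apply/(lquotP kerS); rewrite /to_lquot generic_quotient.reprK.
  have gL : linear (fun q : lquot kerS => f (repr q)).
    move=> a q q'; have [c ->] := to_lquot_surj q; have [c' ->] := to_lquot_surj q'.
    by rewrite -to_lquot_linear !f_pi linearP.
  by exists (mklin gL) => c; rewrite mklinE f_pi.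
have [i iP] := liftP _ (mklin evL) (fun c => id).
have [f fP] := liftP _ (mklin exL) (fun c => rel_rx (c 0)).
have fgQ : fin_gen (lquot kerS : lmodType R).
  exists k, (fun i => pi (delta_mx 0 i)) => q; have [c ->] := to_lquot_surj q.
  exists (c 0); rewrite {1}(row_sum_delta c).
  rewrite -[to_lquot kerS _]/(mklin (to_lquot_linear kerS) _) linear_sum.
  by apply: eq_bigr => l _; rewrite linearZ.
have inj_i : injective i.
  move=> q q'; have [c ->] := to_lquot_surj q; have [c' ->] := to_lquot_surj q'.
  rewrite !iP => ecc'; apply/lquotP => /=.
  by rewrite -[ev _]/(mklin evL _) linearB ecc' subrr.
have [g gP] := injJ fgQ fin_gen_regular f inj_i.
exists (g 1) => l; have := gP (pi (delta_mx 0 l)).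
have single (W : lmodType R) (w : 'I_k -> W) : \sum_i (delta_mx 0 l : 'rV[R]_k) 0 i
  *: w i = w l.
  rewrite (bigD1 l) //= mxE !eqxx scale1r big1 ?addr0 // => i' ne.
  by rewrite mxE (negPf ne) andbF scale0r.
rewrite iP fP !mklinE (_ : ev _ = r l); last exact: (single (R^o : lmodType R) r).
rewrite (_ : ex _ = x l); last exact: single.
by move=> <-; rewrite -linearZ /=; congr (g _); rewrite /GRing.scale /= mulr1.
Qed.

(* Baer's criterion: J is only assumed injective with respect to
   finitely generated modules, and the descending chain condition on J reduces
   an arbitrary ideal to a finitely generated one. *)
Lemma ext_graph_step (V : lmodType R) (G : V -> J -> Prop) (e : V) :
  ext_graph G -> exists j0, forall r j, G (r *: e) j -> r *: j0 = j.
Proof.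
move=> [G00 G0 GL].
(* Annihilators in J of finitely many scalars r with r e in the domain of G. A minimal one does not
   shrink when a scalar s joins the system, so a solution for the old scalars is right at s too. *)
pose Phi : set (set J) := [set S | exists k (r : 'I_k -> R) (x : 'I_k -> J),
  (forall i, G (r i *: e) (x i)) /\ S = [set j : J | forall i, r i *: j = 0]].
have Gsum k (c : 'I_k -> R) (r : 'I_k -> R) x : (forall i, G (r i *: e) (x i)) ->
    G ((\sum_i c i * r i) *: e) (\sum_i c i *: x i).
  move=> Grx; rewrite scaler_suml; elim/big_rec2: _ => // i u v _ Gvu.
  by rewrite -scalerA; apply: GL.
have solve k (r : 'I_k -> R) (x : 'I_k -> J) : (forall i, G (r i *: e) (x i)) ->
    exists j, forall i, r i *: j = x i.
  move=> Grx; apply: inj_fin_gen_ideal => c c0.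
  by apply: G0; have := Gsum _ c _ _ Grx; rewrite c0 scale0r.
have [||S [[k [r [x [Grx ->]]]] minS]] := fin_gen_min fgJ (Phi := Phi).
- move=> S [k [r [x [_ ->]]]]; split=> [i|a u v Hu Hv i]; first exact: scaler0.
  by rewrite scalerDr scalerA mulrC -scalerA Hu Hv scaler0 addr0.
- exists [set j : J | forall i : 'I_0, 0 *: j = 0]; exists 0%N, (fun=> 0), (fun=> 0).
  by split=> // -[].
have [j0 j0P] := solve _ _ _ Grx; exists j0 => s y Gsy.
pose r' i := oapp r s (unlift ord_max i); pose x' i := oapp x y (unlift ord_max i).
have Grx' i : G (r' i *: e) (x' i).
  by rewrite /r' /x'; case: (unliftP ord_max i) => [l|] _ /=.
have [j1 j1P] := solve _ _ _ Grx'.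
have r'l i : r' (lift ord_max i) = r i by rewrite /r' liftK.
have x'l i : x' (lift ord_max i) = x i by rewrite /x' liftK.
have r'm : r' ord_max = s by rewrite /r' unlift_none.
have x'm : x' ord_max = y by rewrite /x' unlift_none.
have /(_ (j0 - j1)) : [set j : J | forall i, r i *: j = 0] `<=`
    [set j : J | forall i, r' i *: j = 0].
  apply: minS => [|j Hj i]; first by exists k.+1, r', x'.
  by rewrite -r'l.
have H i : r i *: (j0 - j1) = 0 by rewrite scalerBr j0P -r'l j1P x'l subrr.
move/(_ H ord_max); rewrite r'm scalerBr => /eqP; rewrite subr_eq0 => /eqP->.
by rewrite -r'm j1P x'm.
Qed.

(** Finite generation replaces Zorn's lemma: values are chosen for one generator after the other,
    the invariant being agreement with G on combinations of the first k generators. *)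
Lemma ext_graphP (V : lmodType R) (G : V -> J -> Prop) :
  fin_gen V -> ext_graph G ->
  exists L : {linear V -> J}, forall v j, G v j -> L v = j.
Proof.
move=> [m [e gen_e]] extG.
suff: forall k, (k <= m)%N -> exists h : 'I_m -> J, forall (c : 'I_m -> R) j,
    (forall i : 'I_m, (k <= i)%N -> c i = 0) -> G (\sum_i c i *: e i) j ->
    \sum_i c i *: h i = j.
  case/(_ m (leqnn m)) => h hP.
  have {}hP c j : G (\sum_i c i *: e i) j -> \sum_i c i *: h i = j.
    by apply: hP => i; rewrite leqNgt ltn_ord.
  have /choice[l lP] := gen_e.
  (* A relation among the generators is a point of G over 0, so h respects it; hence any choice
     [l v] of coefficients gives a linear map. *)
  have h0 c : \sum_i c i *: e i = 0 -> \sum_i c i *: h i = 0.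
    by move=> c0; apply: hP; rewrite c0; case: extG.
  have LL : linear (fun v => \sum_i l v i *: h i).
    move=> a u v; apply/eqP; rewrite -subr_eq0; apply/eqP.
    have split_coef (W : lmodType R) (w : 'I_m -> W) :
        \sum_i l (a *: u + v) i *: w i
        - (a *: (\sum_i l u i *: w i) + \sum_i l v i *: w i) =
        \sum_i (l (a *: u + v) i - (a * l u i + l v i)) *: w i.
      rewrite scaler_sumr -big_split -sumrB /=; apply: eq_bigr => i _.
      by rewrite scalerBl scalerDl scalerA.
    by rewrite split_coef; apply: h0; rewrite -split_coef -!lP subrr.
  by exists (mklin LL) => v j Gvj; rewrite mklinE; apply: hP; rewrite -lP.
  elim=> [_|k IH lt_km].
    exists (fun=> 0) => c j c0; rewrite !big1 => [|i _|i _]; last 2 first.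
    - by rewrite scaler0.
    - by rewrite c0 ?scale0r.
    by case: extG => _ G0 _ /G0.
  have [h hP] := IH (ltnW lt_km); pose k' := Ordinal lt_km.
  (* The extension of G that sends [e i] to [h i] for i < k; [hP] makes it single-valued. *)
  pose Gk v j := exists (c : 'I_m -> R) i, [/\ forall i : 'I_m, (k <= i)%N -> c i = 0,
    G (v + \sum_i c i *: e i) i & j = i - \sum_i c i *: h i].
  have extGk : ext_graph Gk.
    split=> [|j [c [i [c0]]]|a u v j j' [c [i [c0 Gu ->]]] [d [i' [d0 Gv ->]]]].
      exists (fun=> 0), 0; split=> //.
        by rewrite big1 ?addr0 => [|i _]; [case: extG | rewrite scale0r].
      by rewrite big1 ?subrr // => i _; rewrite scale0r.
      by rewrite add0r => /hP <- // ->; rewrite subrr.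
    exists (fun l => a * c l + d l), (a *: i + i'); split=> [l kl||].
    - by rewrite c0 // d0 // mulr0 addr0.
    - case: extG => _ _ /(_ a _ _ _ _ Gu Gv); rewrite scalerDr addrACA scaler_sumr.
      rewrite -big_split /=; congr (G (_ + _) _); apply: eq_bigr => l _.
      by rewrite scalerDl scalerA.
    - rewrite scalerBr addrACA -opprD scaler_sumr -big_split /=; congr (_ - _).
      by apply: eq_bigr => l _; rewrite scalerDl scalerA.
  have [j0 j0P] := ext_graph_step (e k') extGk.
  exists (fun i => if i == k' then j0 else h i) => c j c0 Gc.
  pose d i := if i == k' then 0 else c i.
  have Dc (W : lmodType R) (w : 'I_m -> W) :
      \sum_i c i *: w i = c k' *: w k' + \sum_i d i *: w i.
    have d0 : d k' = 0 by rewrite /d eqxx.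
    rewrite (bigD1 k') // [in RHS](bigD1 k') //= d0 scale0r add0r.
    by congr (_ + _); apply: eq_bigr => i /negPf ne; rewrite /d ne.
  have Gk0 : Gk (c k' *: e k') (j - \sum_i d i *: h i).
    exists d, j; split=> // [i ki|]; last by rewrite -Dc.
    rewrite /d; case: eqP => // /eqP ne; apply: c0.
    by rewrite ltn_neqAle ki andbT; apply: contraNneq ne => ki'; apply/eqP/val_inj.
  rewrite Dc eqxx (j0P _ _ Gk0) -[RHS](subrK (\sum_i d i *: h i)); congr (_ + _).
  by apply: eq_bigr => i _; rewrite /d; case: eqP => // _; rewrite !scale0r.
Qed.


End Extension.
End ArtinianModules.

(** * Categories and extriangulated categories *)

Section LinearFacts.
Variables (R : pzRingType) (U V : lmodType R) (f : U -> V).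
Hypothesis fL : linear f.

Lemma lin0 : f 0 = 0. Proof. exact: (linear0 (mklin fL)). Qed.
Lemma linD u v : f (u + v) = f u + f v. Proof. exact: (linearD (mklin fL)). Qed.
Lemma linN u : f (- u) = - f u. Proof. exact: (linearN (mklin fL)). Qed.
Lemma linB u v : f (u - v) = f u - f v. Proof. exact: (linearB (mklin fL)). Qed.
Lemma linZ a u : f (a *: u) = a *: f u. Proof.
by have := fL a u 0; rewrite lin0 !addr0. Qed.

End LinearFacts.

Section Categories.
Variables (R : comPzRingType) (C : linCat R).

Lemma compNl X Y Z (g : Y ~>[C] Z) (f : X ~> Y) : (- g) \oc f = - (g \oc f).
Proof. exact: (linN (comp_linear_l f)). Qed.

Lemma compNr X Y Z (g : Y ~>[C] Z) (f : X ~> Y) : g \oc (- f) = - (g \oc f).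
Proof. exact: (linN (comp_linear_r g)). Qed.

Lemma compBl X Y Z (g h : Y ~>[C] Z) (f : X ~> Y) :
  (g - h) \oc f = g \oc f - h \oc f.
Proof. exact: (linB (comp_linear_l f)). Qed.

Lemma compBr X Y Z (g : Y ~>[C] Z) (f h : X ~> Y) :
  g \oc (f - h) = g \oc f - g \oc h.
Proof. exact: (linB (comp_linear_r g)). Qed.

Lemma iso_id X : is_iso (idm X : X ~>[C] X).
Proof. by exists (idm X); rewrite comp1m. Qed.

Lemma iso_comp X Y Z (g : Y ~>[C] Z) (f : X ~> Y) :
  is_iso g -> is_iso f -> is_iso (g \oc f).
Proof.
move=> [g' [g'g gg']] [f' [f'f ff']]; exists (f' \oc g'); split.
  by rewrite -compmA (compmA g') g'g comp1m.
by rewrite -compmA (compmA f) ff' comp1m.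
Qed.

Lemma iso_opp X Y (f : X ~>[C] Y) : is_iso f -> is_iso (- f).
Proof.
move=> [g [gf fg]]; exists (- g).
by rewrite !compNl !compNr !opprK gf fg.
Qed.

Lemma iso_monic X Y Z (g : Y ~>[C] Z) (f f' : X ~> Y) :
  is_iso g -> g \oc f = g \oc f' -> f = f'.
Proof. by move=> [h [hg _]] eq_gf; rewrite -[f]comp1m -hg -compmA eq_gf compmA hg
  comp1m. Qed.

Lemma iso_epic X Y Z (g g' : Y ~>[C] Z) (f : X ~> Y) :
  is_iso f -> g \oc f = g' \oc f -> g = g'.
Proof. by move=> [h [_ fh]] eq_gf; rewrite -[g]compm1 -fh compmA eq_gf -compmA fh
  compm1. Qed.

Lemma zero_hom_l X Y (f : X ~>[C] Y) : is_zero X -> f = 0.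
Proof. by move=> X0; rewrite -[f]compm1 X0 comp0r. Qed.

Lemma zero_hom_r X Y (f : X ~>[C] Y) : is_zero Y -> f = 0.
Proof. by move=> Y0; rewrite -[f]comp1m Y0 comp0l. Qed.

Lemma biprod_sym A B S (iA : A ~>[C] S) (iB : B ~> S) pA pB :
  is_biprod iA iB pA pB -> is_biprod iB iA pB pA.
Proof. by case=> ? ? ? ? s; split=> //; rewrite addrC. Qed.

Lemma biprod_zero_l A O (i : O ~>[C] A) (p : A ~> O) :
  is_zero O -> is_biprod (idm A) i (idm A) p.
Proof.
move=> O0; rewrite (zero_hom_l i O0) (zero_hom_r p O0).
by split; rewrite ?comp1m ?compm1 ?comp0l ?comp0r ?addr0.
Qed.

Lemma biprod_zero_r A O (i : O ~>[C] A) (p : A ~> O) :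
  is_zero O -> is_biprod i (idm A) p (idm A).
Proof. by move/(biprod_zero_l i p)/biprod_sym. Qed.

Lemma iso_sum A B : @isomorphic R C A B -> forall O : C, is_zero O -> is_sum A O B.
Proof.
move=> [f [g [gf fg]]] O O0; exists f, 0, g, 0.
by split; rewrite ?comp0l ?comp0r ?addr0.
Qed.

Lemma iso_of_bij_l X Y (f : X ~>[C] Y) :
  (forall Z (g g' : Z ~> X), f \oc g = f \oc g' -> g = g') ->
  (forall Z (h : Z ~> Y), exists g : Z ~> X, f \oc g = h) -> is_iso f.
Proof.
move=> inj surj; have [g fg] := surj _ (idm Y); exists g; split=> //.
by apply: inj; rewrite compmA fg comp1m compm1.
Qed.

Lemma iso_of_bij_r X Y (f : X ~>[C] Y) :
  (forall Z (g g' : Y ~> Z), g \oc f = g' \oc f -> g = g') ->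
  (forall Z (h : X ~> Z), exists g : Y ~> Z, g \oc f = h) -> is_iso f.
Proof.
move=> inj surj; have [g gf] := surj _ (idm X); exists g; split=> //.
by apply: inj; rewrite -compmA gf comp1m compm1.
Qed.

End Categories.

Section BifunctorFacts.
Variables (R : comPzRingType) (C : linCat R) (E : bifunctor C).

Lemma push0 X A A' (a : A ~>[C] A') : push E a (0 : E X A) = 0.
Proof. exact: (lin0 (@push_linear _ _ E X A A' a)). Qed.
Lemma pushD X A A' (a : A ~>[C] A') (d e : E X A) :
  push E a (d + e) = push E a d + push E a e.
Proof. exact: (linD (@push_linear _ _ E X A A' a)). Qed.
Lemma push0l X A A' (d : E X A) : push E (0 : A ~> A') d = 0.
Proof. exact: (lin0 (push_linear_mor d)). Qed.
Lemma pushDl X A A' (a b : A ~>[C] A') (d : E X A) :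
  push E (a + b) d = push E a d + push E b d.
Proof. exact: (linD (push_linear_mor d)). Qed.
Lemma pushBl X A A' (a b : A ~>[C] A') (d : E X A) :
  push E (a - b) d = push E a d - push E b d.
Proof. exact: (linB (push_linear_mor d)). Qed.

Lemma pull0 X X' A (c : X' ~>[C] X) : pull E c (0 : E X A) = 0.
Proof. exact: (lin0 (@pull_linear _ _ E X X' A c)). Qed.
Lemma pullD X X' A (c : X' ~>[C] X) (d e : E X A) :
  pull E c (d + e) = pull E c d + pull E c e.
Proof. exact: (linD (@pull_linear _ _ E X X' A c)). Qed.
Lemma pull0l X X' A (d : E X A) : pull E (0 : X' ~> X) d = 0.
Proof. exact: (lin0 (pull_linear_mor d)). Qed.
Lemma pullDl X X' A (b c : X' ~>[C] X) (d : E X A) :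
  pull E (b + c) d = pull E b d + pull E c d.
Proof. exact: (linD (pull_linear_mor d)). Qed.
Lemma pullBl X X' A (b c : X' ~>[C] X) (d : E X A) :
  pull E (b - c) d = pull E b d - pull E c d.
Proof. exact: (linB (pull_linear_mor d)). Qed.

End BifunctorFacts.

Section Extriangulated.
Variables (R : comPzRingType) (C : extriCat R).
Local Notation push := (push (EE C)).
Local Notation pull := (pull (EE C)).
Local Notation conf d x y := (Defs.realz C d x y).

Lemma zero_ex : exists O : C, is_zero O.
Proof. by case: (ecat_additive C). Qed.

Lemma biprod_ex (A B : C) : exists (S : C) iA iB pA pB,
  @is_biprod R C A B S iA iB pA pB.
Proof. by case: (ecat_additive C) => _ /(_ A B) [S]; exists S. Qed.

Lemma conf_ex (X A : C) (d : EE C X A) : exists (B : C) (x : A ~> B) (y : B ~> X),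
  conf d x y.
Proof.
have [+ _ _ _] := real_additive C => /(_ X A d)[B [x [y xyP]]].
by exists B, x, y; apply/xyP; exists (idm B); rewrite comp1m compm1; split=> //;
  exact: iso_id.
Qed.

Lemma conf_equiv (X A : C) (d : EE C X A) (B B' : C)
    (x : A ~> B) (y : B ~> X) (x' : A ~> B') (y' : B' ~> X) :
  conf d x y -> conf d x' y' -> seq_equiv x y x' y'.
Proof.
have [+ _ _ _] := real_additive C => /(_ X A d)[B0 [x0 [y0 xyP]]].
move=> /xyP[b [[b' [b'b bb']] bx yb]] /xyP[c [iso_c cx yc]].
exists (c \oc b'); split.
- by apply: iso_comp => //; exists b.
- by rewrite -bx -compmA (compmA b') b'b comp1m.
- by rewrite compmA yc -yb -compmA bb' compm1.
Qed.

Lemma conf_map (X A X' A' : C) (d : EE C X A) (d' : EE C X' A') (B B' : C)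
    (x : A ~> B) (y : B ~> X) (x' : A' ~> B') (y' : B' ~> X') (a : A ~> A') (c : X ~>
      X') :
  conf d x y -> conf d' x' y' ->
  push a d = pull c d' -> exists b : B ~> B', b \oc x = x' \oc a /\ y' \oc b = c \oc y.
Proof. by have [_ + _ _] := real_additive C; apply. Qed.

Lemma conf_sum (A X S : C) iA iX pA pX : @is_biprod R C A X S iA iX pA pX ->
  conf (0 : EE C X A) iA pX.
Proof. by have [_ _ + _] := real_additive C; apply. Qed.

Lemma conf_zero_r (A O : C) : is_zero O -> conf (0 : EE C O A) (idm A) (0 : A ~> O).
Proof. by move=> /(biprod_zero_l (0 : O ~> A) (0 : A ~> O)) /conf_sum. Qed.

Lemma conf_zero_l (X O : C) : is_zero O -> conf (0 : EE C X O) (0 : O ~> X) (idm X).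
Proof. by move=> /(biprod_zero_r (0 : O ~> X) (0 : X ~> O)) /conf_sum. Qed.

Lemma et3 (X A X' A' : C) (d : EE C X A) (d' : EE C X' A') (B B' : C)
    (x : A ~> B) (y : B ~> X) (x' : A' ~> B') (y' : B' ~> X') (a : A ~> A') (b : B ~>
      B') :
  conf d x y -> conf d' x' y' -> b \oc x = x' \oc a ->
  exists c : X ~> X', c \oc y = y' \oc b /\ push a d = pull c d'.
Proof. exact: real_ET3. Qed.

Lemma et3op (X A X' A' : C) (d : EE C X A) (d' : EE C X' A') (B B' : C)
    (x : A ~> B) (y : B ~> X) (x' : A' ~> B') (y' : B' ~> X') (b : B ~> B') (c : X ~>
      X') :
  conf d x y -> conf d' x' y' -> c \oc y = y' \oc b ->
  exists a : A ~> A', x' \oc a = b \oc x /\ push a d = pull c d'.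
Proof.
move=> xy xy' eq_bc.
have := @real_ET3op R C A' X' A X d' d B' B y' x' y x c b xy' xy (esym eq_bc).
by move=> [a [ax pa]]; exists a.
Qed.

Lemma et4 (A B D X F : C) (d : EE C D A) (d' : EE C F B)
    (f : A ~> B) (f' : B ~> D) (g : B ~> X) (g' : X ~> F) :
  conf d f f' -> conf d' g g' ->
  exists (G : C) (u : D ~> G) (v : G ~> F) (h' : X ~> G) (d'' : EE C G A),
    [/\ conf d'' (g \oc f) h', h' \oc g = u \oc f' & v \oc h' = g'] /\
    [/\ conf (push f' d') u v, pull u d'' = d & push f d'' = pull v d'].
Proof.
move=> fc gc; have [G [u [v [h' [d'' [? [? [? [? [? ?]]]]]]]]]] := real_ET4 fc gc.
by exists G, u, v, h', d''.
Qed.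

Lemma et4op (A B D X F : C) (d : EE C A D) (d' : EE C B F)
    (f : B ~> A) (f' : D ~> B) (g : X ~> B) (g' : F ~> X) :
  conf d f' f -> conf d' g' g ->
  exists (G : C) (u : G ~> D) (v : F ~> G) (h' : G ~> X) (d'' : EE C A G),
    [/\ conf d'' h' (f \oc g), g \oc h' = f' \oc u & h' \oc v = g'] /\
    [/\ conf (pull f' d') v u, push u d'' = d & pull f d'' = push v d'].
Proof.
move=> fc gc; have := @real_ET4op R C A B D X F d d' f f' g g' fc gc.
move=> [G [u [v [h' [d'' [? [? [? [? [? ?]]]]]]]]]].
by exists G, u, v, h', d''.
Qed.

(** * Exact sequences of Hom and E attached to a conflation *)

Section Exactness.
Variables (X A B : C) (d : EE C X A) (x : A ~> B) (y : B ~> X).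
Hypothesis xy : conf d x y.

Lemma conf_push0 : push x d = 0.
Proof.
have [O O0] := zero_ex.
have [|c [_ ->]] := et3 (a := x) (b := idm B) xy (conf_zero_r B O0); first by [].
exact: pull0.
Qed.

Lemma conf_pull0 : pull y d = 0.
Proof.
have [O O0] := zero_ex.
have [|a [_ <-]] := et3op (c := y) (b := idm B) (conf_zero_l B O0) xy; first by [].
exact: push0.
Qed.

Lemma conf_lift_pull U (c : U ~> X) : pull c d = 0 -> exists l : U ~> B, c = y \oc l.
Proof.
move=> cd; have [S [iA [iU [pA [pU bp]]]]] := biprod_ex A U.
have [|b [_ yb]] := conf_map (a := idm A) (c := c) (conf_sum bp) xy.
  by rewrite cd push0.
by exists (b \oc iU); rewrite compmA yb -compmA; case: bp => _ -> *; rewrite compm1.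
Qed.

Lemma conf_ext_push U (a : A ~> U) : push a d = 0 -> exists l : B ~> U, a = l \oc x.
Proof.
move=> ad; have [S [iU [iX [pU [pX bp]]]]] := biprod_ex U X.
have [|b [bx _]] := conf_map (a := a) (c := idm X) xy (conf_sum bp).
  by rewrite ad pull0.
by exists (pU \oc b); rewrite -compmA bx compmA; case: bp => -> *; rewrite comp1m.
Qed.

End Exactness.

(** Since x kills e, it extends along the inflation of e, and (ET3) completes this to a morphism of
    extensions that is the identity on A. *)
Lemma conf_pull_ex (X A B U : C) (d : EE C X A) (x : A ~> B) y (e : EE C U A) :
  conf d x y -> push x e = 0 -> exists c : U ~> X, e = pull c d.
Proof.
move=> xy xe; have [B' [x' [y' xy']]] := conf_ex e.
have [l Dx] := conf_ext_push xy' xe.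
have [|c [_ pe]] := et3 (a := idm A) (b := l) xy' xy; first by rewrite compm1.
by exists c; rewrite -pe push_id.
Qed.

Lemma conf_push_ex (X A B U : C) (d : EE C X A) (x : A ~> B) y (e : EE C X U) :
  conf d x y -> pull y e = 0 -> exists a : A ~> U, e = push a d.
Proof.
move=> xy ye; have [B' [x' [y' xy']]] := conf_ex e.
have [l Dy] := conf_lift_pull xy' ye.
have [|a [_ pe]] := et3op (c := idm X) (b := l) xy xy'; first by rewrite comp1m.
by exists a; rewrite pe pull_id.
Qed.

(** M realizes the class (d1, d2) on the direct sum of C1 and C2 and plays the role of a pushout of
    B1 and B2 under A. The dual of (ET4), applied to the split sequence on C1 and C2, produces the
    conflations through M; the final equation says that a deflation kills its own class. *)
Lemma conf_glue_l (A C1 C2 : C) (d1 : EE C C1 A) (d2 : EE C C2 A) :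
  exists (M B1 B2 : C) (e1 : M ~> C1) (e2 : M ~> C2)
    (v1 : A ~> B1) (u1 : B1 ~> C1) (h1 : B1 ~> M)
    (v2 : A ~> B2) (u2 : B2 ~> C2) (h2 : B2 ~> M),
  [/\ conf d1 v1 u1, conf (push v1 d2) h1 e2 & e1 \oc h1 = u1] /\
  [/\ conf d2 v2 u2, conf (push v2 d1) h2 e1, e2 \oc h2 = u2
    & pull e1 d1 + pull e2 d2 = 0].
Proof.
have [S [i1 [i2 [p1 [p2 bp]]]]] := biprod_ex C1 C2.
pose mu := pull p1 d1 + pull p2 d2.
have [M [m [e me]]] := conf_ex mu.
(* Stated for any biproduct structure on S, so that exchanging the summands yields both conflations
   for the same M. *)
have half D1 D2 (f1 : EE C D1 A) (f2 : EE C D2 A) j1 j2 q1 q2 :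
    @is_biprod R C D1 D2 S j1 j2 q1 q2 -> mu = pull q1 f1 + pull q2 f2 ->
    exists (B2 : C) (v2 : A ~> B2) (u2 : B2 ~> D2) (h2 : B2 ~> M),
    [/\ conf f2 v2 u2, conf (push v2 f1) h2 (q1 \oc e) & (q2 \oc e) \oc h2 = u2].
  move=> bq Dmu; have [q11 q22 q12 q21 _] := bq.
  have [G [u [v [h [d'' [[hc eh hv] [uv ud pd]]]]]]] :=
    et4op (conf_sum (biprod_sym bq)) me.
  have vu : conf f2 v u.
    by move: uv; rewrite Dmu pullD -!pull_comp q12 q22 pull0l add0r pull_id.
  exists G, v, u, h; split=> //; last by rewrite -compmA eh compmA q22 comp1m.
  suff <- : d'' = push v f1 by [].
  rewrite -[d'']pull_id -q11 pull_comp pd Dmu pushD [push v (pull q2 _)]push_pull.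
  rewrite (conf_push0 vu) pull0 addr0 push_pull -pull_comp q11.
  exact: pull_id.
have [B2 [v2 [u2 [h2 [c2 c2' c2'']]]]] := half _ _ d1 d2 _ _ _ _ bp erefl.
have [B1 [v1 [u1 [h1 [c1 c1' c1'']]]]] :=
  half _ _ d2 d1 _ _ _ _ (biprod_sym bp) (addrC _ _).
exists M, B1, B2, (p1 \oc e), (p2 \oc e), v1, u1, h1, v2, u2, h2.
by do 2!split=> //; rewrite !pull_comp -pullD (conf_pull0 me).
Qed.

Lemma conf_glue_r (X A1 A2 : C) (d1 : EE C X A1) (d2 : EE C X A2) :
  exists (M B1 B2 : C) (m1 : A1 ~> M) (m2 : A2 ~> M)
    (u1 : A1 ~> B1) (v1 : B1 ~> X) (h1 : M ~> B1)
    (u2 : A2 ~> B2) (v2 : B2 ~> X) (h2 : M ~> B2),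
  [/\ conf d1 u1 v1, conf (pull v1 d2) m2 h1 & h1 \oc m1 = u1] /\
  [/\ conf d2 u2 v2, conf (pull v2 d1) m1 h2, h2 \oc m2 = u2
    & push m1 d1 + push m2 d2 = 0].
Proof.
have [S [i1 [i2 [p1 [p2 bp]]]]] := biprod_ex A1 A2.
pose mu := push i1 d1 + push i2 d2.
have [M [m [e me]]] := conf_ex mu.
have half D1 D2 (f1 : EE C X D1) (f2 : EE C X D2) j1 j2 q1 q2 :
    @is_biprod R C D1 D2 S j1 j2 q1 q2 -> mu = push j1 f1 + push j2 f2 ->
    exists (B2 : C) (u2 : D2 ~> B2) (v2 : B2 ~> X) (h2 : M ~> B2),
    [/\ conf f2 u2 v2, conf (pull v2 f1) (m \oc j1) h2 & h2 \oc (m \oc j2) = u2].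
  move=> bq Dmu; have [q11 q22 q12 q21 _] := bq.
  have [G [u [v [h [d'' [[hc hm vh] [uv ud pd]]]]]]] := et4 (conf_sum bq) me.
  have uv2 : conf f2 u v.
    by move: uv; rewrite Dmu pushD -!push_comp q21 q22 push0l add0r push_id.
  exists G, u, v, h; split=> //; last by rewrite compmA hm -compmA q22 compm1.
  suff <- : d'' = pull v f1 by [].
  rewrite -[d'']push_id -q11 push_comp pd Dmu pullD -[pull v (push j2 _)]push_pull.
  rewrite (conf_pull0 uv2) push0 addr0 -push_pull -push_comp q11.
  exact: push_id.
have [B2 [u2 [v2 [h2 [c2 c2' c2'']]]]] := half _ _ d1 d2 _ _ _ _ bp erefl.
have [B1 [u1 [v1 [h1 [c1 c1' c1'']]]]] :=
  half _ _ d2 d1 _ _ _ _ (biprod_sym bp) (addrC _ _).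
exists M, B1, B2, (m \oc i1), (m \oc i2), u1, v1, h1, u2, v2, h2.
by do 2!split=> //; rewrite !push_comp -pushD (conf_push0 me).
Qed.

Lemma conf_split (X A B : C) (x : A ~> B) (y : B ~> X) : conf (0 : EE C X A) x y ->
  exists i p, is_biprod x i p y.
Proof.
move=> xy; have [S [iA [iX [pA [pX bp]]]]] := biprod_ex A X.
have [b [[b' [b'b bb']] bx yb]] := conf_equiv xy (conf_sum bp).
have Dx : x = b' \oc iA by rewrite -bx compmA b'b comp1m.
exists (b' \oc iX), (pA \oc b); case: bp => e1 e2 e3 e4 e5.
rewrite Dx -yb; split; rewrite -!compmA ?(compmA b) ?bb' ?comp1m //.
by rewrite -compDr (compmA iA) (compmA iX) -compDl e5 comp1m.
Qed.

End Extriangulated.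

(** * Functors and pretriangulated categories *)

Section Functors.
Variables (R : comPzRingType).

Section OneFunctor.
Variables (C D : linCat R) (F : functor C D).

Lemma fmor_linear X Y : linear (@fmor R C D F X Y).
Proof. by case: (functorP F). Qed.

Lemma fmor1 X : fmor F (idm X) = idm (F X).
Proof. by case: (functorP F). Qed.

Lemma fmorM X Y Z (g : Y ~>[C] Z) (f : X ~> Y) :
  fmor F (g \oc f) = fmor F g \oc fmor F f.
Proof. by case: (functorP F). Qed.

Lemma fmor0 X Y : fmor F (0 : X ~> Y) = 0.
Proof. exact: lin0 (fmor_linear (X := X) (Y := Y)). Qed.

Lemma fmorD X Y (f g : X ~> Y) : fmor F (f + g) = fmor F f + fmor F g.
Proof. exact: linD (fmor_linear (X := X) (Y := Y)) f g. Qed.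

Lemma fmorN X Y (f : X ~> Y) : fmor F (- f) = - fmor F f.
Proof. exact: linN (fmor_linear (X := X) (Y := Y)) f. Qed.

Lemma fmorB X Y (f g : X ~> Y) : fmor F (f - g) = fmor F f - fmor F g.
Proof. exact: linB (fmor_linear (X := X) (Y := Y)) f g. Qed.

Lemma fmor_iso X Y (f : X ~> Y) : is_iso f -> is_iso (fmor F f).
Proof. by move=> [g [gf fg]]; exists (fmor F g); rewrite -!fmorM gf fg !fmor1. Qed.

Lemma fmor_biprod A B S (iA : A ~>[C] S) (iB : B ~> S) pA pB :
  is_biprod iA iB pA pB ->
  is_biprod (fmor F iA) (fmor F iB) (fmor F pA) (fmor F pB).
Proof.
by case=> e1 e2 e3 e4 e5; split; rewrite -!fmorM ?e1 ?e2 ?e3 ?e4 ?fmor1 ?fmor0 //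
  -fmorD e5 fmor1.
Qed.

Lemma fmor_zero X : is_zero X -> is_zero (F X).
Proof. by rewrite /is_zero -fmor1 => ->; rewrite fmor0. Qed.

Definition faithful := forall X Y (f g : X ~> Y), fmor F f = fmor F g -> f = g.
Definition full := forall X Y (g : F X ~> F Y), exists f : X ~> Y, fmor F f = g.
Definition ess_surj := forall Y : D, exists (X : C) (f : F X ~> Y), is_iso f.

Lemma iso_reflect X Y (f : X ~>[C] Y) :
  faithful -> full -> is_iso (fmor F f) -> is_iso f.
Proof.
move=> ffF fuF [g' [g'f fg']]; have [g Dg] := fuF _ _ g'; exists g.
by split; apply: ffF; rewrite fmorM Dg fmor1.
Qed.

Lemma equivalence_faithful : is_equivalence F -> faithful.
Proof.
move=> [G [[phi [iso_phi phiN]] _]] X Y f g eq_fg.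
apply: (iso_epic (iso_phi X)); rewrite -[f]/(fmor (fid C) f) -[g]/(fmor (fid C) g).
by rewrite -!phiN /= eq_fg.
Qed.

Lemma equivalence_ess_surj : is_equivalence F -> ess_surj.
Proof. by move=> [G [_ [phi [iso_phi _]]]] Y; exists (G Y), (phi Y); exact: iso_phi.
Qed.

End OneFunctor.

Lemma quasi_inverse_sym (C D : linCat R) (F : functor C D) (G : functor D C) :
  quasi_inverse F G -> quasi_inverse G F.
Proof. by case. Qed.

Lemma equivalence_full (C D : linCat R) (F : functor C D) : is_equivalence F -> full F.
Proof.
move=> [G qFG]; have ffG : faithful G.
  by apply: equivalence_faithful; exists F; exact: quasi_inverse_sym.
have [[phi [iso_phi phiN]] _] := qFG.
move=> X Y g; have [psi [psiK Kpsi]] := iso_phi X.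
exists (phi Y \oc fmor G g \oc psi); apply: ffG.
apply: (iso_monic (iso_phi Y)); have /= -> := phiN _ _ (phi Y \oc fmor G g \oc psi).
by rewrite -compmA psiK compm1.
Qed.

Lemma equivalence_of_ff (C D : linCat R) (F : functor C D) :
  faithful F -> full F -> ess_surj F -> is_equivalence F.
Proof.
move=> ffF fuF /choice[G0 G0P].
have exE Y : exists ee : (F (G0 Y) ~> Y) * (Y ~> F (G0 Y)),
    ee.2 \oc ee.1 = idm (F (G0 Y)) /\ ee.1 \oc ee.2 = idm Y.
  by have [f [g fg]] := G0P Y; exists (f, g).
pose e Y := sval (cid (exE Y)).
have eP Y : (e Y).2 \oc (e Y).1 = idm (F (G0 Y)) /\ (e Y).1 \oc (e Y).2 = idm Y.
  by rewrite /e; case: cid.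
pose lift X Y (g : F X ~> F Y) : X ~> Y := sval (cid (fuF X Y g)).
have liftE X Y (g : F X ~> F Y) : fmor F (lift X Y g) = g by rewrite /lift; case: cid.
pose G1 X Y (f : X ~>[D] Y) := lift _ _ ((e Y).2 \oc f \oc (e X).1).
have GP : is_functor G1.
  split=> [X Y a f g|X|X Y Z g f]; apply: ffF.
  - by rewrite fmor_linear !liftE compDr compZr compDl compZl.
  - by rewrite liftE fmor1 compm1; case: (eP X).
  - by rewrite fmorM !liftE -!compmA (compmA (e Y).1); case: (eP Y) => _ ->;
    rewrite comp1m.
have e_iso Y : is_iso (e Y).1 by exists (e Y).2; exact: eP.
exists (Functor GP); split.
  exists (fun X => lift _ _ (e (F X)).1); split=> [X|X Y f].
    by apply: (iso_reflect ffF fuF); rewrite liftE; apply: e_iso.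
  apply: ffF; rewrite /= !fmorM !liftE -!compmA.
  by rewrite (compmA (e _).1); case: (eP (F Y)) => _ ->; rewrite comp1m.
exists (fun Y => (e Y).1); split=> [|X Y f] //=.
by rewrite liftE -!compmA compmA; case: (eP Y) => _ ->; rewrite comp1m.
Qed.

End Functors.

(** * Triangulations from forward rotation and one octahedron per composition *)

Section PreTriangulated.
Variables (R : comPzRingType) (T : linCat R) (S : functor T T).

(** The part of exactness under Hom(U, -) that the five lemma uses. It passes to the image of a
    triangle under an equivalence before that image is known to be distinguished. *)
Definition hom_exact X Y Z (f : X ~>[T] Y) (g : Y ~> Z) (h : Z ~> S X) : Prop :=
  [/\ g \oc f = 0, h \oc g = 0 & fmor S f \oc h = 0] /\
  [/\ forall U (k : U ~> Y), g \oc k = 0 -> exists l, k = f \oc l,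
      forall U (k : U ~> Z), h \oc k = 0 -> exists l, k = g \oc l
    & forall U (k : U ~> S X), fmor S f \oc k = 0 -> exists l, k = h \oc l].

Lemma five_lemma X Y Z X' Y' Z' (f : X ~> Y) (g : Y ~> Z) (h : Z ~> S X)
    (f' : X' ~> Y') (g' : Y' ~> Z') (h' : Z' ~> S X')
    (a : X ~> X') (b : Y ~> Y') (c : Z ~> Z') :
  hom_exact f g h -> hom_exact f' g' h' -> is_iso a -> is_iso b ->
  b \oc f = f' \oc a -> c \oc g = g' \oc b -> fmor S a \oc h = h' \oc c ->
  is_iso c.
Proof.
move=> [[gf hg Sfh] [exY exZ exX]] [[gf' hg' Sfh'] [exY' exZ' exX']] iso_a iso_b bf
  cg ah.
have iso_Sa := fmor_iso S iso_a; have iso_Sb := fmor_iso S iso_b.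
apply: iso_of_bij_l => [U k k' /eqP|U k'].
  rewrite -subr_eq0 -compBr => /eqP; set d := k - k' => cd.
  suff /eqP : d = 0 by rewrite subr_eq0 => /eqP.
  have [|l Dd] := exZ _ d.
    by apply: (iso_monic iso_Sa); rewrite compmA ah -compmA cd !comp0r.
  have [|m Dm] := exY' _ (b \oc l); first by rewrite compmA -cg -compmA -Dd.
  have [a' [_ aa']] := iso_a.
  have Dl : l = f \oc (a' \oc m).
    apply: (iso_monic iso_b); rewrite Dm compmA bf -compmA (compmA a) aa'.
    by rewrite comp1m.
  by rewrite Dd Dl compmA gf comp0l.
have [Sa' [_ SaK]] := iso_Sa.
have [|k Dk] := exX _ (Sa' \oc (h' \oc k')).
  apply: (iso_monic iso_Sb); rewrite comp0r !compmA -fmorM bf fmorM.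
  by rewrite -(compmA (fmor S f')) SaK compm1 Sfh' comp0l.
have [|l' Dl'] := exZ' _ (k' - c \oc k).
  by rewrite compBr (compmA h') -ah -compmA -Dk compmA SaK comp1m subrr.
have [b' [_ bb']] := iso_b.
exists (k + g \oc (b' \oc l')).
by rewrite compDr compmA cg -compmA (compmA b) bb' comp1m -Dl' addrC subrK.
Qed.

Variable dist : forall X Y Z : T, (X ~> Y) -> (Y ~> Z) -> (Z ~> S X) -> Prop.
Arguments dist {X Y Z}.

Definition dist_rotate := forall X Y Z (f : X ~> Y) (g : Y ~> Z) (h : Z ~> S X),
  dist f g h -> dist g h (- fmor S f).

Definition dist_iso_closed :=
  forall X Y Z X' Y' Z' (f : X ~> Y) (g : Y ~> Z) (h : Z ~> S X)
      (f' : X' ~> Y') (g' : Y' ~> Z') (h' : Z' ~> S X')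
      (a : X ~> X') (b : Y ~> Y') (c : Z ~> Z'),
    is_iso a -> is_iso b -> is_iso c ->
    b \oc f = f' \oc a -> c \oc g = g' \oc b -> fmor S a \oc h = h' \oc c ->
    dist f g h -> dist f' g' h'.

Definition dist_complete := forall X Y Z X' Y' Z'
      (f : X ~> Y) (g : Y ~> Z) (h : Z ~> S X)
      (f' : X' ~> Y') (g' : Y' ~> Z') (h' : Z' ~> S X')
      (a : X ~> X') (b : Y ~> Y'),
    dist f g h -> dist f' g' h' -> b \oc f = f' \oc a ->
    exists c : Z ~> Z', c \oc g = g' \oc b /\ fmor S a \oc h = h' \oc c.

Definition octahedron X Y Z Z' X' Y'
      (f : X ~> Y) (f' : Y ~> Z') (f'' : Z' ~> S X)
      (g : Y ~> Z) (g' : Z ~> X') (g'' : X' ~> S Y)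
      (h' : Z ~> Y') (h'' : Y' ~> S X) : Prop :=
    exists (u : Z' ~> Y') (v : Y' ~> X'),
      dist u v (fmor S f' \oc g'') /\
      u \oc f' = h' \oc g /\ h'' \oc u = f'' /\
      v \oc h' = g' /\ g'' \oc v = fmor S f \oc h''.

Hypotheses (addT : is_additive T) (equivS : is_equivalence S).
Hypothesis iso_dist : dist_iso_closed.
Hypothesis id_dist : forall X Z : T, is_zero Z ->
  dist (idm X) (0 : X ~> Z) (0 : Z ~> S X).
Hypothesis cone_dist : forall X Y (f : X ~> Y),
    exists (Z : T) (g : Y ~> Z) (h : Z ~> S X), dist f g h.
Hypothesis rot_dist : dist_rotate.
Hypothesis mor_dist : dist_complete.

Lemma dist_comp0 X Y Z (f : X ~> Y) (g : Y ~> Z) (h : Z ~> S X) :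
  dist f g h -> g \oc f = 0.
Proof.
move=> dfgh; have [[O O0] _] := addT.
have [|c [<- _]] := mor_dist (a := idm X) (b := f) (id_dist X O0) dfgh => //.
exact: comp0r.
Qed.

Lemma dist_lift X Y Z (f : X ~> Y) (g : Y ~> Z) (h : Z ~> S X) U (k : U ~> Y) :
  dist f g h -> g \oc k = 0 -> exists l, k = f \oc l.
Proof.
move=> dfgh gk; have [[O O0] _] := addT.
have [|c [_]] := mor_dist (a := k) (b := 0) (rot_dist (id_dist U O0)) (rot_dist dfgh).
  by rewrite gk comp0l.
rewrite fmor1 compNl compNr compm1 => /oppr_inj;
  have [l <-] := equivalence_full equivS c.
by rewrite -fmorM => /(equivalence_faithful equivS); exists l.
Qed.

Lemma dist_exact X Y Z (f : X ~> Y) (g : Y ~> Z) (h : Z ~> S X) :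
  dist f g h -> hom_exact f g h.
Proof.
move=> dfgh; have dghf := rot_dist dfgh; have dhfg := rot_dist dghf.
split; split; try exact: dist_comp0; try exact: dist_lift.
- exact: dist_comp0 dfgh.
- exact: dist_comp0 dghf.
- by have /eqP := dist_comp0 dhfg; rewrite compNl oppr_eq0 => /eqP.
- by move=> U k; apply: dist_lift dfgh.
- by move=> U k; apply: dist_lift dghf.
- by move=> U k Sfk; apply: dist_lift dhfg _; rewrite compNl Sfk oppr0.
Qed.

Lemma dist_five X Y Z X' Y' Z' (f : X ~> Y) (g : Y ~> Z) (h : Z ~> S X)
    (f' : X' ~> Y') (g' : Y' ~> Z') (h' : Z' ~> S X') (a : X ~> X') (b : Y ~> Y') :
  dist f g h -> dist f' g' h' -> is_iso a -> is_iso b -> b \oc f = f' \oc a ->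
  exists c : Z ~> Z', [/\ is_iso c, c \oc g = g' \oc b & fmor S a \oc h = h' \oc c].
Proof.
move=> d d' iso_a iso_b bf; have [c [cg ah]] := mor_dist d d' bf.
by exists c; split=> //; apply: five_lemma (dist_exact d) (dist_exact d') iso_a iso_b
  bf cg ah.
Qed.

(** Rotating the given triangle twice and a triangle on f three times gives two triangles that start
    with [- fmor S f]; the comparison of their third terms descends along the fully faithful S. *)
Lemma dist_rotate_back X Y Z (f : X ~> Y) (g : Y ~> Z) (h : Z ~> S X) :
  dist g h (- fmor S f) -> dist f g h.
Proof.
move=> dghf; have [Z1 [g1 [h1 dfgh1]]] := cone_dist f.
have d1 := rot_dist (rot_dist dghf).
have d2 := rot_dist (rot_dist (rot_dist dfgh1)).
have [|c [iso_c]] := dist_five d2 d1 (iso_id (S X)) (iso_id (S Y)).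
  by rewrite comp1m compm1.
have ffS := equivalence_faithful equivS; have fuS := equivalence_full equivS.
have [w Dc] := fuS _ _ c; rewrite -{}Dc in iso_c *.
rewrite compm1 !compNr fmor1 comp1m compNl -!fmorM => /oppr_inj/ffS wg /oppr_inj/ffS wh.
have iso_w := iso_reflect ffS fuS iso_c.
apply: (iso_dist (iso_id X) (iso_id Y) iso_w _ _ _ dfgh1).
- by rewrite comp1m compm1.
- by rewrite compm1.
- by rewrite fmor1 comp1m.
Qed.

(** Cones are unique up to isomorphism, so the octahedron may be built on conveniently chosen
    ones. *)
Lemma octahedron_transport X Y Z (f : X ~> Y) (g : Y ~> Z) :
  (exists Z' X' Y' f' f'' g' g'' h' h'',
    [/\ dist f f' f'', dist g g' g'', dist (g \oc f) h' h''
      & @octahedron X Y Z Z' X' Y' f f' f'' g g' g'' h' h'']) ->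
  forall Z' X' Y' f' f'' g' g'' h' h'',
  dist f f' f'' -> dist g g' g'' -> dist (g \oc f) h' h'' ->
  @octahedron X Y Z Z' X' Y' f f' f'' g g' g'' h' h''.
Proof.
move=> [Z1 [X1 [Y1 [f1 [f2 [g1 [g2 [h1 [h2 [df dg dh [u [v [duv [uf [hu [vh
  gv]]]]]]]]]]]]]]]].
move=> Z' X' Y' f' f'' g' g'' h' h'' df' dg' dh'.
have same (A B W W' : T) (p : A ~> B) (r : B ~> W) s (r' : B ~> W') s' :
    dist p r s -> dist p r' s' ->
    exists c c', [/\ c' \oc c = idm W, c \oc c' = idm W', c \oc r = r' & s = s' \oc c].
  move=> d d'; have [|c [[c' [c'c cc']] cr cs]] := dist_five d d' (iso_id A) (iso_id B).
    by rewrite comp1m compm1.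
  by exists c, c'; split=> //; [rewrite cr compm1 | rewrite -cs fmor1 comp1m].
have [c1 [c1' [c1K Kc1 c1f c1f']]] := same _ _ _ _ _ _ _ _ _ df df'.
have [c2 [c2' [c2K Kc2 c2f c2f']]] := same _ _ _ _ _ _ _ _ _ dg dg'.
have [c3 [c3' [c3K Kc3 c3f c3f']]] := same _ _ _ _ _ _ _ _ _ dh dh'.
exists (c3 \oc u \oc c1'), (c2 \oc v \oc c3'); split; [|split; [|split; [|split]]].
- have i1 : is_iso c1 by exists c1'.
  have i2 : is_iso c2 by exists c2'.
  have i3 : is_iso c3 by exists c3'.
  apply: (iso_dist i1 i3 i2 _ _ _ duv).
  + by rewrite -!compmA c1K compm1.
  + by rewrite -!compmA c3K compm1.
  + by rewrite compmA -fmorM c1f -compmA -c2f'.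
- by rewrite -c1f -!compmA (compmA c1') c1K comp1m uf compmA c3f.
- by rewrite !compmA -c3f' hu c1f' -compmA Kc1 compm1.
- by rewrite -c3f -!compmA (compmA c3') c3K comp1m vh c2f.
- by rewrite !compmA -c2f' gv c3f' -!compmA Kc3 compm1.
Qed.

Hypothesis oct_dist : forall X Y Z (f : X ~> Y) (g : Y ~> Z),
  exists Z' X' Y' f' f'' g' g'' h' h'',
    [/\ dist f f' f'', dist g g' g'', dist (g \oc f) h' h''
      & @octahedron X Y Z Z' X' Y' f f' f'' g g' g'' h' h''].

Definition mk_triangulation : triangulation T := Triangulation addT equivS
  iso_dist id_dist cone_dist
  (fun X Y Z f g h => conj (@rot_dist X Y Z f g h) (@dist_rotate_back X Y Z f g h))
  mor_dist
  (fun X Y Z Z' X' Y' f f' f'' g g' g'' h' h'' df dg dh =>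
     octahedron_transport (oct_dist f g) df dg dh).

End PreTriangulated.

(** * The stable category of a relative Frobenius structure *)

Section Quotients.
Variables (R : comPzRingType) (C : linCat R) (I : ideal C).

Lemma quot_morD X Y (f g : X ~>[C] Y) : quot_mor I (f + g) = quot_mor I f + quot_mor
  I g.
Proof. exact: (fmorD (quot_functor I)). Qed.

Lemma quot_morN X Y (f : X ~>[C] Y) : quot_mor I (- f) = - quot_mor I f.
Proof. exact: (fmorN (quot_functor I)). Qed.

Lemma quot_mor_linear X Y a (f g : X ~>[C] Y) :
  quot_mor I (a *: f + g) = a *: quot_mor I f + quot_mor I g.
Proof. exact: (fmor_linear (quot_functor I)). Qed.

Lemma quot_morM X Y Z (g : Y ~>[C] Z) (f : X ~> Y) :
  quot_mor I (g \oc f) = quot_mor I g \oc quot_mor I f :> (X ~>[quotCat I] Z).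
Proof. exact: (fmorM (quot_functor I)). Qed.

Lemma quot_mor1 (X : C) : quot_mor I (idm X) = idm (X : quotCat I).
Proof. by []. Qed.

Lemma quot_mor0 (X Y : C) : quot_mor I (0 : X ~> Y) = 0.
Proof. exact: (fmor0 (quot_functor I)). Qed.

Lemma quot_mor_surj (X Y : C) (f : X ~>[quotCat I] Y) : exists f0 : X ~>[C] Y,
  quot_mor I f0 = f.
Proof. by have [f0 ->] := to_lquot_surj f; exists f0. Qed.

Lemma quot_mor_eq0 X Y (f : X ~>[C] Y) : quot_mor I f = 0 <-> in_ideal I f.
Proof. by rewrite -quot_mor0 quot_mor_eq subr0. Qed.

Lemma quot_biprod A B S (iA : A ~>[C] S) (iB : B ~> S) pA pB :
  is_biprod iA iB pA pB ->
  @is_biprod R (quotCat I) A B S (quot_mor I iA) (quot_mor I iB) (quot_mor I pA)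
    (quot_mor I pB).
Proof. exact: (fmor_biprod (quot_functor I)). Qed.

Lemma quot_additive : is_additive C -> is_additive (quotCat I).
Proof.
move=> [[O O0] sums]; split; first by exists O; apply: (fmor_zero (quot_functor I)).
move=> A B; have [S [iA [iB [pA [pB bp]]]]] := sums A B.
by exists S, (quot_mor I iA), (quot_mor I iB), (quot_mor I pA), (quot_mor I pB);
  exact: quot_biprod bp.
Qed.

Lemma quot_iso X Y (f : X ~>[C] Y) : is_iso f -> @is_iso R (quotCat I) X Y (quot_mor
  I f).
Proof. exact: (fmor_iso (quot_functor I)). Qed.

End Quotients.

Section FrobeniusStructure.
Variables (R : comPzRingType) (C : extriCat R) (P : set C).
Local Notation push := (push (EE C)).
Local Notation pull := (pull (EE C)).
Local Notation conf d x y := (Defs.realz C d x y).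
Local Notation K := (add_hull P).
Local Notation I := (add_ideal (ecat_additive C) P).
Local Notation T := (quotCat I).
Local Notation q := (quot_mor I).

Definition rel_ext (X A : C) (d : EE C X A) : Prop :=
  forall (Z : C) (k : Z ~> X), K Z -> pull k d = 0.

Definition rel_ext_op (X A : C) (d : EE C X A) : Prop :=
  forall (Z : C) (k : A ~> Z), K Z -> push k d = 0.

Hypothesis relE : forall X A (d : EE C X A), rel_ext d <-> rel_ext_op d.
Hypothesis enough_rel_proj : forall X : C, exists (A Z : C) (d : EE C X A)
  (x : A ~> Z) (y : Z ~> X), [/\ conf d x y, rel_ext d & K Z].
Hypothesis enough_rel_inj : forall A : C, exists (X Z : C) (d : EE C X A)
  (x : A ~> Z) (y : Z ~> X), [/\ conf d x y, rel_ext d & K Z].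

Lemma rel_pull X X' A (c : X' ~>[C] X) (d : EE C X A) : rel_ext d -> rel_ext (pull c d).
Proof. by move=> Hd Z k KZ; rewrite -pull_comp; apply: Hd. Qed.

Lemma rel_push X A A' (a : A ~>[C] A') (d : EE C X A) : rel_ext d -> rel_ext (push a d).
Proof. by move=> Hd Z k KZ; rewrite -push_pull Hd // push0. Qed.

Lemma rel_pull0 X X' A (c : X' ~>[C] X) (d : EE C X A) :
  rel_ext d -> in_ideal I c -> pull c d = 0.
Proof. by move=> Hd [Z [a [b [KZ ->]]]]; rewrite pull_comp Hd // pull0. Qed.

Lemma rel_push0 X A A' (a : A ~>[C] A') (d : EE C X A) :
  rel_ext d -> in_ideal I a -> push a d = 0.
Proof. by move=> /relE Hd [Z [b [c [KZ ->]]]]; rewrite push_comp Hd // push0. Qed.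

Lemma rel_pull_eq X X' A (c c' : X' ~>[C] X) (d : EE C X A) :
  rel_ext d -> q c = q c' -> pull c d = pull c' d.
Proof.
move=> Hd /quot_mor_eq /(rel_pull0 Hd); rewrite pullBl => /eqP.
by rewrite subr_eq0 => /eqP.
Qed.

Lemma rel_push_eq X A A' (a a' : A ~>[C] A') (d : EE C X A) :
  rel_ext d -> q a = q a' -> push a d = push a' d.
Proof.
move=> Hd /quot_mor_eq /(rel_push0 Hd); rewrite pushBl => /eqP.
by rewrite subr_eq0 => /eqP.
Qed.

Lemma in_ideal_r X Y Z (f : X ~>[C] Z) (g : Z ~> Y) : K Z -> in_ideal I (g \oc f).
Proof. by move=> KZ; exists Z, f, g. Qed.

Record suspension (A : C) := Suspension {
  susp_obj : C;
  susp_mid : C;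
  susp_ext : EE C susp_obj A;
  susp_inf : A ~> susp_mid;
  susp_def : susp_mid ~> susp_obj;
  susp_conf : conf susp_ext susp_inf susp_def;
  susp_rel : rel_ext susp_ext;
  susp_midK : K susp_mid }.

Lemma suspension_ex A : exists s : suspension A, True.
Proof.
by have [X [Z [d [x [y [xy Hd KZ]]]]]] := enough_rel_inj A;
  exists (Suspension xy Hd KZ).
Qed.

Definition susp A : suspension A := sval (cid (suspension_ex A)).
Definition Sg A : C := susp_obj (susp A).
Definition del A : EE C (Sg A) A := susp_ext (susp A).

Lemma del_rel A : rel_ext (del A). Proof. exact: susp_rel. Qed.

(* The class of a morphism B -> Sigma A of the stable category: this identifies
   Hom(B, Sigma A) with the group of the relative extensions of B by A. *)
Definition cls (B A : C) (h : B ~>[T] Sg A) : EE C B A := pull (repr h) (del A).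

Lemma cls_q (B A : C) (c : B ~>[C] Sg A) : cls (q c) = pull c (del A).
Proof.
apply: rel_pull_eq; first exact: del_rel.
by rewrite /quot_mor /to_lquot generic_quotient.reprK.
Qed.

Lemma cls_rel B A (h : B ~>[T] Sg A) : rel_ext (cls h).
Proof. by apply/rel_pull/del_rel. Qed.

Lemma cls_linear B A : linear (@cls B A).
Proof.
move=> a f g; have [f0 <-] := quot_mor_surj f; have [g0 <-] := quot_mor_surj g.
by rewrite -quot_mor_linear !cls_q pull_linear_mor.
Qed.

Lemma cls_inj B A (h h' : B ~>[T] Sg A) : cls h = cls h' -> h = h'.
Proof.
have [c <-] := quot_mor_surj h; have [c' <-] := quot_mor_surj h'.
rewrite !cls_q => /eqP; rewrite -subr_eq0 -pullBl =>
  /eqP /(conf_lift_pull (susp_conf _)).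
move=> [l Dl]; apply/quot_mor_eq; rewrite Dl; apply: in_ideal_r; exact: susp_midK.
Qed.

Lemma cls_surj B A (d : EE C B A) : rel_ext d -> exists h : B ~>[T] Sg A, cls h = d.
Proof.
move=> /relE Hd; have [c ->] := conf_pull_ex (susp_conf (susp A)) (Hd _ _ (susp_midK
  _)).
by exists (q c); rewrite cls_q.
Qed.

Lemma cls_comp B' B A (h : B ~>[T] Sg A) (c : B' ~>[C] B) :
  cls (h \oc (q c : B' ~>[T] B)) = pull c (cls h).
Proof. by have [h0 <-] := quot_mor_surj h; rewrite -quot_morM !cls_q pull_comp. Qed.

Lemma Sg1_ex A A' (a : A ~>[T] A') : exists h : Sg A ~>[T] Sg A',
  cls h = push (repr a) (del A).
Proof. by apply/cls_surj/rel_push/del_rel. Qed.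

(** By [cls_inj] the chosen morphism is the only one with its class, so the functor laws can be
    checked on extensions. *)
Definition Sg1 A A' (a : A ~>[T] A') : Sg A ~>[T] Sg A' := sval (cid (Sg1_ex a)).

Lemma Sg1_q A A' (a : A ~>[C] A') : cls (Sg1 (q a)) = push a (del A).
Proof.
rewrite /Sg1; case: cid => h /= ->; apply: rel_push_eq; first exact: del_rel.
by rewrite /quot_mor /to_lquot generic_quotient.reprK.
Qed.

Lemma cls_Sg1 B A A' (h : B ~>[T] Sg A) (a : A ~>[C] A') :
  cls ((Sg1 (q a) : Sg A ~>[T] Sg A') \oc h) = push a (cls h).
Proof. by have [c <-] := quot_mor_surj h; rewrite cls_comp Sg1_q cls_q push_pull. Qed.

Lemma Sg1_functor : is_functor (C := T) (D := T) Sg1.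
Proof.
split=> [A A' r f g|A|A A' A'' g f].
- have [f0 <-] := quot_mor_surj f; have [g0 <-] := quot_mor_surj g.
  by apply: cls_inj; rewrite -quot_mor_linear Sg1_q cls_linear !Sg1_q push_linear_mor.
- apply: cls_inj; rewrite -[idm A]quot_mor1 Sg1_q -[idm (Sg A : T)]quot_mor1 cls_q.
  by rewrite push_id pull_id.
- have [f0 <-] := quot_mor_surj f; have [g0 <-] := quot_mor_surj g.
  by apply: cls_inj; rewrite -quot_morM Sg1_q cls_Sg1 Sg1_q push_comp.
Qed.

Definition Sgf : functor T T := Functor Sg1_functor.

(** Any relative conflation with middle term in K computes the suspension: the exact sequences make
    composition with h bijective. *)
Lemma mid_iso (X A Z : C) (d : EE C X A) (x : A ~> Z) (y : Z ~> X) (h : X ~>[T] Sg A) :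
  conf d x y -> K Z -> cls h = d -> is_iso h.
Proof.
move=> xy KZ hd; apply: iso_of_bij_l => [U g g'|U k].
  have [g0 <-] := quot_mor_surj g; have [g0' <-] := quot_mor_surj g'.
  move/(congr1 (@cls _ _)); rewrite !cls_comp hd => /eqP;
    rewrite -subr_eq0 -pullBl => /eqP.
  by move=> /(conf_lift_pull xy) [l Dl]; apply/quot_mor_eq; rewrite Dl;
    apply: in_ideal_r.
have [|c Dc] := conf_pull_ex (e := cls k) xy.
  by have /relE := cls_rel k; apply.
by exists (q c); apply: cls_inj; rewrite cls_comp hd Dc.
Qed.

Lemma Sgf_equiv : is_equivalence Sgf.
Proof.
apply: equivalence_of_ff => [A A' f g|A A' h|X].
- have [f0 <-] := quot_mor_surj f; have [g0 <-] := quot_mor_surj g.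
  move/(congr1 (@cls _ _)); rewrite /= !Sg1_q => /eqP;
    rewrite -subr_eq0 -pushBl => /eqP.
  move=> /(conf_ext_push (susp_conf _)) [l Dl].
  by apply/(@quot_mor_eq R C I A A' f0 g0); rewrite Dl; apply: in_ideal_r;
    apply: susp_midK.
- have [|a Da] := conf_push_ex (e := cls h) (susp_conf (susp A)).
    by apply: (cls_rel h); apply: susp_midK.
  by exists (q a); apply: cls_inj; rewrite /= Sg1_q -Da.
- have [A [Z [d [x [y [xy Hd KZ]]]]]] := enough_rel_proj X.
  have [h hd] := cls_surj Hd; have [h' [h'h hh']] := mid_iso xy KZ hd.
  by exists A, h'; exists h.
Qed.

Definition fdist (X Y Z : T) (f : X ~> Y) (g : Y ~> Z) (h : Z ~> Sgf X) : Prop :=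
  exists (A B D : C) (d : EE C D A) (x : A ~> B) (y : B ~> D) (w : D ~>[T] Sg A)
    (a : A ~>[T] X) (b : B ~>[T] Y) (c : D ~>[T] Z),
  [/\ conf d x y, rel_ext d & cls w = d] /\
  [/\ is_iso a, is_iso b & is_iso c] /\
  [/\ b \oc (q x : A ~>[T] B) = f \oc a, c \oc (q y : B ~>[T] D) = g \oc b
    & fmor Sgf a \oc w = h \oc c].

Lemma fdist_conf (A B D : C) (d : EE C D A) (x : A ~> B) (y : B ~> D) (w : D ~>[T] Sg
  A) :
  conf d x y -> cls w = d -> fdist (q x) (q y) w.
Proof.
move=> xy wd; exists A, B, D, d, x, y, w, (idm (A : T)), (idm (B : T)), (idm (D : T)).
split; first by split=> //; rewrite -wd; apply: cls_rel.
split; first by split; apply: iso_id.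
by rewrite fmor1 !comp1m !compm1.
Qed.

Lemma fdist_iso : dist_iso_closed fdist.
Proof.
move=> X Y Z X' Y' Z' f g h f' g' h' a b c ia ib ic bf cg ah.
move=> [A [B [D [d [x [y [w [a0 [b0 [c0 [xyd [[ia0 ib0 ic0] [bx cy aw]]]]]]]]]]]]].
exists A, B, D, d, x, y, w, (a \oc a0), (b \oc b0), (c \oc c0).
split=> //; split; first by split; apply: iso_comp.
split.
- by rewrite -compmA bx !compmA bf.
- by rewrite -compmA cy !compmA cg.
- by rewrite fmorM -compmA aw !compmA ah.
Qed.

Lemma K_zero (O : C) : K O -> is_zero (O : T).
Proof.
move=> KO; rewrite /is_zero -quot_mor1; apply/quot_mor_eq0.
by rewrite -[idm O]comp1m; apply: in_ideal_r.
Qed.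

Lemma fdist_id (X Z : T) : is_zero Z -> fdist (idm X) (0 : X ~> Z) (0 : Z ~> Sgf X).
Proof.
move=> Z0; have [O O0] := zero_ex C.
have fO := fdist_conf (w := 0) (conf_zero_r X O0) (lin0 (@cls_linear _ _)).
have OT0 : is_zero (O : T) := fmor_zero (quot_functor I) O0.
have i0 : is_iso (0 : O ~>[T] Z).
  exists 0; split; first by rewrite comp0l; exact: esym OT0.
  by rewrite comp0l; exact: esym Z0.
apply: (fdist_iso (iso_id X) (iso_id X) i0 _ _ _ fO).
- by rewrite quot_mor1.
- by rewrite quot_mor0 comp0r compm1.
- by rewrite !comp0r.
Qed.

(* Up to isomorphism in the stable category, every morphism is an inflation. *)
Lemma inflation_replace (X Y : C) (f : X ~>[T] Y) :
  exists (M N : C) (d : EE C N X) (x : X ~> M) (y : M ~> N) (j : M ~>[T] Y),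
  [/\ conf d x y, rel_ext d, is_iso j & j \oc (q x : X ~>[T] M) = f].
Proof.
have [f0 <-] := quot_mor_surj f.
have [M [B1 [B2 [m1 [m2 [u1 [v1 [h1 [u2 [v2 [h2]]]]]]]]]]] :=
  conf_glue_r (del X) (push f0 (del X)).
move=> [[c1 c1' h1m] [c2 c2' h2m sum0]].
have KB1 : K B1.
  have [b [iso_b _ _]] := conf_equiv c1 (susp_conf (susp X)).
  have [b' [b'b bb']] := iso_b.
  have [O O0] := zero_ex C.
  apply: (add_summand (S := susp_mid (susp X)) (B := O)); last exact: susp_midK.
  by apply: iso_sum => //; exists b.
have v10 : pull v1 (push f0 (del X)) = 0.
  by rewrite -push_pull (conf_pull0 c1) push0.
have [i [p bp]] := conf_split (eq_rect _ (fun e => conf e m2 h1) c1' _ v10).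
have B10 := K_zero KB1.
have bpT := quot_biprod I bp.
have pm : (q p : M ~>[T] Y) \oc (q m2 : Y ~>[T] M) = idm (Y : T) by case: bpT.
have mp : (q m2 : Y ~>[T] M) \oc (q p : M ~>[T] Y) = idm (M : T).
  by case: bpT => _ _ _ _ <-; rewrite (zero_hom_l (q i) B10) comp0l addr0.
(* B1 lies in K, so p identifies M with Y in the quotient. The minus sign is forced by [sum0], which
   makes q m1 + q m2 q f0 vanish. *)
exists M, B2, (pull v2 (del X)), m1, h2, (- q p : M ~>[T] Y); split=> //.
- by apply/rel_pull/del_rel.
- by apply: iso_opp; exists (q m2).
- have : push (m1 + m2 \oc f0) (del X) = 0 by rewrite pushDl push_comp.
  move=> /(conf_ext_push (susp_conf _)) [l Dl].
  have : q m1 + (q m2 : Y ~>[T] M) \oc (q f0 : X ~>[T] Y) = 0.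
    rewrite -quot_morM -quot_morD; apply/quot_mor_eq0; rewrite Dl.
    by apply: in_ideal_r; apply: susp_midK.
  move=> /(congr1 (fun t : X ~>[T] M => (q p : M ~>[T] Y) \oc t)).
  rewrite compDr compmA pm comp1m comp0r => /eqP; rewrite addrC addr_eq0 => /eqP ->.
  by rewrite compNl.
Qed.

Lemma fdist_cone (X Y : T) (f : X ~> Y) :
  exists (Z : T) (g : Y ~> Z) (h : Z ~> Sgf X), fdist f g h.
Proof.
have [M [N [d [x [y [j [xy Hd ij jx]]]]]]] := inflation_replace f.
have [w wd] := cls_surj Hd; have [j' [j'j jj']] := ij.
exists N, ((q y : M ~>[T] N) \oc j'), w.
apply: (fdist_iso (iso_id X) ij (iso_id (N : T)) _ _ _ (fdist_conf xy wd)).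
- by rewrite jx compm1.
- by rewrite comp1m -compmA j'j compm1.
- by rewrite fmor1 comp1m compm1.
Qed.

Lemma fdist_rot : dist_rotate fdist.
Proof.
move=> X Y Z f g h [A [B [D [d [x0 [y0 [w]]]]]]].
move=> [a [b [c [[xy0 Hd wd] [[ia ib ic] [bx cy aw]]]]]].
(* Gluing d with the suspension of A gives a conflation from B1 through M to Sigma A with class
   [push v1 (del A)]. As B2 lies in K, M is isomorphic to D in the quotient; there [e2] becomes -w,
   whence the sign in the rotated triangle. *)
have [M [B1 [B2 [e1 [e2 [v1 [u1 [h1 [v2 [u2 [h2]]]]]]]]]]] := conf_glue_l d (del A).
move=> [[c1 c1' eh1] [c2 c2' eh2 sum0]].
have [r [ir rx yr]] := conf_equiv xy0 c1.
have KB2 : K B2.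
  have [t [it _ _]] := conf_equiv c2 (susp_conf (susp A)).
  have [O O0] := zero_ex C.
  apply: (add_summand (S := susp_mid (susp A)) (B := O)); last exact: susp_midK.
  by apply: iso_sum => //; exists t.
have v20 : push v2 d = 0.
  by move/relE: Hd; apply.
have [i [p bp]] := conf_split (eq_rect _ (fun e => conf e h2 e1) c2' _ v20).
have B20 := K_zero KB2.
have bpT := quot_biprod I bp.
have ei : (q e1 : M ~>[T] D) \oc (q i : D ~>[T] M) = idm (D : T) by case: bpT.
have ie : (q i : D ~>[T] M) \oc (q e1 : M ~>[T] D) = idm (M : T).
  by case: bpT => _ _ _ _ <-; rewrite (zero_hom_l (q h2) B20) comp0l add0r.
have e2w : (q e2 : M ~>[T] Sgf A) = - ((w : D ~>[T] Sgf A) \oc (q e1 : M ~>[T] D)).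
  apply: cls_inj; rewrite (linN (@cls_linear _ _)) cls_comp wd cls_q.
  by apply/eqP; rewrite -addr_eq0 addrC sum0.
have [r' [r'r rr']] := ir.
have vd : cls (Sg1 (q v1)) = push v1 (del A) by exact: Sg1_q.
have ib' : is_iso (b \oc (q r' : B1 ~>[T] B)).
  by apply: iso_comp => //; apply: quot_iso; exists r.
have ic' : is_iso (c \oc (q e1 : M ~>[T] D)) by apply: iso_comp => //; exists (q i).
have ia' : is_iso (- fmor Sgf a) by apply/iso_opp/fmor_iso.
apply: (fdist_iso ib' ic' ia' _ _ _ (fdist_conf c1' vd)).
- rewrite -compmA -quot_morM eh1 [RHS]compmA -cy -compmA -quot_morM.
  by rewrite -yr -compmA rr' compm1.
- by rewrite e2w compNl compNr opprK compmA aw -compmA.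
- rewrite compNl compNr opprK -fmorM -bx -[Sg1 _]/(fmor Sgf _) -fmorM.
  by rewrite -compmA -quot_morM -rx compmA r'r comp1m.
Qed.

Lemma fdist_complete : dist_complete fdist.
Proof.
move=> X Y Z X' Y' Z' f g h f' g' h' a b.
move=> [A [B [D [d [x [y [w [a0 [b0 [c0]]]]]]]]]].
move=> [[xy Hd wd] [[[a1 [a1K Ka1]] [b1 [b1K Kb1]] [c1 [c1K Kc1]]] [bx cy aw]]].
move=> [A' [B' [D' [d' [x' [y' [w' [a0' [b0' [c0']]]]]]]]]].
move=> [[xy' Hd' wd'] [[[a1' [a1K' Ka1']] [b1' [b1K' Kb1']] [c1' [c1K' Kc1']]] [bx'
  cy' aw']]] bf.
have [al Dal] := quot_mor_surj (a1' \oc a \oc a0).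
have [be Dbe] := quot_mor_surj (b1' \oc b \oc b0).
have eq_T : (q (be \oc x) : A ~>[T] B') = q (x' \oc al).
  rewrite !quot_morM Dal Dbe -!compmA bx (compmA b) bf !compmA; congr (_ \oc _ \oc _).
  by apply: (iso_monic (g := b0')); [exists b1' | rewrite !compmA Kb1' comp1m bx'
    -compmA Ka1' compm1].
(* The lifted square commutes only up to a map through V in K. As d is relative, the factor r
   extends along the inflation x, so [be] can be corrected within its class before (ET3) is used. *)
move/quot_mor_eq: eq_T => [V [r [s [KV Dsr]]]].
have [|r' Dr] := conf_ext_push (a := r) xy.
  by move/relE: Hd; apply.
have [|ga [gy pe]] := et3 (a := al) (b := be - s \oc r') xy xy'.
  by rewrite compBl -compmA -Dr -Dsr opprB addrC subrK.
have be_q : q (be - s \oc r') = q be.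
  by apply/quot_mor_eq; rewrite addrAC subrr add0r -compNl; apply: in_ideal_r.
exists (c0' \oc (q ga : D ~>[T] D') \oc c1); split.
- apply: (iso_epic (f := b0)); first by exists b1.
  rewrite -!compmA -cy (compmA c1) c1K comp1m -quot_morM gy quot_morM be_q Dbe.
  by rewrite compmA cy' -!compmA (compmA b0') Kb1' comp1m.
- apply: (iso_epic (f := c0)); first by exists c1.
  rewrite -!compmA c1K compm1 (compmA h') -aw' -aw -[RHS]compmA.
  have -> : (w' : D' ~>[T] Sgf A') \oc (q ga : D ~>[T] D') = fmor Sgf (q al) \oc w.
    by apply: cls_inj; rewrite cls_Sg1 cls_comp wd wd' pe.
  by rewrite !compmA -!fmorM Dal !compmA Ka1' comp1m.
Qed.

Lemma fdist_oct (X Y Z : T) (f : X ~> Y) (g : Y ~> Z) :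
  exists Z' X' Y' f' f'' g' g'' h' h'',
    [/\ fdist f f' f'', fdist g g' g'', fdist (g \oc f) h' h''
      & @octahedron R T Sgf fdist X Y Z Z' X' Y' f f' f'' g g' g'' h' h''].
Proof.
have [Y1 [D [d [x [y [j [xy Hd ij jx]]]]]]] := inflation_replace f.
have [Z1 [F [d' [x' [y' [k [xy' Hd' ik kx']]]]]]] := inflation_replace (g \oc j).
have [G [u [v [h' [d'' [[hc hx vh] [uv ud pd]]]]]]] := et4 xy xy'.
(* For m from an object of K, pushing m^* d'' along x gives a pullback of d' from K, which is 0. So
   m^* d'' is itself a pullback of d from K, hence 0. *)
have Hd'' : rel_ext d''.
  move=> V m KV; have [|n Dn] := conf_pull_ex (e := pull m d'') xy.
    by rewrite push_pull pd -pull_comp Hd'.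
  by rewrite Dn Hd.
have [w wd] := cls_surj Hd; have [w' wd'] := cls_surj Hd';
  have [w'' wd''] := cls_surj Hd''.
have [j1 [j1K Kj1]] := ij; have [k1 [k1K Kk1]] := ik.
have ij1 : is_iso j1 by exists j.
have w'd : cls (fmor Sgf j1 \oc (fmor Sgf j \oc w')) = d'.
  by rewrite compmA -fmorM j1K fmor1 comp1m.
exists D, F, G, ((q y : Y1 ~>[T] D) \oc j1), w, ((q y' : Z1 ~>[T] F) \oc k1),
  (fmor Sgf j \oc w').
exists ((q h' : Z1 ~>[T] G) \oc k1), w''; split.
- apply: (fdist_iso (iso_id X) ij (iso_id (D : T)) _ _ _ (fdist_conf xy wd)).
  + by rewrite jx compm1.
  + by rewrite comp1m -compmA j1K compm1.
  + by rewrite fmor1 comp1m compm1.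
- apply: (fdist_iso ij ik (iso_id (F : T)) _ _ _ (fdist_conf xy' wd')).
  + by [].
  + by rewrite comp1m -compmA k1K compm1.
  + by rewrite compm1.
- apply: (fdist_iso (iso_id X) ik (iso_id (G : T)) _ _ _ (fdist_conf hc wd'')).
  + by rewrite compm1 quot_morM compmA kx' -compmA jx.
  + by rewrite comp1m -compmA k1K compm1.
  + by rewrite fmor1 comp1m compm1.
- exists (q u), (q v); split.
    have w3 : cls (fmor Sgf ((q y : Y1 ~>[T] D) \oc j1) \oc (fmor Sgf j \oc w')) =
      push y d'.
      by rewrite compmA -fmorM -compmA j1K compm1 cls_Sg1 wd'.
    exact: fdist_conf uv w3.
  have xk : (q x' : Y1 ~>[T] Z1) \oc j1 = k1 \oc g.
    by apply: (iso_monic ik); rewrite !compmA kx' Kk1 comp1m -compmA Kj1 compm1.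
  split; first by rewrite compmA -quot_morM -hx quot_morM -!compmA xk.
  split; first by apply: cls_inj; rewrite cls_comp wd'' wd.
  split; first by rewrite compmA -quot_morM vh.
  rewrite -jx fmorM -!compmA; congr (_ \oc _); apply: cls_inj.
  by rewrite cls_Sg1 cls_comp wd' wd'' pd.
Qed.

Definition frobenius_triangulation : triangulation T :=
  mk_triangulation (quot_additive I (ecat_additive C)) Sgf_equiv fdist_iso fdist_id
    fdist_cone fdist_rot fdist_complete fdist_oct.

End FrobeniusStructure.

(** * Functors with a trace *)

Section Triangulations.
Variables (R : comPzRingType) (T : linCat R) (S : triangulation T).

Lemma triangulation_exact X Y Z (f : X ~>[T] Y) (g : Y ~> Z) (h : Z ~> shift S X) :
  dist S f g h -> hom_exact (S := shift S) f g h.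
Proof.
apply: (dist_exact (dist := @dist R T S)).
- exact: tri_additive S.
- exact: shift_equiv.
- exact: dist_id.
- by move=> ? ? ? ? ? ? /dist_rot.
- exact: dist_mor.
Qed.

Lemma triangulation_five X Y Z X' Y' Z' (f : X ~>[T] Y) (g : Y ~> Z) (h : Z ~> shift
  S X)
    (f' : X' ~>[T] Y') (g' : Y' ~> Z') (h' : Z' ~> shift S X') (a : X ~> X') (b : Y
      ~> Y') :
  dist S f g h -> dist S f' g' h' -> is_iso a -> is_iso b -> b \oc f = f' \oc a ->
  exists c : Z ~> Z', [/\ is_iso c, c \oc g = g' \oc b
    & fmor (shift S) a \oc h = h' \oc c].
Proof.
move=> d d' iso_a iso_b bf; have [c [cg ah]] := dist_mor d d' bf.
by exists c; split=> //; apply: five_lemma (triangulation_exact d)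
  (triangulation_exact d') iso_a iso_b bf cg ah.
Qed.

Variables (G : functor T T) (equivG : is_equivalence G).

Lemma equivalence_exact X Y Z (p : Y ~>[T] Z) (r : X ~> Y) :
  (forall U (k : U ~> Y), p \oc k = 0 -> exists l, k = r \oc l) ->
  forall U (k : U ~> G Y), fmor G p \oc k = 0 -> exists l, k = fmor G r \oc l.
Proof.
move=> ex U k pk; have [U' [e [e' [e'e ee']]]] := equivalence_ess_surj equivG U.
have [k' Dk'] := equivalence_full equivG (k \oc e).
have [|l Dl] := ex _ k'.
  by apply: (equivalence_faithful equivG); rewrite fmorM Dk' compmA pk comp0l fmor0.
by exists (fmor G l \oc e'); rewrite compmA -fmorM -Dl Dk' -compmA ee' compm1.
Qed.

Lemma equivalence_hom_exact (psi : forall X, G (shift S X) ~> shift S (G X)) :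
  is_nat_iso (F := fcomp G (shift S)) (G := fcomp (shift S) G) psi ->
  forall X Y Z (f : X ~>[T] Y) (g : Y ~> Z) (h : Z ~> shift S X),
  hom_exact (S := shift S) f g h ->
  hom_exact (S := shift S) (fmor G f) (fmor G g) (psi X \oc fmor G h).
Proof.
move=> [iso_psi psiN] X Y Z f g h [[gf hg Sfh] [exY exZ exX]].
have psiE : fmor (shift S) (fmor G f) \oc psi X = psi Y \oc fmor G (fmor (shift S) f).
  exact: esym (psiN _ _ f).
split; split.
- by rewrite -fmorM gf fmor0.
- by rewrite -compmA -fmorM hg fmor0 comp0r.
- by rewrite compmA psiE -compmA -fmorM Sfh fmor0 comp0r.
- exact: equivalence_exact exY.
- move=> U k; rewrite -compmA => hk; apply: (equivalence_exact exZ).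
  by apply: (iso_monic (iso_psi X)); rewrite comp0r.
- move=> U k Sfk; have [psi' [psi'K Kpsi']] := iso_psi X.
  have [|l Dl] := equivalence_exact exX (k := psi' \oc k).
    apply: (iso_monic (iso_psi Y)); rewrite comp0r compmA -psiE -compmA (compmA (psi
      X)).
    by rewrite Kpsi' comp1m.
  by exists l; rewrite -compmA -Dl compmA Kpsi' comp1m.
Qed.

End Triangulations.

Section TraceFunctor.
Variables (R : comPzRingType) (J : lmodType R) (T : linCat R) (S : triangulation T).
Variables (G : functor T T) (equivG : is_equivalence G).
Local Notation Sh := (shift S).
Variable Tr : forall X : T, (G X ~> Sh X) -> J.
Arguments Tr {X} _.
Hypothesis TrL : forall X, linear (@Tr X).
Hypothesis Tr_nat : forall X Y (g : X ~>[T] Y) (t : G Y ~> Sh X),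
  Tr (fmor Sh g \oc t) = Tr (t \oc fmor G g).
Hypothesis Tr_inj : forall X B (f : G X ~>[T] B),
  (forall v : B ~> Sh X, Tr (v \oc f) = 0) -> f = 0.
(** With [Tr_inj], Hom(G X, B) behaves as the J-dual of Hom(B, Sigma X). Representability is asked
    for partial forms, so extending a form and representing it are one step. *)
Hypothesis Tr_repr : forall X B (L : (B ~>[T] Sh X) -> J -> Prop), ext_graph L ->
  exists f : G X ~> B, forall v j, L v j -> Tr (v \oc f) = j.

Let Tr0 X : @Tr X 0 = 0. Proof. exact: lin0 (@TrL X). Qed.
Let TrN X (s : G X ~> Sh X) : Tr (- s) = - Tr s.
Proof. exact: linN (@TrL X) s. Qed.
Let TrB X (s t : G X ~> Sh X) : Tr (s - t) = Tr s - Tr t.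
Proof. exact: linB (@TrL X) s t. Qed.

Lemma Tr_eq X B (f f' : G X ~>[T] B) :
  (forall v : B ~> Sh X, Tr (v \oc f) = Tr (v \oc f')) -> f = f'.
Proof.
move=> eq_Tr; apply/eqP; rewrite -subr_eq0; apply/eqP/Tr_inj => v.
by rewrite compBr TrB eq_Tr subrr.
Qed.

Let ffS : faithful Sh. Proof. exact: equivalence_faithful (shift_equiv S). Qed.
Let fuS : full Sh. Proof. exact: equivalence_full (shift_equiv S). Qed.

(** The comparison of G with the shift represents the form sending a shifted morphism Sigma p to Tr
    p; faithfulness of the shift makes this form single-valued. *)
Lemma trace_shift_ex X : exists psi : G (Sh X) ~> Sh (G X),
  forall p : G X ~> Sh X, Tr (fmor Sh p \oc psi) = Tr p.
Proof.
pose L (v : Sh (G X) ~> Sh (Sh X)) j := exists2 p : G X ~> Sh X,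
  v = fmor Sh p & j = Tr p.
have [|psi psiP] := @Tr_repr (Sh X) (Sh (G X)) L.
  split; first by exists 0; rewrite ?fmor0.
    by move=> j [p Dp ->]; rewrite (_ : p = 0) //; apply: ffS; rewrite -Dp fmor0.
  move=> a u v i j [p -> ->] [p' -> ->]; exists (a *: p + p'); last by rewrite TrL.
  by rewrite fmor_linear.
by exists psi => p; apply: psiP; exists p.
Qed.

Definition trace_shift X := sval (cid (trace_shift_ex X)).
Local Notation psi := trace_shift.

Lemma trace_shiftE X (p : G X ~> Sh X) : Tr (fmor Sh p \oc psi X) = Tr p.
Proof. by rewrite /psi; case: cid. Qed.

Lemma trace_shift_nat :
  is_nat_iso (F := fcomp G Sh) (G := fcomp Sh G) trace_shift.
Proof.
split=> [X|X Y f] /=; last first.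
  apply: Tr_eq => v; have [p <-] := fuS v.
  rewrite compmA -Tr_nat compmA -fmorM trace_shiftE Tr_nat -trace_shiftE fmorM.
  by rewrite compmA.
apply: iso_of_bij_r => [Z g g' /eqP|Z h].
  rewrite -subr_eq0 -compBl => /eqP; set d := g - g' => d0.
  suff /eqP : d = 0 by rewrite subr_eq0 => /eqP.
  have [Z' [e [e' [e'e ee']]]] := equivalence_ess_surj (shift_equiv S) Z.
  have [b Db] := fuS (e' \oc d).
  rewrite -[d]comp1m -ee' -compmA -Db (_ : b = 0) ?fmor0 ?comp0r //.
  apply: Tr_inj => v; rewrite -trace_shiftE fmorM Db -!compmA d0.
  by rewrite !comp0r Tr0.
have [Z' [e [e' [e'e ee']]]] := equivalence_ess_surj (shift_equiv S) Z.
(* Testing [fmor Sh b \oc psi X] against [fmor Sh v] yields Tr (v b), so this is the form that b has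
   to represent. *)
pose L (v : Z' ~> Sh X) j := j = Tr (fmor Sh v \oc (e' \oc h)).
have [|b bP] := @Tr_repr X Z' L.
  split=> [|j ->|a u v i j -> ->]; rewrite /L ?fmor0 ?comp0l ?Tr0 //.
  by rewrite fmor_linear compDl compZl TrL.
exists (e \oc fmor Sh b); rewrite -compmA (_ : _ \oc psi X = e' \oc h).
  by rewrite compmA ee' comp1m.
apply: Tr_eq => v; have [v' <-] := fuS v.
by rewrite compmA -fmorM trace_shiftE; apply: bP.
Qed.

Theorem trace_triangle_functor : triangle_functor S G.
Proof.
exists trace_shift; split=> [|X Y Z f g h dfgh]; first exact: trace_shift_nat.
have [W [a [b dW]]] := dist_cone S (fmor G f).
(* Wanted is th : G Z -> W with th G(g) = a and b th = psi G(h). Tested against the trace, these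
   equations prescribe Tr (v th) for v = Sigma(g) u and for v = v' b; L is the resulting form on the
   sum of the two submodules. *)
pose L (v : W ~> Sh Z) j := exists (u : W ~> Sh Y) (v' : Sh (G X) ~> Sh Z),
  v = fmor Sh g \oc u + v' \oc b /\ j = Tr (u \oc a) + Tr (v' \oc psi X \oc fmor G h).
have extL : ext_graph L.
  split.
  - by exists 0, 0; rewrite !comp0l comp0r !Tr0 !addr0.
  (* When the two contributions to v cancel, u and -v' are part of a morphism between rotations of
     [dW] and of the shifted triangle. Its third component is some Sigma w, and the two traces are
     Tr (w G(f)) and its opposite. *)
  - move=> j [u [v' [/esym/eqP]]]; rewrite addr_eq0 -compNl => /eqP Dgu ->.
    have dS : dist S (fmor Sh f) (fmor Sh g) (- fmor Sh h).
      have /dist_rot/dist_rot/dist_rot := dfgh.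
      apply: dist_iso (iso_id _) (iso_opp (iso_id _)) (iso_id _) _ _ _.
      + by rewrite compNl compNr opprK comp1m compm1.
      + by rewrite comp1m compNr compm1.
      + by rewrite fmor1 comp1m compm1.
    have /dist_rot/dist_rot dW' := dW; have /dist_rot dS' := dS.
    have [c [cb uc]] := dist_mor dW' dS' (esym Dgu).
    have [w Dw] := fuS c; rewrite -{c}Dw in cb uc.
    have Sh_w : fmor Sh h \oc - v' = fmor Sh (w \oc fmor G f).
      by apply: oppr_inj; rewrite fmorM -compNl -cb compNr.
    have ua : u \oc a = fmor Sh f \oc w.
      by apply/ffS/oppr_inj; rewrite !fmorM -compNr uc compNl.
    have -> : Tr (v' \oc psi X \oc fmor G h) = - Tr (- v' \oc psi X \oc fmor G h).
      by rewrite !compNl TrN opprK.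
    by rewrite -Tr_nat compmA Sh_w trace_shiftE ua Tr_nat subrr.
  - move=> r s t i j [u [v' [-> ->]]] [u1 [v1 [-> ->]]].
    exists (r *: u + u1), (r *: v' + v1); split.
      by rewrite compDr compZr compDl compZl scalerDr addrACA.
    by rewrite !compDl !compZl !TrL scalerDr addrACA.
have [th thP] := Tr_repr extL.
have thg : th \oc fmor G g = a.
  apply: Tr_eq => u; rewrite compmA -Tr_nat compmA; apply: thP.
  by exists u, 0; rewrite !comp0l Tr0 !addr0.
have bth : b \oc th = psi X \oc fmor G h.
  apply: Tr_eq => v; rewrite !compmA; apply: thP.
  by exists 0, v; rewrite comp0l comp0r Tr0 !add0r.
have [th' [th'K Kth']] : is_iso th.
  apply: (five_lemma (equivalence_hom_exact equivG trace_shift_nat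
    (triangulation_exact dfgh))
    (triangulation_exact dW) (iso_id _) (iso_id _)).
  - by rewrite comp1m compm1.
  - by rewrite compm1.
  - by rewrite fmor1 comp1m bth.
apply: dist_iso (iso_id _) (iso_id _) (_ : is_iso th') _ _ _ dW.
- by exists th.
- by rewrite comp1m compm1.
- by rewrite compm1 -thg compmA th'K comp1m.
- by rewrite fmor1 comp1m -bth -compmA Kth' compm1.
Qed.

End TraceFunctor.

(** * Quasi-inverses of triangle functors *)

Section QuasiInverse.
Variables (R : comPzRingType) (T : linCat R) (S : triangulation T).
Variables (F G : functor T T).
Local Notation Sh := (shift S).

(** G carries a triangle on [fmor F f] to one isomorphic, through [ka], to the given triangle; full
    faithfulness of G brings the isomorphism of third terms back. *)
Lemma quasi_inverse_triangle_functor :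
  quasi_inverse F G -> triangle_functor S G -> triangle_functor S F.
Proof.
move=> qFG [psi [[iso_psi psiN] psiD]].
have equivG : is_equivalence G by exists F; exact: quasi_inverse_sym.
have ffG := equivalence_faithful equivG; have fuG := equivalence_full equivG.
have [[ka [iso_ka kaN]] _] := qFG.
have {}kaN X Y (f : X ~> Y) : ka Y \oc fmor G (fmor F f) = f \oc ka X := kaN X Y f.
have {}psiN X Y (f : X ~> Y) :
  psi Y \oc fmor G (fmor Sh f) = fmor Sh (fmor G f) \oc psi X := psiN X Y f.
have phi_ex X : exists phi : F (Sh X) ~> Sh (F X),
    fmor Sh (ka X) \oc (psi (F X) \oc fmor G phi) = ka (Sh X).
  have [p [pK Kp]] := fmor_iso Sh (iso_ka X).
  have [r [rK Kr]] := iso_psi (F X).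
  have [phi Dphi] := fuG _ _ (r \oc (p \oc ka (Sh X))); exists phi.
  by rewrite Dphi (compmA (psi _)) Kr comp1m compmA Kp comp1m.
pose phi X := sval (cid (phi_ex X)).
have phiE X : fmor Sh (ka X) \oc (psi (F X) \oc fmor G (phi X)) = ka (Sh X).
  by rewrite /phi; case: cid.
have iso_S X := fmor_iso Sh (iso_ka X).
have cancel_phi X Y (s t : Y ~> Sh (F X)) :
    fmor Sh (ka X) \oc (psi (F X) \oc fmor G s) =
    fmor Sh (ka X) \oc (psi (F X) \oc fmor G t) -> s = t.
  by move=> /(iso_monic (iso_S X)) /(iso_monic (iso_psi _)) /ffG.
exists phi; split; first split=> [X|X Y f] /=.
- apply: (iso_reflect ffG fuG); have [r [rK Kr]] := iso_psi (F X).
  have [p [pK Kp]] := iso_S X.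
  have -> : fmor G (phi X) = r \oc (p \oc ka (Sh X)).
    by rewrite -phiE (compmA p) pK comp1m compmA rK comp1m.
  apply: iso_comp; first by exists (psi (F X)).
  by apply: iso_comp; [exists (fmor Sh (ka X)) | exact: iso_ka].
- apply: cancel_phi; rewrite !fmorM (compmA (psi _)) (compmA (fmor Sh _)) phiE kaN.
  rewrite (compmA (psi (F Y))) psiN -!compmA (compmA (fmor Sh (ka Y))) -fmorM kaN fmorM.
  by rewrite -compmA phiE.
- move=> X Y Z f g h dfgh.
  have [W [a [b dW]]] := dist_cone S (fmor F f).
  have [|c [iso_c cg ch]] := triangulation_five (psiD _ _ _ _ _ _ dW) dfgh (iso_ka X)
    (iso_ka Y).
    by rewrite kaN.
  have [k [kK Kk]] := iso_ka Z; have [ga Dga] := fuG _ _ (k \oc c).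
  have Dc : ka Z \oc fmor G ga = c by rewrite Dga compmA Kk comp1m.
  have iso_ga : is_iso ga.
    by apply: (iso_reflect ffG fuG); rewrite Dga; apply: iso_comp => //; exists (ka Z).
  apply: dist_iso (iso_id _) (iso_id _) iso_ga _ _ _ dW.
  + by rewrite comp1m compm1.
  + apply/ffG/(iso_monic (iso_ka Z)).
    by rewrite compm1 kaN fmorM compmA Dc cg.
  + rewrite fmor1 comp1m; apply: cancel_phi.
    rewrite ch -Dc !fmorM -!compmA (compmA (psi _) (fmor G (phi X))).
    by rewrite (compmA (fmor Sh _) (_ \oc fmor G (phi X))) phiE [RHS]compmA kaN -compmA.
Qed.

End QuasiInverse.

(** * Additive closures and induced functors *)

Section AddHull.
Variables (R : comPzRingType) (C : linCat R) (addC : is_additive C).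

Lemma add_hull_sub (P V : set C) : (forall X, P X -> add_hull V X) ->
  forall X, add_hull P X -> add_hull V X.
Proof.
move=> PV X; elim=> {X} [X /PV //|X X0|A B S AB _ VA _ VB|A B S AB _ VS].
- exact: add_zero.
- exact: add_sum AB VA VB.
- exact: add_summand AB VS.
Qed.

Lemma add_hullS (P V : set C) : P `<=` V -> forall X, add_hull P X -> add_hull V X.
Proof. by move=> PV; apply: add_hull_sub => X /PV; apply: add_in. Qed.

Lemma add_hull_iso (P : set C) X Y : @isomorphic R C X Y -> add_hull P Y -> add_hull
  P X.
Proof.
move=> XY; have [[O O0] _] := addC.
exact: add_summand (iso_sum XY O0).
Qed.

Hypothesis wic : weakly_idempotent_complete C.

(** The hull is closed under direct summands; weak idempotent completeness makes the kernel of r a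
    complement of X. *)
Lemma add_hull_retract (P : set C) X Z (s : X ~>[C] Z) (r : Z ~> X) :
  r \oc s = idm X -> add_hull P Z -> add_hull P X.
Proof.
move=> rs; have [V [k [rk kP]]] := wic (ex_intro _ s rs).
have rp : r \oc (idm Z - s \oc r) = 0 by rewrite compBr compm1 compmA rs comp1m subrr.
have [p [kp _]] := kP _ _ rp.
have k_inj U (w w' : U ~> V) : k \oc w = k \oc w' -> w = w'.
  move=> eq_kw; have [|w0 [_ w0P]] := kP _ (k \oc w).
    by rewrite compmA rk comp0l.
  by rewrite -(w0P w erefl) -(w0P w').
apply: (add_summand (B := V)); exists s, k, r, p; split=> //.
- by apply: k_inj; rewrite compmA kp compBl -compmA rk comp0r subr0 comp1m compm1.
- by apply: k_inj; rewrite compmA kp compBl -compmA rs compm1 comp1m subrr comp0r.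
- by rewrite kp addrC subrK.
Qed.

Lemma add_hull_idm (P : set C) X : add_hull P X <-> in_ideal (add_ideal addC P) (idm X).
Proof.
split=> [PX|[Z [a [b [PZ ba]]]]]; last exact: add_hull_retract (esym ba) PZ.
by exists X, (idm X), (idm X); rewrite comp1m.
Qed.

Lemma add_ideal_thru (P : set C) X Z Y (a : X ~>[C] Z) (b : Z ~> Y) :
  add_hull P Z -> in_ideal (add_ideal addC P) (b \oc a).
Proof. by move=> PZ; exists Z, a, b. Qed.

(** F respects direct sums only modulo I2. The identity of the image therefore differs from a map
    through hull objects by a morphism of I2, which also lies in the ideal of V. *)
Lemma functor_hull (I1 I2 : ideal C) (F : functor (quotCat I1) (quotCat I2)) (P V :
  set C) :
  (forall X Y (f : X ~>[C] Y), in_ideal I2 f -> in_ideal (add_ideal addC V) f) ->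
  (forall X, P X -> add_hull V (F X)) ->
  forall X, add_hull P X -> add_hull V (F X).
Proof.
move=> I2V PV X; elim=> {X} [X /PV //|X X0|A B S [iA [iB [pA [pB bp]]]] _ VA _ VB
  |A B S [iA [iB [pA [pB bp]]]] _ VS].
- apply/add_hull_idm/I2V/quot_mor_eq0; rewrite quot_mor1.
  exact/(fmor_zero F)/(fmor_zero (quot_functor I1) X0).
- have [_ _ _ _] := fmor_biprod F (quot_biprod I1 bp).
  have [a <-] := quot_mor_surj (fmor F (quot_mor I1 iA)).
  have [a' <-] := quot_mor_surj (fmor F (quot_mor I1 pA)).
  have [b <-] := quot_mor_surj (fmor F (quot_mor I1 iB)).
  have [b' <-] := quot_mor_surj (fmor F (quot_mor I1 pB)).
  rewrite -!quot_morM -quot_morD -quot_mor1 => /quot_mor_eq/I2V HI.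
  have subm := ideal_submod (add_ideal addC V) (F S : C) (F S).
  apply/add_hull_idm; rewrite -[idm _](subKr (a \oc a' + b \oc b')).
  apply: (submoduleB subm) => //; apply: (submoduleD subm); exact: add_ideal_thru.
- have [+ _ _ _ _] := fmor_biprod F (quot_biprod I1 bp).
  have [a <-] := quot_mor_surj (fmor F (quot_mor I1 iA)).
  have [a' <-] := quot_mor_surj (fmor F (quot_mor I1 pA)).
  rewrite -!quot_morM -quot_mor1 => /quot_mor_eq/I2V HI.
  have subm := ideal_submod (add_ideal addC V) (F A : C) (F A).
  apply/add_hull_idm; rewrite -[idm _](subKr (a' \oc a)).
  apply: (submoduleB subm) => //; exact: add_ideal_thru.
Qed.

End AddHull.

(** * Functors induced on a further quotient *)

Section InducedFunctors.
Variables (R : comPzRingType) (C : linCat R) (K : ideal C).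

Section Projection.
Variables (I : ideal C) (IK : forall X Y (f : X ~>[C] Y), in_ideal I f -> in_ideal K f).

Definition quot_proj (X Y : C) (f : X ~>[quotCat I] Y) : X ~>[quotCat K] Y :=
  quot_mor K (generic_quotient.repr f).

Lemma quot_projE X Y (f : X ~>[C] Y) : quot_proj (quot_mor I f) = quot_mor K f.
Proof.
apply/quot_mor_eq/IK/quot_mor_eq.
by rewrite /quot_mor /to_lquot generic_quotient.reprK.
Qed.

Lemma quot_proj_functor : is_functor (C := quotCat I) (D := quotCat K) quot_proj.
Proof.
split=> [X Y a f g|X|X Y Z g f].
- have [f0 <-] := quot_mor_surj f; have [g0 <-] := quot_mor_surj g.
  by rewrite -quot_mor_linear !quot_projE quot_mor_linear.
- by rewrite -[idm X]quot_mor1 quot_projE.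
- have [f0 <-] := quot_mor_surj f; have [g0 <-] := quot_mor_surj g.
  by rewrite -quot_morM !quot_projE quot_morM.
Qed.

Lemma quot_proj_linear X Y : linear (@quot_proj X Y).
Proof. by case: quot_proj_functor. Qed.

Lemma quot_proj1 (X : C) : quot_proj (idm (X : quotCat I)) = idm (X : quotCat K).
Proof. by case: quot_proj_functor. Qed.

Lemma quot_projM (X Y Z : C) (g : Y ~>[quotCat I] Z) (f : X ~>[quotCat I] Y) :
  quot_proj (g \oc f) = quot_proj g \oc quot_proj f.
Proof. by case: quot_proj_functor. Qed.

Definition quot_proj_f : functor (quotCat I) (quotCat K) := Functor quot_proj_functor.

End Projection.

Section Induced.
Variables (I I' : ideal C) (F : functor (quotCat I) (quotCat I')).
Hypothesis IK : forall X Y (f : X ~>[C] Y), in_ideal I f -> in_ideal K f.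
Hypothesis IK' : forall X Y (f : X ~>[C] Y), in_ideal I' f -> in_ideal K f.
Hypothesis FK : forall X Y (f : X ~>[C] Y) (t : (F X : C) ~>[C] (F Y : C)),
  in_ideal K f -> fmor F (quot_mor I f) = quot_mor I' t -> in_ideal K t.

Definition induced_mor (X Y : C) (f : X ~>[quotCat K] Y) : F X ~>[quotCat K] F Y :=
  quot_proj (fmor F (quot_mor I (generic_quotient.repr f))).

Lemma induced_morE X Y (f : X ~>[quotCat I] Y) :
  induced_mor (quot_proj f) = quot_proj (fmor F f).
Proof.
have [f0 <-] := quot_mor_surj f; rewrite quot_projE // /induced_mor.
set f1 := generic_quotient.repr _.
have Kf : in_ideal K (f1 - f0).
  by apply/quot_mor_eq; rewrite /quot_mor /f1 /to_lquot generic_quotient.reprK.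
have [t Dt] := quot_mor_surj (fmor F (quot_mor I (f1 - f0))).
have := FK Kf (esym Dt) => /quot_mor_eq0; rewrite -(quot_projE IK') Dt quot_morD
  quot_morN.
rewrite (fmorB F) (linB (quot_proj_linear IK' (X := _) (Y := _))) => /eqP.
by rewrite subr_eq0 => /eqP.
Qed.

Lemma induced_induces : induces F induced_mor.
Proof. by move=> X Y f t Ft; rewrite -(quot_projE IK) induced_morE Ft quot_projE. Qed.

Lemma induced_functor : is_functor (C := quotCat K) (D := quotCat K) induced_mor.
Proof.
have surj X Y (f : X ~>[quotCat K] Y) : exists f0 : X ~>[quotCat I] Y, quot_proj f0 = f.
  have [f0 <-] := quot_mor_surj f; exists (quot_mor I f0); exact: quot_projE.
split=> [X Y a f g|X|X Y Z g f].
- have [f0 <-] := surj _ _ f; have [g0 <-] := surj _ _ g.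
  have <- : quot_proj (a *: f0 + g0) = a *: quot_proj f0 + quot_proj g0.
    exact: (quot_proj_linear IK).
  rewrite !induced_morE (fmor_linear F); exact: (quot_proj_linear IK').
- rewrite -[idm X](quot_proj1 IK) induced_morE (fmor1 F); exact: (quot_proj1 IK').
- have [f0 <-] := surj _ _ f; have [g0 <-] := surj _ _ g.
  have <- : quot_proj (g0 \oc f0) = quot_proj g0 \oc quot_proj f0 by exact:
    (quot_projM IK).
  rewrite !induced_morE (fmorM F); exact: (quot_projM IK').
Qed.

End Induced.

Lemma induced_nat (I I' : ideal C) (F : functor (quotCat I) (quotCat I'))
    (G : functor (quotCat I') (quotCat I))
    (F1 : forall X Y : C, (X ~>[quotCat K] Y) -> (F X ~>[quotCat K] F Y))
    (G1 : forall X Y : C, (X ~>[quotCat K] Y) -> (G X ~>[quotCat K] G Y))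
    (F1P : is_functor (C := quotCat K) (D := quotCat K) F1)
    (G1P : is_functor (C := quotCat K) (D := quotCat K) G1) :
  (forall X Y (f : X ~>[C] Y), in_ideal I f -> in_ideal K f) ->
  induces F F1 -> induces G G1 ->
  nat_isomorphic (fcomp G F) (fid (quotCat I)) ->
  nat_isomorphic (fcomp (Functor G1P) (Functor F1P)) (fid (quotCat K)).
Proof.
move=> IK indF indG [phi [iso_phi phiN]].
exists (fun X => quot_proj (phi X)); split=> [X|X Y f].
  exact: (fmor_iso (quot_proj_f IK) (iso_phi X)).
have [f0 <-] := quot_mor_surj f.
have [t Dt] := quot_mor_surj (fmor F (quot_mor I f0)).
have [u Du] := quot_mor_surj (fmor G (quot_mor I' t)).
have -> : fmor (fcomp (Functor G1P) (Functor F1P)) (quot_mor K f0) = quot_mor K u.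
  exact: etrans (congr1 (@G1 _ _) (indF _ _ _ _ (esym Dt))) (indG _ _ _ _ (esym Du)).
have := phiN X Y (quot_mor I f0); rewrite /= -Dt -Du.
move=> /(congr1 (fmor (quot_proj_f IK) (X := _) (Y := _))).
by rewrite !fmorM /= !quot_projE.
Qed.

End InducedFunctors.

(** * The pairing of an Auslander-Reiten-Serre duality *)

Section StableIdeals.
Variables (R : comPzRingType) (C : extriCat R).
Local Notation push := (push (EE C)).
Local Notation pull := (pull (EE C)).
Local Notation conf d x y := (Defs.realz C d x y).
Hypotheses (enoughP : enough_projectives C) (enoughI : enough_injectives C).

Lemma proj_ideal_add (V : set C) : projective C `<=` add_hull V ->
  forall (X Y : C) (f : X ~> Y), in_ideal (proj_ideal C) f ->
  in_ideal (add_ideal (ecat_additive C) V) f.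
Proof.
move=> QV X Y f Pf; have [A [P [d [x [y [xy projP]]]]]] := enoughP Y.
by have [l ->] := conf_lift_pull xy (Pf _ d); apply/add_ideal_thru/QV.
Qed.

Lemma inj_ideal_add (V : set C) : injectiveo C `<=` add_hull V ->
  forall (X Y : C) (f : X ~> Y), in_ideal (inj_ideal C) f ->
  in_ideal (add_ideal (ecat_additive C) V) f.
Proof.
move=> QV X Y f If; have [A [I [d [x [y [xy injI]]]]]] := enoughI X.
have [l ->] := conf_ext_push xy (If _ d).
by exists I, x, l; split=> //; apply: QV.
Qed.

Lemma projective_zero (X : C) : is_zero (X : stableP C) <-> projective C X.
Proof.
split=> [/(quot_mor_eq0 (proj_ideal C) (idm X)) X0 A d|projX].
  by rewrite -[d]pull_id; apply: X0.
by apply/(quot_mor_eq0 (proj_ideal C) (idm X)) => A d; apply: projX.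
Qed.

Lemma injective_zero (X : C) : is_zero (X : stableI C) <-> injectiveo C X.
Proof.
split=> [/(quot_mor_eq0 (inj_ideal C) (idm X)) X0 A d|injX].
  by rewrite -[d]push_id; apply: X0.
by apply/(quot_mor_eq0 (inj_ideal C) (idm X)) => A d; apply: injX.
Qed.

Lemma projective_retract (X Z : C) (s : X ~> Z) (r : Z ~> X) :
  r \oc s = idm X -> projective C Z -> projective C X.
Proof. by move=> rs projZ A d; rewrite -[d]pull_id -rs pull_comp [pull r d]projZ
  pull0. Qed.

Lemma projective_sum (A B S : C) : is_sum A B S ->
  projective C A -> projective C B -> projective C S.
Proof.
move=> [iA [iB [pA [pB [_ _ _ _ sum1]]]]] projA projB X d.
by rewrite -[d]pull_id -sum1 pullDl !pull_comp [pull iA d]projA [pull iB d]projB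
  !pull0 addr0.
Qed.

Lemma stableI_pushE X Y (f g : X ~>[C] Y) B (d : EE C B X) :
  quot_mor (inj_ideal C) f = quot_mor (inj_ideal C) g -> push f d = push g d.
Proof.
move=> /quot_mor_eq/(_ _ d); rewrite pushBl => /eqP.
by rewrite subr_eq0 => /eqP.
Qed.

(* The pushout along the inflation of f^*d kills f^*d. *)
Lemma conf_kill_pull (V : set C) (X A Z Y : C) (d : EE C X A) (x : A ~> Z) (y : Z ~> X)
    (f : Y ~> X) : conf d x y -> add_hull V Z -> add_hull V Y ->
  exists (A' Z' : C) (a : A ~> A') (x' : A' ~> Z') (y' : Z' ~> X),
  [/\ conf (push a d) x' y', add_hull V Z' & pull f (push a d) = 0].
Proof.
move=> xy VZ VY.
have [M [B1 [B2 [e1 [e2 [v1 [u1 [h1 [v2 [u2 [h2]]]]]]]]]]] := conf_glue_l d (pull f d).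
move=> [[c1 c1' _] [c2 c2' _ _]].
exists B2, M, v2, h2, e1; split=> //; last by rewrite -push_pull (conf_push0 c2).
have [b [iso_b _ _]] := conf_equiv c1 xy.
move: c1'; rewrite push_pull (conf_push0 c1) pull0 => /conf_split [i [p bp]].
apply: (add_sum (A := B1) (B := Y)) => //; first by exists h1, i, p, e2.
by apply: (add_hull_iso (ecat_additive C)) VZ; exists b.
Qed.

Lemma conf_kill_push (V : set C) (X A Z Y : C) (d : EE C X A) (x : A ~> Z) (y : Z ~> X)
    (h : A ~> Y) : conf d x y -> add_hull V Z -> add_hull V Y ->
  exists (X' Z' : C) (c : X' ~> X) (x' : A ~> Z') (y' : Z' ~> X'),
  [/\ conf (pull c d) x' y', add_hull V Z' & push h (pull c d) = 0].
Proof.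
move=> xy VZ VY.
have [M [B1 [B2 [m1 [m2 [u1 [v1 [h1 [u2 [v2 [h2]]]]]]]]]]] := conf_glue_r d (push h d).
move=> [[c1 c1' _] [c2 c2' _ _]].
exists B2, M, v2, m1, h2; split=> //; last by rewrite push_pull (conf_pull0 c2).
have [b [iso_b _ _]] := conf_equiv c1 xy.
move: c1'; rewrite -push_pull (conf_pull0 c1) push0 => /conf_split [i [p bp]].
apply: (add_sum (A := Y) (B := B1)) => //; first by exists m2, i, p, h1.
by apply: (add_hull_iso (ecat_additive C)) VZ; exists b.
Qed.

Lemma pull_hull (V : set C) (X A : C) (d : EE C X A) :
  (forall Z (k : Z ~> X), V Z -> pull k d = 0) ->
  forall Z (k : Z ~> X), add_hull V Z -> pull k d = 0.
Proof.
move=> Vd Z + HZ; elim: {Z} HZ => [Z VZ k|Z Z0 k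
  |A1 B1 S [iA [iB [pA [pB [_ _ _ _ sum1]]]]] _ HA _ HB k
  |A1 B1 S [iA [iB [pA [pB [pi1 _ _ _ _]]]]] _ HS k].
- exact: Vd.
- by rewrite (zero_hom_l k Z0) pull0l.
- by rewrite -[k]compm1 -sum1 compDr !compmA pullDl !pull_comp -!(pull_comp k) HA HB
  !pull0 addr0.
- by rewrite -[k]compm1 -pi1 compmA pull_comp HS pull0.
Qed.

Lemma push_hull (V : set C) (X A : C) (d : EE C X A) :
  (forall Z (k : A ~> Z), V Z -> push k d = 0) ->
  forall Z (k : A ~> Z), add_hull V Z -> push k d = 0.
Proof.
move=> Vd Z + HZ; elim: {Z} HZ => [Z VZ k|Z Z0 k
  |A1 B1 S [iA [iB [pA [pB [_ _ _ _ sum1]]]]] _ HA _ HB k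
  |A1 B1 S [iA [iB [pA [pB [pi1 _ _ _ _]]]]] _ HS k].
- exact: Vd.
- by rewrite (zero_hom_r k Z0) push0l.
- by rewrite -[k]comp1m -sum1 compDl -!compmA pushDl !push_comp -!(push_comp _ k) HA
  HB !push0 addr0.
- by rewrite -[k]comp1m -pi1 -compmA push_comp HS push0.
Qed.

End StableIdeals.

Section Pairing.
Variables (R : comPzRingType) (J : lmodType R) (C : extriCat R).
Variable sigma : functor (stableI C) (stableP C).
Local Notation push := (push (EE C)).
Local Notation pull := (pull (EE C)).

(** The duality at A = sigma X, transported along tau (sigma X) = X and written on morphisms of C,
    so that only [sigma] remains in it. *)
Record ars_pairing (pr : forall X B : C, ((sigma X : C) ~>[C] B) -> EE C B X -> J) :
  Prop :=
  ARSPairing {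
  pr_linear_l : forall X B (d : EE C B X), linear (fun f => pr X B f d);
  pr_linear_r : forall X B f, linear (@pr X B f);
  pr_pull : forall X B B' (f : (sigma X : C) ~> B) (b : B ~> B') (d : EE C B' X),
    pr X B' (b \oc f) d = pr X B f (pull b d);
  pr_push : forall X Y B (g : X ~>[C] Y) (s : (sigma X : C) ~>[C] (sigma Y : C))
      (f : (sigma Y : C) ~> B) (d : EE C B X),
    fmor sigma (quot_mor (inj_ideal C) g) = quot_mor (proj_ideal C) s ->
    pr X B (f \oc s) d = pr Y B f (push g d);
  pr_eq0 : forall X B (f : (sigma X : C) ~> B),
    (forall d, pr X B f d = 0) <-> in_ideal (proj_ideal C) f;
  pr_repr : forall X B (L : {linear EE C B X -> J}), exists f, forall d,
    pr X B f d = L d }.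

Lemma ars_pairing_ex (D : ARS_duality J C) : quasi_inverse (tau D) sigma ->
  exists pr, ars_pairing pr.
Proof.
move=> [_ [phi [iso_phi phiN]]].
(* E is a functor on C, so the isomorphism between X and tau (sigma X) is lifted to C. The lifts are
   inverse modulo the injective ideal, and pushouts see no more than that. *)
have eps_ex X : exists e : (X ~>[C] tau D (sigma X)) * ((tau D (sigma X) : C) ~>[C] X),
    [/\ quot_mor (inj_ideal C) e.2 = phi X,
        quot_mor (inj_ideal C) (e.2 \oc e.1) = quot_mor (inj_ideal C) (idm X)
      & quot_mor (inj_ideal C) (e.1 \oc e.2) =
        quot_mor (inj_ideal C) (idm (tau D (sigma X) : C))].
  have [psi [psiK Kpsi]] := iso_phi X.
  have [e De] := quot_mor_surj psi; have [e' De'] := quot_mor_surj (phi X).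
  by exists (e, e'); rewrite /= !quot_morM De De' psiK Kpsi.
pose eps X := (sval (cid (eps_ex X))).1; pose eps' X := (sval (cid (eps_ex X))).2.
have eps'E X : quot_mor (inj_ideal C) (eps' X) = phi X.
  by rewrite /eps'; case: cid => ? [].
have epsK X : quot_mor (inj_ideal C) (eps' X \oc eps X) = quot_mor (inj_ideal C) (idm
  X).
  by rewrite /eps' /eps; case: cid => ? [].
have epsK' X : quot_mor (inj_ideal C) (eps X \oc eps' X) =
    quot_mor (inj_ideal C) (idm (tau D (sigma X) : C)).
  by rewrite /eps' /eps; case: cid => ? [].
pose pr X B (f : (sigma X : C) ~>[C] B) (d : EE C B X) : J :=
  ars_eta D (quot_mor (proj_ideal C) f : sigma X ~>[stableP C] B) (push (eps X) d).
exists pr; split=> [X B d a f g|X B f a d e|X B B' f b d|X Y B g s f d Ds|X B f|X B L].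
- by rewrite /pr quot_mor_linear ars_linear.
- by rewrite /pr push_linear linearP.
- by rewrite /pr quot_morM ars_nat_r push_pull.
- have [t Dt] := quot_mor_surj (fmor (tau D) (quot_mor (proj_ideal C) s)).
  rewrite /pr quot_morM (ars_nat_l _ Dt) -!push_comp; congr (ars_eta D _ _).
  apply: stableI_pushE; rewrite !quot_morM Dt -Ds.
  have N := phiN X Y (quot_mor (inj_ideal C) g).
  have phiE Z : phi Z \oc (quot_mor (inj_ideal C) (eps Z) : Z ~>[stableI C] tau D
    (sigma Z)) = idm Z.
    by rewrite -eps'E -quot_morM epsK.
  apply: (iso_monic (iso_phi Y)); rewrite [LHS]compmA [RHS]compmA phiE comp1m.
  by rewrite [X in X \oc _]N -compmA phiE compm1.
- split=> [f0|Pf d]; last first.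
    rewrite /pr (_ : quot_mor _ f = 0); last exact/quot_mor_eq0.
    have := @ars_linear _ _ _ D (sigma X) B (-1) 0 0 (push (eps X) d).
    by rewrite scaler0 addr0 scaleN1r addNr.
  apply/quot_mor_eq0; apply: (@ars_inj _ _ _ D) => d.
  have -> : ars_eta D (0 : sigma X ~>[stableP C] B) d = 0.
    have := @ars_linear _ _ _ D (sigma X) B (-1) 0 0 d.
    by rewrite scaler0 addr0 scaleN1r addNr.
  have := f0 (push (eps' X) d); rewrite /pr -push_comp.
  by rewrite (stableI_pushE d (epsK' X)) push_id.
- have LL : linear (fun d : EE C B (tau D (sigma X)) => L (push (eps' X) d)).
    by move=> a d e; rewrite push_linear linearP.
  have [f fP] := ars_surj (mklin LL).
  have [f0 Df] := quot_mor_surj f; exists f0 => d.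
  rewrite /pr Df fP mklinE -push_comp.
  by rewrite (stableI_pushE d (epsK X)) push_id.
Qed.

End Pairing.

(** * Generators of the preprojectives *)

Section ProjectiveGenerator.
Variables (R : comPzRingType) (C : extriCat R).
Hypotheses (wic : weakly_idempotent_complete C) (ksC : krull_schmidt C).
Hypothesis fin_ind : finite_set (ind (projective C)).

Lemma local_indecomposable (X : C) : local_end X -> indecomposable X.
Proof.
move=> [X0 locX]; split=> // A B [iA [iB [pA [pB [e1 e2 e3 e4 sum1]]]]].
have [[g [gf _]]|[g [gf _]]] := locX (iA \oc pA) (iB \oc pB)
  (eq_rect_r (fun f => is_iso f) (iso_id X) sum1).
- right; rewrite /is_zero -e2.
  by rewrite -[iB]comp1m -gf -!compmA e3 !comp0r.
- left; rewrite /is_zero -e1.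
  by rewrite -[iA]comp1m -gf -!compmA e4 !comp0r.
Qed.

Lemma add_hull_finsum (V : set C) n (F : 'I_n -> C) (X : C) :
  is_finsum F X -> (forall k, add_hull V (F k)) -> add_hull V X.
Proof.
move=> [i [p [_ _ sum1]]] VF; apply/(add_hull_idm (ecat_additive C) wic); rewrite -sum1.
have subm := ideal_submod (add_ideal (ecat_additive C) V) X X.
elim/big_rec: _ => [|k f _ Vf]; first exact: submodule0 subm.
by apply: (submoduleD subm) => //; apply: add_ideal_thru.
Qed.

Lemma projective_generator : exists TQ : C,
  projective C TQ /\ forall P, projective C P -> add_hull [set TQ] P.
Proof.
have [TQ [projTQ TQP]] : exists TQ : C, projective C TQ /\
    forall X, indecomposable X -> projective C X -> add_hull [set TQ] X.
  have [s Ds] := (finite_seqP _).1 fin_ind.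
  suff [TQ [projTQ TQP]] : exists TQ : C, projective C TQ /\ forall X,
    indecomposable X ->
      projective C X -> @isomorphic R C X \in s -> add_hull [set TQ] X.
    exists TQ; split=> // X indX projX; apply: TQP => //.
    have : ind (projective C) (@isomorphic R C X) by exists X.
    by rewrite Ds.
  elim: s {Ds} => [|a s [TQ [projTQ TQP]]].
    by have [O O0] := zero_ex C; exists O; split=> // A d;
      rewrite -[d]pull_id O0 pull0l.
  have [[X0 [indX0 projX0 X0a]]|no] := pselect (exists X0 : C,
      [/\ indecomposable X0, projective C X0 & @isomorphic R C X0 = a]); last first.
    exists TQ; split=> // X indX projX; rewrite inE => /orP[/eqP Xa|]; last exact: TQP.
    by case: no; exists X.
  have [S [iT [iX [pT [pX bp]]]]] := biprod_ex TQ X0.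
  have S_TQ : add_hull [set S] TQ.
    by apply: (add_summand (B := X0) (S := S)); [exists iT, iX, pT, pX | exact: add_in].
  have S_X0 : add_hull [set S] X0.
    apply: (add_summand (B := TQ) (S := S)); last exact: add_in.
    by exists iX, iT, pX, pT; exact: biprod_sym.
  exists S; split; first by apply: projective_sum projTQ projX0; exists iT, iX, pT, pX.
  move=> X indX projX; rewrite inE => /orP[/eqP Xa|Xs].
    apply: (add_hull_iso (ecat_additive C)) S_X0.
    have : @isomorphic R C X0 X0 by exists (idm X0); exact: iso_id.
    by rewrite X0a -Xa.
  by apply: add_hull_sub (TQP X indX projX Xs) => _ ->.
exists TQ; split=> // P projP; have [n [F [sumF locF]]] := ksC P.
apply: (add_hull_finsum sumF) => k; apply: TQP; first exact: local_indecomposable.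
case: sumF => i [p [pi1 _ _]].
exact: projective_retract (pi1 k) projP.
Qed.

End ProjectiveGenerator.

(** * Finiteness of the class of preprojectives *)

Section PreprojectiveGenerator.
Variables (R : comPzRingType) (C : extriCat R).
Variables (F : functor (stableP C) (stableI C)) (sigma : functor (stableI C) (stableP
  C)).
Hypotheses (wic : weakly_idempotent_complete C) (enoughP : enough_projectives C)
  (enoughI : enough_injectives C).
Hypothesis sigmaF : nat_isomorphic (fcomp sigma F) (fid (stableP C)).
Local Notation K := (preprojectives sigma).
Local Notation sg := (fun X : C => (sigma X : C)).
Local Notation ta := (fun X : C => (F X : C)).

Lemma sigma_hull (P V : set C) : projective C `<=` add_hull V ->
  (forall X, P X -> add_hull V (sigma X)) -> forall X,
    add_hull P X -> add_hull V (sigma X).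
Proof.
by move=> QV; apply: functor_hull (proj_ideal_add enoughP QV); exact: wic.
Qed.

Lemma projective_preprojective : projective C `<=` K.
Proof. by move=> P projP; apply: add_in; exists 0%N, P. Qed.

Lemma sigma_preprojective X : K X -> K (sigma X).
Proof.
apply: sigma_hull; first exact: projective_preprojective.
by move=> _ [n [P [projP ->]]]; apply: add_in; exists n.+1, P.
Qed.

Lemma sigmaF_hull (V : set C) Y : projective C `<=` add_hull V ->
  add_hull V Y -> add_hull V (sigma (F Y)).
Proof.
move=> QV VY; have [phi [iso_phi _]] := sigmaF; have [psi [psiK _]] := iso_phi Y.
have [f Df] := quot_mor_surj (phi Y); have [g Dg] := quot_mor_surj psi.
move: psiK; rewrite -Df -Dg -quot_morM -[idm _]quot_mor1 => /esym/quot_mor_eq.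
move=> /(proj_ideal_add enoughP QV) HI.
have subm := ideal_submod (add_ideal (ecat_additive C) V) (sg (F Y)) (sg (F Y)).
apply/(add_hull_idm (ecat_additive C) wic); rewrite -[idm _](subrK (g \oc f)).
by apply: (submoduleD subm) => //; apply: add_ideal_thru.
Qed.

(** Finite pieces of the two orbits; with the strict bounds [U 0] and [L 0] are empty. *)
Let U n : set C := [set X | exists k P, [/\ (k < n)%N,
  projective C P & X = iter k sg P]].
Let L n : set C := [set X | exists k I, [/\ (k < n)%N,
  injectiveo C I & X = iter k ta I]].

Let U_in n k P : (k < n)%N -> projective C P -> add_hull (U n) (iter k sg P).
Proof. by move=> kn projP; apply: add_in; exists k, P. Qed.

Let Q_hull n V : U n.+1 `<=` V -> projective C `<=` add_hull V.
Proof. by move=> UV P projP; apply/add_in/UV; exists 0%N, P. Qed.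

(** Up to projectives, [sigma] moves [sigma^k P] one step up and [tau^k I] one step down. An
    injective I is zero in the quotient where [sigma] starts, so its image is projective and changes
    to the side of U. *)
Let UL_step a b X : add_hull (U a `|` L b.+1) X -> add_hull (U a.+1 `|` L b) (sigma X).
Proof.
have QV : projective C `<=` add_hull (U a.+1 `|` L b) by apply: (@Q_hull a) => X' UX;
  left.
apply: (sigma_hull QV) => _ [[k [P [ka projP ->]]]|[[|k] [I [kb injI ->]]]].
- by apply: add_in; left; exists k.+1, P.
- by apply/QV/projective_zero/(fmor_zero sigma)/injective_zero.
- by apply: (sigmaF_hull QV); apply: add_in; right; exists k, I.
Qed.

Let UL_iter a b X : add_hull (U a `|` L b) X -> add_hull (U (a + b)) (iter b sg X).
Proof.
elim: b a X => [|b IH] a X.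
  by rewrite addn0; apply: add_hullS => Y [//|[k [I []]]].
by move/UL_step/IH; rewrite iterSr addSnnS.
Qed.

Let translates_bound X : add_hull (translates F) X -> exists b, add_hull (L b) X.
Proof.
have LS b b' : (b <= b')%N -> L b `<=` L b'.
  by move=> bb' Y [k [I [kb injI ->]]]; exists k, I; split=> //; apply: leq_trans bb'.
elim=> {X} [X [n [I [injI ->]]]|X X0|A B S AB _ [a HA] _ [b HB]|A B S AB _ [b HS]].
- by exists n.+1; apply: add_in; exists n, I.
- by exists 0%N; apply: add_zero.
- exists (maxn a b); apply: (add_sum AB).
    by apply: add_hullS HA; apply: LS; apply: leq_maxl.
  by apply: add_hullS HB; apply: LS; apply: leq_maxr.
- by exists b; apply: add_summand AB HS.
Qed.

Hypothesis KI : preprojectives sigma = preinjectives F.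

Lemma preprojective_generator :
  (exists TQ : C, projective C TQ /\ forall P, projective C P -> add_hull [set TQ] P) ->
  exists T0 : C, K T0 /\ forall X, K X -> add_hull [set T0] X.
Proof.
move=> [TQ [projTQ TQP]].
have [b Lb] : exists b, add_hull (L b) TQ.
  by apply: translates_bound; rewrite -[add_hull _]KI; apply: projective_preprojective.
have Ub_TQ : add_hull (U b) (iter b sg TQ).
  by rewrite -{1}[b]add0n; apply: UL_iter; apply: add_hullS Lb => X; right.
(* [sigma] respects sums and summands only up to projectives; the images of these corrections
   accumulate in [U k]. *)
have iterP k P : projective C P -> add_hull ([set iter k sg TQ] `|` U k) (iter k sg P).
  move=> projP; elim: k => [|k IH].
    by apply: add_hullS (TQP P projP) => X; left.
  apply: (sigma_hull _ _ IH); first by apply: (@Q_hull k) => X; right.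
  move=> _ [->|[j [P' [jk projP' ->]]]]; apply: add_in; first by left.
  by right; exists j.+1, P'.
have iterb P : projective C P -> add_hull (U b) (iter b sg P).
  by move/(iterP b); apply: add_hull_sub => X [->|] //; apply: add_in.
have QU : projective C `<=` add_hull (U b).
  (* For b = 0 the set [U b] is empty, and [iterb] is already the claim. *)
  move=> P projP; case: b iterb {Lb Ub_TQ} => [|b] iterb; first exact: iterb P projP.
  exact: (@U_in b.+1 0 P).
have KU X : K X -> add_hull (U b) X.
  apply: add_hull_sub => _ [n [P [projP ->]]]; elim: n => [|n IH]; first exact: QU.
  apply: (sigma_hull QU _ IH) => _ [j [P' [jb projP' ->]]].
  have [jb'|jb'] := ltnP j.+1 b; first exact: (U_in jb').
  have Db : j.+1 = b by apply/eqP; rewrite eqn_leq jb jb'.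
  by rewrite -[sigma _]/(iter j.+1 sg P') Db; apply: iterb.
suff [T0 [KT0 T0P]] : exists T0 : C, K T0 /\ forall X, U b X -> add_hull [set T0] X.
  by exists T0; split=> // X /KU; apply: add_hull_sub.
(* T0 is the direct sum of the [sigma^k TQ] with k < b. *)
elim: b {Lb Ub_TQ iterb QU KU} => [|b [T0 [KT0 T0P]]].
  by have [O O0] := zero_ex C; exists O; split=> [|X [k [P []]]]; first exact: add_zero.
have [S [i1 [i2 [p1 [p2 bp]]]]] := biprod_ex T0 (iter b sg TQ).
have S_T0 : add_hull [set S] T0.
  apply: (add_summand (B := iter b sg TQ) (S := S)); last exact: add_in.
  by exists i1, i2, p1, p2.
have S_TQ : add_hull [set S] (iter b sg TQ).
  apply: (add_summand (B := T0) (S := S)); last exact: add_in.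
  by exists i2, i1, p2, p1; exact: biprod_sym.
have KS X : U b X -> add_hull [set S] X.
  by move/T0P; apply: add_hull_sub => _ ->.
exists S; split=> [|_ [k [P [kb projP ->]]]].
  apply: (add_sum _ KT0); first by exists i1, i2, p1, p2.
  by apply: add_in; exists b, TQ.
move: kb; rewrite ltnS leq_eqVlt => /predU1P[->|kb]; last by apply: KS; exists k, P.
by apply: add_hull_sub (iterP b P projP) => X [->|/KS].
Qed.

(** Pullbacks along projectives vanish anyway, so relativity has to be tested only on [sigma T0],
    where the pairing applies. *)
Lemma preprojective_sigma_generator T0 : (forall X, K X -> add_hull [set T0] X) ->
  forall X, K X -> add_hull (projective C `|` [set sg T0]) X.
Proof.
move=> T0P; apply: add_hull_sub => _ [[|n] [P [projP ->]]]; first by apply: add_in;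
  left.
have QV : projective C `<=` add_hull (projective C `|` [set sg T0]).
  by move=> Q projQ; apply: add_in; left.
apply: (sigma_hull QV _ (T0P (iter n sg P) _)); first by move=> _ ->; apply: add_in;
  right.
by apply: add_in; exists n, P.
Qed.

End PreprojectiveGenerator.

(** * The Frobenius structure of the preprojectives *)

Section RelativeStructure.
Variables (R : comPzRingType) (J : lmodType R) (C : extriCat R).
Variable sigma : functor (stableI C) (stableP C).
Variable pr : forall X B : C, ((sigma X : C) ~>[C] B) -> EE C B X -> J.
Arguments pr {X B} _ _.
Hypotheses (artR : artinian R) (fgJ : fin_gen J) (injJ : injective_in_mod J)
  (cogJ : cogenerates_mod J) (extfin : ext_finite C).
Hypotheses (wic : weakly_idempotent_complete C) (enoughP : enough_projectives C)
  (enoughI : enough_injectives C).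
Hypotheses (prP : ars_pairing (@pr)) (full_sigma : full sigma).
Local Notation push := (push (EE C)).
Local Notation pull := (pull (EE C)).
Local Notation conf d x y := (Defs.realz C d x y).
Local Notation K := (preprojectives sigma).
Local Notation KI := (preprojective_ideal sigma).
Local Notation sg := (fun X : C => (sigma X : C)).
Local Notation rel_ext := (rel_ext (inverse_translates sigma)).
Local Notation rel_ext_op := (rel_ext_op (inverse_translates sigma)).

(** The cogenerator property, applied to the map R -> E(B, X) with 1 |-> d, gives a form not
    vanishing on R d, and every form is some [pr f]. *)
Lemma pr_detect X B (d : EE C B X) : (forall f, pr f d = 0) -> d = 0.
Proof.
move=> pr0; apply: contrapT => d0.
have hL : linear (fun r : R^o => r *: d) by move=> a r s; rewrite scalerDl scalerA.
have [|f [m]] := cogJ (fin_gen_regular R) (extfin B X) (h := mklin hL).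
  by exists 1; rewrite mklinE scale1r.
by have [g <-] := pr_repr prP f; rewrite mklinE (linZ (pr_linear_r prP g)) pr0 scaler0.
Qed.

Lemma pull_sigma_push X A B (d : EE C B A) :
  (forall f : sg X ~> B, pull f d = 0) <-> (forall g : A ~> X, push g d = 0).
Proof.
split=> [d0 g|d0 f]; apply: pr_detect => u.
  have [s Ds] := quot_mor_surj (fmor sigma (quot_mor (inj_ideal C) g)).
  by rewrite -(pr_push prP u d (esym Ds)) (pr_pull prP) d0 (lin0 (pr_linear_r prP s)).
have [v Dv] := full_sigma (quot_mor (proj_ideal C) u : sigma A ~>[stableP C] sigma X).
have [g Dg] := quot_mor_surj v; rewrite -Dg in Dv.
by rewrite -(pr_pull prP) (pr_push prP f d Dv) d0 (lin0 (pr_linear_r prP f)).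
Qed.

(** One direction is closure of K under [sigma]; for the other, each generator of K is projective or
    the image under [sigma] of a generator. *)
Lemma rel_extE X A (d : EE C X A) : rel_ext d <-> rel_ext_op d.
Proof.
split=> [Hd Z k KZ|Hd].
  apply/pull_sigma_push: k => f; apply: Hd; exact: sigma_preprojective.
move=> Z k; apply: pull_hull => {}Z {}k [[|n] [P [projP DZ]]]; subst Z.
  by rewrite [pull k d]projP.
move: k; apply/(pull_sigma_push (iter n sg P)) => g; apply: Hd.
by apply: add_in; exists n, P.
Qed.

Variable T0 : C.
Hypotheses (KT0 : K T0) (T0P : forall X, K X -> add_hull [set T0] X).
Hypothesis injK : injectiveo C `<=` K.

Lemma rel_proj_ex (X : C) : exists (A Z : C) (d : EE C X A) (x : A ~> Z) (y : Z ~> X),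
  [/\ conf d x y, rel_ext d & K Z].
Proof.
(* The annihilator, under the pairing, of the maps f with f^* d = 0. Pushing d out enlarges that set
   of maps and shrinks S. *)
pose S A (d : EE C X A) : set (EE C X T0) :=
  [set e | forall f : sg T0 ~> X, pull f d = 0 -> pr f e = 0].
pose Phi : set (set (EE C X T0)) := [set S' | exists (A Z : C) (d : EE C X A) (x : A
  ~> Z)
  (y : Z ~> X), [/\ conf d x y, K Z & S' = S A d]].
have [||_ [[A [Z [d [x [y [xy KZ ->]]]]]] minS]] :=
    fin_gen_min artR (extfin X T0) (Phi := Phi).
- move=> _ [A [Z [d [_ [_ [_ _ ->]]]]]]; split=> [f _|a e e' He He' f fd].
    exact: lin0 (pr_linear_r prP f).
  by rewrite (pr_linear_r prP) He // He' // scaler0 addr0.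
- have [A [P [d [x [y [xy projP]]]]]] := enoughP X.
  by exists (S A d), A, P, d, x, y; split=> //; apply: projective_preprojective.
(* [conf_kill_pull] adds any given f to the killed maps, and by minimality S does not shrink; so e
   pairs to 0 with every f. *)
have S0 e : S A d e -> e = 0.
  move=> Se; apply: pr_detect => f.
  have [A' [Z' [a [x' [y' [xy' KZ' fd']]]]]] :=
    conf_kill_pull f xy KZ (sigma_preprojective wic enoughP KT0).
  have /(_ e Se) : S A d `<=` S A' (push a d).
    apply: minS; first by exists A', Z', (push a d), x', y'.
    by move=> e' He' g gd; apply: He'; rewrite -push_pull gd push0.
  exact.
exists A, Z, d, x, y; split=> //; apply/rel_extE => Y k KY.
(* For k : A -> T0 the class k_* d lies in S: its pairing with f equals a pairing of f^* d. *)
apply: push_hull (T0P KY) => {KY}Y {}k /= DY; subst Y; apply: S0 => f fd.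
have [s Ds] := quot_mor_surj (fmor sigma (quot_mor (inj_ideal C) k)).
by rewrite -(pr_push prP f d (esym Ds)) (pr_pull prP) fd (lin0 (pr_linear_r prP s)).
Qed.

Lemma rel_inj_ex (A : C) : exists (X Z : C) (d : EE C X A) (x : A ~> Z) (y : Z ~> X),
  [/\ conf d x y, rel_ext d & K Z].
Proof.
(* Dually, E(sigma T0, A) pairs with the maps sigma A -> sigma T0. By fullness these are stably
   sigma h with h : A -> T0, and S annihilates those with h_* d = 0. *)
pose S X (d : EE C X A) : set (EE C (sg T0) A) :=
  [set e | forall (h : A ~> T0) (s : sg A ~> sg T0),
     fmor sigma (quot_mor (inj_ideal C) h) = quot_mor (proj_ideal C) s ->
     push h d = 0 -> pr s e = 0].
pose Phi : set (set (EE C (sg T0) A)) := [set S' | exists (X Z : C) (d : EE C X A) (x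
  : A ~> Z)
  (y : Z ~> X), [/\ conf d x y, K Z & S' = S X d]].
have [||_ [[X [Z [d [x [y [xy KZ ->]]]]]] minS]] :=
    fin_gen_min artR (extfin (sg T0) A) (Phi := Phi).
- move=> _ [X [Z [d [_ [_ [_ _ ->]]]]]]; split=> [h s _ _|a e e' He He' h s hs hd].
    exact: lin0 (pr_linear_r prP s).
  by rewrite (pr_linear_r prP) (He h s) // (He' h s) // scaler0 addr0.
- have [X [I [d [x [y [xy injI]]]]]] := enoughI A.
  by exists (S X d), X, I, d, x, y; split=> //; apply: injK.
have S0 e : S X d e -> e = 0.
  move=> Se; apply: pr_detect => s.
  have [v Dv] := full_sigma (quot_mor (proj_ideal C) s : sigma A ~>[stableP C] sigma
    T0).
  have [h Dh] := quot_mor_surj v; rewrite -Dh in Dv.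
  have [X' [Z' [c [x' [y' [xy' KZ' hd']]]]]] := conf_kill_push h xy KZ KT0.
  have /(_ e Se) : S X d `<=` S X' (pull c d).
    apply: minS; first by exists X', Z', (pull c d), x', y'.
    by move=> e' He' g t gt gd; apply: (He' g t gt); rewrite push_pull gd pull0.
  by apply; [exact: Dv | exact: hd'].
exists X, Z, d, x, y; split=> // Y k KY.
apply: pull_hull (preprojective_sigma_generator wic enoughP T0P KY) => {KY}Y {}k.
case=> [projY|/= DY]; first by rewrite [pull k d]projY.
subst Y; apply: S0 => h s hs hd.
by rewrite -(pr_pull prP) (pr_push prP k d hs) hd (lin0 (pr_linear_r prP k)).
Qed.

Local Notation T := (quotCat KI).
Local Notation q := (quot_mor KI).

Definition preprojective_triangulation : triangulation T :=
  frobenius_triangulation rel_extE rel_proj_ex rel_inj_ex.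

Lemma proj_ideal_preprojective (X Y : C) (f : X ~> Y) :
  in_ideal (proj_ideal C) f -> in_ideal KI f.
Proof. apply: (proj_ideal_add enoughP); exact: projective_preprojective. Qed.

Lemma inj_ideal_preprojective (X Y : C) (f : X ~> Y) :
  in_ideal (inj_ideal C) f -> in_ideal KI f.
Proof. exact: inj_ideal_add. Qed.

(** Nondegeneracy on relative extensions. For a relative d with middle term in K, f^* d pairs with
    sigma g as f pairs with the relative class g_* d; so f^* d = 0 and f lifts to K. *)
Lemma pr_ideal X B (f : sg X ~> B) :
  (forall d, rel_ext d -> pr f d = 0) -> in_ideal KI f.
Proof.
move=> f0; have [A [Z [d [x [y [xy Hd KZ]]]]]] := rel_proj_ex B.
have [|l ->] := conf_lift_pull (c := f) xy; last exact: add_ideal_thru.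
apply: pr_detect => u.
have [v Dv] := full_sigma (quot_mor (proj_ideal C) u : sigma A ~>[stableP C] sigma X).
have [g Dg] := quot_mor_surj v; rewrite -Dg in Dv.
by rewrite -(pr_pull prP) (pr_push prP f d Dv) f0 //; apply: rel_push.
Qed.

Variable sigma1 : forall X Y : C, (X ~>[T] Y) -> (sigma X ~>[T] sigma Y).
Hypothesis sigma1P : is_functor (C := T) (D := T) sigma1.
Hypotheses (ind_sigma : induces sigma sigma1) (equiv_sigma : is_equivalence (Functor
  sigma1P)).

Theorem sigma_triangle_functor : triangle_functor preprojective_triangulation
  (Functor sigma1P).
Proof.
pose Sh X := Sg rel_inj_ex X.
pose c B X (h : B ~>[T] Sh X) : EE C B X := cls h.
(* The pairing of the identity with the extension classified by t; [TrE] recovers the whole pairing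
   from it. *)
pose Tr X (t : sg X ~>[T] Sh X) : J := pr (idm (sg X)) (c _ _ t).
have TrE X B (f : sg X ~>[C] B) (v : B ~>[T] Sh X) : Tr X (v \oc (q f : sg X ~>[T]
  B)) = pr f (c _ _ v).
  by rewrite /Tr /c cls_comp -(pr_pull prP) compm1.
apply: (@trace_triangle_functor R J T preprojective_triangulation (Functor sigma1P)
  equiv_sigma Tr).
- move=> X a s t; rewrite /Tr /c cls_linear.
  exact: (pr_linear_r prP).
- move=> X Y g t; have [g0 <-] := quot_mor_surj g.
  have [s Ds] := quot_mor_surj (fmor sigma (quot_mor (inj_ideal C) g0)).
  have -> : fmor (Functor sigma1P) (q g0) = q s by apply: ind_sigma; rewrite Ds.
  rewrite TrE /Tr /c [cls _](cls_Sg1 rel_extE) -(pr_push prP _ _ (esym Ds)).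
  by rewrite comp1m.
- move=> X B f; have [f0 <-] := quot_mor_surj f => f00.
  apply/quot_mor_eq0/pr_ideal => d Hd; have [v <-] := cls_surj rel_extE rel_inj_ex Hd.
  by rewrite -[cls v]/(c _ _ v) -TrE; apply: f00.
- move=> X B L [L0 L0' LL].
  (* Through [cls] the form lives on the relative extensions inside E(B, X), which Ext-finiteness
     makes finitely generated, and it is extended from there to all of E(B, X). *)
  pose G (e : EE C B X) (j : J) := exists2 v : B ~>[T] Sh X, e = c _ _ v & L v j.
  have [||La LaP] := ext_graphP artR fgJ injJ (V := EE C B X) (G := G).
  + exact: extfin.
  + split; first by exists 0 => //; rewrite /c (lin0 (@cls_linear _ _ _ _ _ _)).
      move=> j [v v0]; rewrite (_ : v = 0); first exact: L0'.
      by apply: cls_inj; rewrite (lin0 (@cls_linear _ _ _ _ _ _)).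
    move=> a e e' i j [v -> Lv] [v' -> Lv']; exists (a *: v + v'); last exact: LL.
    by rewrite /c cls_linear.
  have [f0 f0P] := pr_repr prP La; exists (q f0) => v j Lv.
  by rewrite TrE f0P; apply: LaP; exists v.
Qed.

End RelativeStructure.

Theorem proposition5p4 (R : comPzRingType) (J : lmodType R) (C : extriCat R)
    (D : ARS_duality J C) (tauV : functor (stableI C) (stableP C)) :
  artinian R ->
  min_inj_cogenerator J ->
  weakly_idempotent_complete C ->
  ext_finite C ->
  enough_projectives C ->
  enough_injectives C ->
  functorially_finite (projective C) ->
  functorially_finite (injectiveo C) ->
  krull_schmidt C ->
  finite_set (ind (projective C)) ->
  finite_set (ind (injectiveo C)) ->
  quasi_inverse (tau D) tauV ->
  preprojectives tauV = preinjectives (tau D) ->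
  let K := preprojective_ideal tauV in
  exists (S : triangulation (quotCat K))
    (tau1 : forall X Y : C,
      (X ~>[quotCat K] Y) -> (tau D X ~>[quotCat K] tau D Y))
    (tau1P : is_functor (C := quotCat K) (D := quotCat K) tau1),
    [/\ induces (tau D) tau1,
        is_equivalence (Functor tau1P)
      & triangle_functor S (Functor tau1P)].
Proof.
move=> artR [[fgJ injJ cogJ] _] wic extfin enoughP enoughI _ _ ksC finP _ qF KE K.
have [pr prP] := ars_pairing_ex qF.
have full_sigma : full tauV.
  by apply: equivalence_full; exists (tau D); apply: quasi_inverse_sym.
have injK : injectiveo C `<=` preprojectives tauV.
  by rewrite KE => I injI; apply: add_in; exists 0%N, I.
have [T0 [KT0 T0P]] := preprojective_generator wic enoughP qF.1 KE
  (projective_generator wic ksC finP).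
pose S := preprojective_triangulation artR cogJ extfin wic enoughP enoughI prP
  full_sigma
  KT0 T0P injK.
have PK := @proj_ideal_preprojective R C tauV enoughP.
have IK := inj_ideal_preprojective enoughI injK.
have tauK X : preprojectives tauV X -> preprojectives tauV (tau D X).
  rewrite KE; apply: (functor_hull (addC := ecat_additive C) wic (I1 := proj_ideal C)).
    by apply: (inj_ideal_add enoughI) => I injI; apply: add_in; exists 0%N, I.
  by move=> _ [n [I [injI ->]]]; apply: add_in; exists n.+1, I.
(* Only objects need checking: a morphism through Z in K goes to one through F Z, modulo I'. *)
have thru (I I' : ideal C) (F : functor (quotCat I) (quotCat I')) :
    (forall X Y (f : X ~>[C] Y), in_ideal I' f -> in_ideal K f) ->
    (forall X, preprojectives tauV X -> preprojectives tauV (F X)) ->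
    forall X Y (f : X ~>[C] Y) (t : (F X : C) ~>[C] (F Y : C)),
    in_ideal K f -> fmor F (quot_mor I f) = quot_mor I' t -> in_ideal K t.
  move=> I'K FK X Y _ t [Z [a [b [KZ ->]]]]; rewrite quot_morM fmorM.
  have [a' <-] := quot_mor_surj (fmor F (quot_mor I a)).
  have [b' <-] := quot_mor_surj (fmor F (quot_mor I b)).
  rewrite -quot_morM => /esym/quot_mor_eq/I'K Kt.
  have subm := ideal_submod K (F X : C) (F Y : C).
  rewrite -(subrK (b' \oc a') t); apply: (submoduleD subm) => //.
  exact/add_ideal_thru/FK.
have tauKK := thru _ _ (tau D) IK tauK.
have sigmaKK := thru _ _ tauV PK (sigma_preprojective wic enoughP).
have tau1P := induced_functor PK IK tauKK.
have sigma1P := induced_functor IK PK sigmaKK.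
have ind_tau := induced_induces PK IK tauKK.
have ind_sigma := induced_induces IK PK sigmaKK.
have q1 : quasi_inverse (Functor tau1P) (Functor sigma1P).
  split; first exact: induced_nat PK ind_tau ind_sigma qF.1.
  exact: induced_nat IK ind_sigma ind_tau qF.2.
exists S, (@induced_mor R C K _ _ (tau D)), tau1P; split=> //;
  first by exists (Functor sigma1P).
apply: (quasi_inverse_triangle_functor q1).
apply: (sigma_triangle_functor artR fgJ injJ) => //.
by exists (Functor tau1P); apply: quasi_inverse_sym.
Qed.
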